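(* Let $(G,o)$ be a unimodular random rooted graph with maximum degree at most $D$. Assume there is $h>0$ such that $i(G)\ge h$ with probability $1$. Then $\mathbb{E}\nu_{G,o}$ has only finitely many atoms.
   Context: The isoperimetric constant is $i(G)=\inf\{|\partial S|/|S| : \emptyset\ne S\subseteq V(G), |S|<\infty\}$, where $\partial S$ is the set of vertices not in $S$ having a neighbor in $S$. Matching measure: $\nu_{G,u}$ is the spectral measure at the one-vertex path $u$ of the adjacency operator of the path tree $T(G,u)$ (vertices: finite paths in $G$ starting at $u$; two paths adjacent iff one is obtained from the other by deleting its last vertex); $\mathbb{E}\nu_{G,o}$ is $E\mapsto\mathbb{E}[\nu_{G,o}(E)]$. A random rooted graph $(G,o)$ is unimodular if $\mathbb{E}\sum_v f(G,o,v)=\mathbb{E}\sum_v f(G,v,o)$ for all non-negative measurable $f$ on bi-rooted graphs. *)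

(* Defs.v *)
From HB Require Import structures.
From mathcomp Require Import all_boot all_order all_algebra.
From mathcomp Require Import all_classical all_reals all_analysis.
From mathcomp Require Import measurable_realfun.
Set Implicit Arguments.
Unset Strict Implicit.
Unset Printing Implicit Defensive.
Import Order.TTheory GRing.Theory Num.Theory.
Local Open Scope classical_set_scope.
Local Open Scope ring_scope.

Record lgraph := LGraph { lV : nat -> bool ; ladj : nat -> nat -> bool }.

Definition simple_graph (g : lgraph) : Prop :=
  (forall i j, ladj g i j = ladj g j i) /\
  (forall i, ~~ ladj g i i) /\
  (forall i j, ladj g i j -> lV g i && lV g j).

Definition max_degree_le (g : lgraph) (D : nat) : Prop :=
  forall v (s : seq nat), uniq s -> all (ladj g v) s -> (size s <= D)%N.

Definition rooted_connected (g : lgraph) (o : nat) : Prop :=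
  lV g o /\
  forall v, lV g v -> exists p : seq nat, path (ladj g) o p /\ last o p = v.

Definition graph_iso (g1 g2 : lgraph) (phi : nat -> nat) : Prop :=
  (forall i, lV g1 i -> lV g2 (phi i)) /\
  {in lV g1 &, injective phi} /\
  (forall j, lV g2 j -> exists2 i, lV g1 i & phi i = j) /\
  (forall i j, lV g1 i -> lV g1 j -> ladj g2 (phi i) (phi j) = ladj g1 i j).

Definition bigraph := (lgraph * nat * nat)%type.

(* Cylinder events generating the (local / product) sigma-algebra on bi-rooted
   labelled graphs. *)
Definition bigraph_cyl : set (set bigraph) :=
  [set A | (exists i, A = [set x : bigraph | lV x.1.1 i]) \/
           (exists i j, A = [set x : bigraph | ladj x.1.1 i j]) \/
           (exists i, A = [set x : bigraph | x.1.2 = i]) \/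
           (exists j, A = [set x : bigraph | x.2 = j])].

Definition bigraph_measurable (A : set bigraph) : Prop := <<s bigraph_cyl >> A.

(* Non-negative measurable functions on bi-rooted graphs that only depend on the
   isomorphism class (i.e. measurable functions on G_** ). *)
Definition transport_fun (R : realType) (f : bigraph -> \bar R) : Prop :=
  (forall x, (0 <= f x)%E) /\
  (forall B : set (\bar R), measurable B -> bigraph_measurable (f @^-1` B)) /\
  (forall g1 g2 phi u v, graph_iso g1 g2 phi -> lV g1 u -> lV g1 v ->
      f (g1, u, v) = f (g2, phi u, phi v)).

(* A random rooted graph on a probability space: every sample is a connected
   rooted simple graph, and the map omega |-> (G omega, o omega) is measurable for
   the product (local) sigma-algebra. *)
Definition random_rooted_graph d (Omega : measurableType d)
  (G : Omega -> lgraph) (o : Omega -> nat) : Prop :=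
  (forall w, simple_graph (G w) /\ rooted_connected (G w) (o w)) /\
  (forall i, measurable [set w | lV (G w) i]) /\
  (forall i j, measurable [set w | ladj (G w) i j]) /\
  (forall i, measurable [set w | o w = i]).

Definition unimodular d (Omega : measurableType d) (R : realType)
  (P : probability Omega R) (G : Omega -> lgraph) (o : Omega -> nat) : Prop :=
  forall f : bigraph -> \bar R, transport_fun f ->
    (\int[P]_w (\sum_(v <oo | lV (G w) v) f (G w, o w, v)))%E =
    (\int[P]_w (\sum_(v <oo | lV (G w) v) f (G w, v, o w)))%E.

Definition vboundary (g : lgraph) (S : set nat) : set nat :=
  [set w | lV g w /\ ~ S w /\ exists2 v, S v & ladj g v w].

Definition iso_const (R : realType) (g : lgraph) : \bar R :=
  ereal_inf [set r : \bar R | exists S : set nat,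
     [/\ finite_set S, S !=set0, S `<=` [set v | lV g v] &
         r = (counting (vboundary g S) * ((fine (counting S : \bar R))^-1)%:E)%E]].

(* Vertices of the path tree T(g,u): finite (self-avoiding) paths in g starting at u. *)
Definition is_gpath (g : lgraph) (u : nat) (p : seq nat) : bool :=
  if p is u' :: r then [&& u' == u, path (ladj g) u r, uniq p & all (lV g) p]
  else false.

Definition tree_adj (p q : seq nat) : bool :=
  ((size q == (size p).+1) && (take (size p) q == p)) ||
  ((size p == (size q).+1) && (take (size q) p == q)).

Definition closed_walks (g : lgraph) (u : nat) (k : nat) : set (seq (seq nat)) :=
  [set w | [/\ size w = k.+1, head [::] w = [:: u], last [::] w = [:: u],
              all (is_gpath g u) w & path tree_adj [:: u] (behead w)]].

(* [mu] is the spectral measure at the root of the adjacency operator of the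
   path tree T(g,u): its k-th moment equals <A^k d_root, d_root>, i.e. the
   number of closed walks of length k at the root of T(g,u).  (For bounded
   degree the operator is bounded self-adjoint and this determines mu.) *)
Definition matching_measure (R : realType) (g : lgraph) (u : nat)
    (mu : probability R R) : Prop :=
  forall k : nat, (\int[mu]_x ((x ^+ k)%:E))%E = counting (closed_walks g u k).

(* Main.v *)
(* For Im z > 0, let R_T(u) = r(u, T) / r(T) be the ratio of matching polynomials
   mu(G - T - u) / mu(G - T) in infinite volume; it maps the upper to the lower half-plane,
   and w_T(u) = lim i t R_T(u)(theta + i t) dominates the atom of the matching measure of
   G - T at theta.  Call u essential if w(u) > 0, and special if it is inessential with an
   essential neighbour.  A special vertex a splits a unit mass among its neighbours
   proportionally to w_a, only essential neighbours receiving a share.  Perturbing the weights on an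
   essential component K and using the sign of the imaginary part shows that the loads
   (atom plus received shares) of the vertices of K add up to at most 1.
   By mass transport, P(special) + E w(o) = E load(o); an infinite component has load 0, and if
   every finite component has at least N vertices then E load(o) <= P(K finite) / N, while
   the isoperimetric inequality gives h P(K finite) <= D P(special), as the boundary of K
   consists of special vertices.  For N >= D / h this forces E w(o) = 0.  So an atom theta
   requires a finite component K with fewer than D / h + 1 vertices; theta is then a root of the
   matching polynomial of K, and there are finitely many such polynomials. *)
Require Import Defs.
From HB Require Import structures.
From mathcomp Require Import all_boot all_order all_algebra.
From mathcomp Require Import complex finmap.
From mathcomp Require Import all_classical all_reals all_analysis.
From mathcomp Require Import measurable_realfun.
From mathcomp Require Import zify ring lra.
Import Order.TTheory GRing.Theory Num.Theory.
Import numFieldNormedType.Exports.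
Set Implicit Arguments.
Unset Strict Implicit.
Unset Printing Implicit Defensive.
Local Open Scope classical_set_scope.
Local Open Scope ring_scope.
Local Open Scope complex_scope.

(** * Matching polynomials of finite weighted graphs *)

(** No spectral theorem on [g] itself is available for matching polynomials. What replaces it is the
    recursion 1/G(u) = z - (sum of G(v) in the graph minus u), which keeps G in the lower
    half-plane. This positivity, known at finite volume and Im z > 0, must survive two limits: first
    the volume, where a contraction makes the limit exist and forget the labels, then t to 0, where
    the two-point Pick inequality makes Re (i t G) monotone. As denominators may vanish in a limit,
    signs are carried by Im (a conj b) and not by quotients. The load bound rests on a cancellation:
    deleting two vertices of one essential component is negligible to leading order. Hence, when the
    imaginary masses on S and the edges from S to special vertices are scaled by 1 + sigma, the
    normalised polynomial tends to 1 + sigma load(S), affine in sigma; sigma = -1 is the edge of the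
    range where positivity holds. Of the path tree only nu({theta}) <= w(o) is used. It follows from
    the moments, by test polynomials on finite truncations of the tree. *)

Section MatchingPolynomial.
Variables (K : comNzRingType) (x : nat -> K) (c : nat -> nat -> K).

(** Signed sum over matchings, with mass [x u] for an uncovered vertex and weight [c u v] for an
    edge, expanded along the head of the list. The fuel [n] is there because [rem v s'] is not a
    structural subterm; any [n] at least the size gives the same value. *)
Fixpoint mu_rec (n : nat) (s : seq nat) : K :=
  match n, s with
  | n'.+1, u :: s' =>
      x u * mu_rec n' s' - \sum_(v <- s') c u v * mu_rec n' (rem v s')
  | _, _ => 1
  end.

Definition mu (s : seq nat) : K := mu_rec (size s) s.

Lemma mu_rec_fuel n s : (size s <= n)%N -> mu_rec n s = mu s.
Proof.
rewrite /mu; elim: n {-2}n (leqnn n) s => [|N IH] [|n] // leN [|u s] //= ls.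
congr (_ - _); first by congr (_ * _); apply: IH.
rewrite [LHS]big_seq [RHS]big_seq; apply: eq_bigr => v vs; congr (_ * _).
have sr : (size (rem v s) <= size s)%N by rewrite size_rem // leq_pred.
rewrite IH ?(leq_trans sr) // -(IH (size s)) //.
exact: leq_trans ls leN.
Qed.

Lemma mu_nil : mu [::] = 1. Proof. by []. Qed.

Lemma mu_cons u s :
  mu (u :: s) = x u * mu s - \sum_(v <- s) c u v * mu (rem v s).
Proof.
rewrite {1}/mu /=; congr (_ - _); rewrite [LHS]big_seq [RHS]big_seq.
apply: eq_bigr => v vs; rewrite mu_rec_fuel // size_rem //; exact: leq_pred.
Qed.

Lemma rem_comm (u v : nat) s : uniq s -> rem u (rem v s) = rem v (rem u s).
Proof.
by move=> us; rewrite !(rem_filter, rem_uniq, filter_uniq) // -!filter_predI;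
  apply: eq_filter => w /=; rewrite andbC.
Qed.

Hypothesis c_sym : forall u v, c u v = c v u.

(** Expanding at both vertices leaves, apart from visibly symmetric terms, a double sum over
    distinct partners of [u] and [v]; it is symmetric because deletions commute. This is the
    transposition case of invariance under reordering, which allows expansion at any vertex. *)
Lemma mu_swap u v s :
  uniq (u :: v :: s) -> mu (u :: v :: s) = mu (v :: u :: s).
Proof.
rewrite /= inE negb_or => /andP[/andP[uv us] /andP[vs Us]].
have H a b : a != b -> a \notin s -> b \notin s -> mu (a :: b :: s) =
   x a * x b * mu s - x a * (\sum_(w <- s) c b w * mu (rem w s))
   - (c a b * mu s + (x b * \sum_(w <- s) c a w * mu (rem w s)
      - \sum_(w <- s) \sum_(w' <- s | w' != w) c a w * c b w' * mu (rem w' (rem w s)))).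
  move=> ab as_ bs; rewrite mu_cons [mu (b :: s)]mu_cons big_cons /= eqxx.
  congr (_ - _); first by rewrite mulrBr mulrA.
  congr (_ + _); rewrite mulr_sumr -sumrB [LHS]big_seq [RHS]big_seq.
  apply: eq_bigr => w ws; have [bw|bw] := eqVneq b w.
    by rewrite -bw (negPf bs) in ws.
  rewrite mu_cons mulrBr; congr (_ - _); first by ring.
  rewrite mulr_sumr {1}rem_filter // big_filter; apply: eq_bigr => w' _.
  by rewrite mulrA.
rewrite !H // 1?eq_sym // (c_sym u v).
suff -> : \sum_(w <- s) \sum_(w' <- s | w' != w) c u w * c v w' * mu (rem w' (rem w s))
  = \sum_(w <- s) \sum_(w' <- s | w' != w) c v w * c u w' * mu (rem w' (rem w s)) by ring.
rewrite (exchange_big_dep predT) //=; apply: eq_bigr => w _.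
by apply: eq_big => [w'|w' _]; rewrite 1?eq_sym // rem_comm //; ring.
Qed.

Lemma mu_perm s t : uniq s -> perm_eq s t -> mu s = mu t.
Proof.
elim: {s}(size s) {-2}s (leqnn (size s)) t => [|n IH] s.
  by rewrite leqn0 => /nilP -> t _; rewrite perm_sym => /perm_nilP ->.
have cons u a b : (size a <= n)%N -> uniq a -> perm_eq a b -> mu (u :: a) = mu (u :: b).
  move=> sa ua pab; rewrite !mu_cons; congr (_ - _); first by congr (_ * _); apply: IH.
  rewrite (perm_big _ pab) [LHS]big_seq [RHS]big_seq; apply: eq_bigr => v vb.
  congr (_ * _); apply: IH; rewrite ?rem_uniq //.
    by rewrite size_rem ?(perm_mem pab) // (leq_trans (leq_pred _)).
  rewrite -(perm_cons v) -(permPl (perm_to_rem _)) ?(perm_mem pab) //.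
  by rewrite (perm_trans pab) // perm_to_rem.
have front u t : (size t <= n.+1)%N -> uniq t -> u \in t -> mu t = mu (u :: rem u t).
  elim: t => // w t IHt; rewrite ltnS => st /= /andP[wt ut].
  have [->//|wu] := eqVneq w u; rewrite inE eq_sym (negPf wu) /= => uint.
  rewrite (cons w t (u :: rem u t)) ?perm_to_rem // mu_swap //.
    by rewrite /= inE (negPf wu) mem_rem_uniq // inE (negPf wu) (negPf wt) rem_uniq // mem_rem_uniq // inE eqxx.
case: s => [|u s] ls t; first by rewrite perm_sym => _ /perm_nilP ->.
move=> us pst; have ut : u \in t by rewrite -(perm_mem pst) mem_head.
have Ut : uniq t by rewrite -(perm_uniq pst).
rewrite (front u t) // -?(perm_size pst) //.
apply: cons => //; first by case/andP: us.
by rewrite -(perm_cons u) (perm_trans pst) // perm_to_rem.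
Qed.

End MatchingPolynomial.

Lemma eq_mu (K : comNzRingType) (x x' : nat -> K) c c' s :
  {in s, x =1 x'} -> {in s &, c =2 c'} -> mu x c s = mu x' c' s.
Proof.
elim: {s}(size s) {-2}s (leqnn (size s)) => [|n IH] s.
  by rewrite leqn0 => /nilP ->.
case: s => [|u s] //= ls ex ec; rewrite !mu_cons.
have sub (t : seq nat) : {subset t <= s} -> {in t, x =1 x'} * {in t &, c =2 c'}.
  by move=> ts; split=> [v /ts vs|v w /ts vs /ts ws];
     rewrite ?ex ?ec // inE ?vs ?ws orbT.
congr (_ - _).
  by rewrite ex ?mem_head // IH //; case: (sub s).
rewrite [LHS]big_seq [RHS]big_seq; apply: eq_bigr => v vs.
rewrite ec ?mem_head // ?inE ?vs ?orbT //; congr (_ * _).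
have [h1 h2] := sub (rem v s) (@mem_rem _ _ _).
by apply: IH => //; rewrite size_rem // (leq_trans (leq_pred _)).
Qed.

Lemma mu_map (K : comNzRingType) (x : nat -> K) c (phi : nat -> nat) s :
  {in s &, injective phi} ->
  mu x c [seq phi i | i <- s] = mu (x \o phi) (fun i j => c (phi i) (phi j)) s.
Proof.
elim: {s}(size s) {-2}s (leqnn (size s)) => [|n IH] s.
  by rewrite leqn0 => /nilP ->.
case: s => [|u s] //= ls inj; rewrite !mu_cons.
have sub (t : seq nat) : {subset t <= s} -> {in t &, injective phi}.
  by move=> ts v w /ts vs /ts ws; apply: inj; rewrite inE ?vs ?ws orbT.
congr (_ - _); first by rewrite IH //; apply: sub.
rewrite big_map [LHS]big_seq [RHS]big_seq; apply: eq_bigr => v vs.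
congr (_ * _); rewrite -IH; first last.
- by apply: sub; apply: mem_rem.
- by rewrite size_rem // (leq_trans (leq_pred _)).
congr mu; have {}inj := sub s (fun _ => id).
elim: s vs inj {IH ls sub} => //= w s IHs vs inj.
have [->|wv] := eqVneq w v; first by rewrite eqxx.
rewrite inE eq_sym (negPf wv) /= in vs.
rewrite ifN /= ?IHs //.
  by move=> a b ha hb; apply: inj; rewrite inE ?ha ?hb orbT.
by apply: contraNneq wv => /inj ->//; rewrite inE ?eqxx ?vs ?orbT.
Qed.

(** The case of interest is evaluation of polynomials: it turns [mu] with mass ['X] into its value
    at a point. *)
Lemma mu_rmorph (K K' : comNzRingType) (f : {rmorphism K -> K'}) x c s :
  f (mu x c s) = mu (f \o x) (fun u v => f (c u v)) s.
Proof.
elim: {s}(size s) {-2}s (leqnn (size s)) => [|n IH] s.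
  by rewrite leqn0 => /nilP ->; rewrite !mu_nil rmorph1.
case: s => [|u s] ls; first by rewrite !mu_nil rmorph1.
rewrite !mu_cons rmorphB rmorphM IH //=; congr (_ - _).
rewrite rmorph_sum [LHS]big_seq [RHS]big_seq; apply: eq_bigr => v vs.
by rewrite rmorphM IH // size_rem // (leq_trans (leq_pred _)).
Qed.

Section Deletion.
Variables (K : comNzRingType) (x : nat -> K) (c : nat -> nat -> K).
Hypothesis c_sym : forall u v, c u v = c v u.

(* [muD F T] is the matching polynomial of the graph induced on [F], with the
   vertices of [T] deleted. *)
Definition muD (F T : seq nat) : K := mu x c [seq v <- F | v \notin T].

Lemma eq_muD F T T' : T =i T' -> muD F T = muD F T'.
Proof. by move=> TT; congr mu; apply: eq_filter => v; rewrite TT. Qed.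

Lemma muD_notin F T u : u \notin F -> muD F (u :: T) = muD F T.
Proof.
move=> uF; congr mu; apply: eq_in_filter => v vF; rewrite inE negb_or.
by case: eqVneq vF => // ->; rewrite (negPf uF).
Qed.

Lemma muD_expand F T u : uniq F -> u \in F -> u \notin T ->
  muD F T = x u * muD F (u :: T)
            - \sum_(v <- F | v \notin u :: T) c u v * muD F (v :: u :: T).
Proof.
move=> UF uF uT.
have h v T' : [seq w <- F | w \notin v :: T'] = rem v [seq w <- F | w \notin T'].
  rewrite rem_filter ?filter_uniq // -filter_predI; apply: eq_filter => w.
  by rewrite inE negb_or.
rewrite {1}/muD (@mu_perm _ _ _ c_sym _ (u :: [seq v <- F | v \notin u :: T])).
- rewrite mu_cons big_filter; congr (_ - _); apply: eq_bigr => v _.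
  by congr (_ * _); rewrite /muD (h v).
- exact: filter_uniq.
by rewrite h perm_to_rem // mem_filter uT.
Qed.

End Deletion.

(** * Complex numbers and positive semidefinite 2x2 matrices *)

Section ComplexPreliminaries.
Variable R : realType.
Implicit Types (z w : R[i]) (a b : R).

(** Squared modulus as an element of [R], so that estimates take place in the real field. *)
Definition nsq z : R := complex.Re z ^+ 2 + complex.Im z ^+ 2.

Lemma nsq_ge0 z : 0 <= nsq z. Proof. by rewrite addr_ge0 ?sqr_ge0. Qed.

Lemma nsq_gt0 z : (0 < nsq z) = (z != 0).
Proof.
rewrite lt_neqAle nsq_ge0 andbT eq_sym /nsq paddr_eq0 ?sqr_ge0 // !sqrf_eq0.
by case: z => a b; rewrite eq_complex.
Qed.

Lemma nsqM z w : nsq (z * w) = nsq z * nsq w.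
Proof. by case: z w => a b [a' b']; rewrite /nsq /=; ring. Qed.

Lemma nsqJ z : nsq (conjc z) = nsq z.
Proof. by case: z => a b; rewrite /nsq /=; ring. Qed.

Lemma nsqN z : nsq (- z) = nsq z.
Proof. by case: z => a b; rewrite /nsq /=; ring. Qed.

Lemma nsqR a : nsq a%:C = a ^+ 2.
Proof. by rewrite /nsq /=; ring. Qed.

Lemma ReV z : complex.Re z^-1 = complex.Re z / nsq z.
Proof. by case: z => a b. Qed.

Lemma ImV z : complex.Im z^-1 = - complex.Im z / nsq z.
Proof. by case: z => a b; rewrite /= mulNr. Qed.

Lemma nsqV z : nsq z^-1 = (nsq z)^-1.
Proof.
have [->|z0] := eqVneq z 0; first by rewrite invr0 /nsq /= expr0n /= addr0 invr0.
have nz : nsq z != 0 by rewrite gt_eqF // nsq_gt0.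
by apply: (mulIf nz); rewrite mulVf // -nsqM mulVf // /nsq /=; ring.
Qed.

Lemma ReD z w : complex.Re (z + w) = complex.Re z + complex.Re w.
Proof. by case: z w => a b []. Qed.
Lemma ImD z w : complex.Im (z + w) = complex.Im z + complex.Im w.
Proof. by case: z w => a b []. Qed.
Lemma ReN z : complex.Re (- z) = - complex.Re z.
Proof. by case: z. Qed.
Lemma ImN z : complex.Im (- z) = - complex.Im z.
Proof. by case: z. Qed.
Lemma Re_mul z w : complex.Re (z * w) =
  complex.Re z * complex.Re w - complex.Im z * complex.Im w.
Proof. by case: z w => a b []. Qed.
Lemma Im_mul z w : complex.Im (z * w) =
  complex.Re z * complex.Im w + complex.Im z * complex.Re w.
Proof. by case: z w => a b []. Qed.
Lemma Im_sum I (r : seq I) P (F : I -> R[i]) :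
  complex.Im (\sum_(i <- r | P i) F i) = \sum_(i <- r | P i) complex.Im (F i).
Proof. exact: (big_morph _ ImD). Qed.
(* [z] is an admissible off-diagonal entry of a positive semidefinite hermitian
   2x2 matrix with diagonal [a], [b]; such triples form a convex cone. *)
Definition psd2 z a b := [/\ 0 <= a, 0 <= b & nsq z <= a * b].

(** Cauchy-Schwarz bounds the square of the cross term by (a b')(a' b), and the arithmetic-geometric
    mean inequality bounds twice its root by a b' + a' b. *)
Lemma psd2D z a b w a' b' :
  psd2 z a b -> psd2 w a' b' -> psd2 (z + w) (a + a') (b + b').
Proof.
move=> [a0 b0 zab] [a0' b0' wab]; split; rewrite ?addr_ge0 //.
have -> : nsq (z + w) = nsq z + nsq w + 2 * complex.Re (z * (conjc w)).
  by case: z w {zab wab} => p q [p' q']; rewrite /nsq /=; ring.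
suff : 2 * complex.Re (z * (conjc w)) <= a * b' + a' * b by move: zab wab; nra.
have : complex.Re (z * (conjc w)) ^+ 2 <= (a * b) * (a' * b').
  apply: (@le_trans _ _ (nsq z * nsq w)); last by rewrite ler_pM ?nsq_ge0.
  by rewrite -(nsqJ w) -nsqM /nsq lerDl sqr_ge0.
set r := complex.Re _ => hr.
have h0 : 0 <= a * b' + a' * b by rewrite addr_ge0 ?mulr_ge0.
have [r0|r0] := lerP r 0; first by apply: le_trans h0; lra.
rewrite -ler_sqr ?nnegrE ?mulr_ge0 //; last exact: ltW.
by have := sqr_ge0 (a * b' - a' * b); nra.
Qed.

Lemma psd2Z k z a b : 0 <= k -> psd2 z a b -> psd2 (k%:C * z) (k * a) (k * b).
Proof.
move=> k0 [a0 b0 zab]; split; rewrite ?mulr_ge0 // nsqM nsqR.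
by have := ler_wpM2l (sqr_ge0 k) zab; nra.
Qed.

Lemma psd2R a : 0 <= a -> psd2 a%:C a a.
Proof. by move=> a0; split => //; rewrite nsqR expr2. Qed.

Lemma psd2_sum (I : eqType) (r : seq I) (P : pred I) (c : I -> R) (z : I -> R[i])
    (a b : I -> R) :
  (forall i, 0 <= c i) -> (forall i, i \in r -> P i -> psd2 (z i) (a i) (b i)) ->
  psd2 (\sum_(i <- r | P i) (c i)%:C * z i)
       (\sum_(i <- r | P i) c i * a i) (\sum_(i <- r | P i) c i * b i).
Proof.
move=> c0 h; elim: r h => [|i r IH] h.
  by rewrite !big_nil; split; rewrite // /nsq /=; lra.
have {}IH : psd2 (\sum_(i <- r | P i) (c i)%:C * z i)
       (\sum_(i <- r | P i) c i * a i) (\sum_(i <- r | P i) c i * b i).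
  by apply: IH => j jr; apply: h; rewrite inE jr orbT.
rewrite !big_cons; case: ifP => // Pi.
by apply: psd2D IH; apply: psd2Z => //; apply: h; rewrite ?mem_head.
Qed.

End ComplexPreliminaries.

(** * Green functions of finite graphs in the upper half-plane *)

Section FiniteGraph.
Variables (R : realType) (x : nat -> R[i]) (c : nat -> nat -> R).
Hypothesis c_sym : forall u v, c u v = c v u.
Hypothesis c_ge0 : forall u v, 0 <= c u v.
Hypothesis x_gt0 : forall v, 0 < complex.Im (x v).

Definition muC (F T : seq nat) : R[i] := muD x (fun u v => (c u v)%:C) F T.
Definition green F T u : R[i] := muC F (u :: T) / muC F T.

Variable F : seq nat.
Hypothesis uF : uniq F.

Let c_symC u v : (c u v)%:C = (c v u)%:C. Proof. by rewrite c_sym. Qed.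

Let count_del T u : u \in F -> u \notin T ->
  (count (fun v => v \notin u :: T) F < count (fun v => v \notin T) F)%N.
Proof.
move=> uin uT; rewrite -!size_filter.
have -> : [seq v <- F | v \notin u :: T] = rem u [seq v <- F | v \notin T].
  rewrite rem_filter ?filter_uniq // -filter_predI; apply: eq_filter => w.
  by rewrite inE negb_or.
rewrite size_rem ?mem_filter ?uT // prednK // -has_predT.
by apply/hasP; exists u; rewrite ?mem_filter ?uT.
Qed.

(** The Heilmann-Lieb argument: nonvanishing and the sign of the Green functions are proved together
    by induction on the number of remaining vertices, since the recursion divides by
    [muC F (u :: T)] and adds only nonnegative terms to Im (x u). *)
Lemma upper_half_plane T :
  muC F T != 0 /\
  (forall u, u \in F -> u \notin T ->
     [/\ (green F T u)^-1 = x u - \sum_(v <- F | v \notin u :: T)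
                                    (c u v)%:C * green F (u :: T) v,
         complex.Im (x u) <= complex.Im (green F T u)^-1
       & complex.Im (green F T u) < 0]).
Proof.
elim: {T}_.+1 {-2}T (ltnSn (count (fun v => v \notin T) F)) => // n IH T leT.
have key u : u \in F -> u \notin T -> muC F (u :: T) != 0 /\
   exists2 w, muC F T = w * muC F (u :: T) &
     complex.Im (x u) <= complex.Im w /\
     w = x u - \sum_(v <- F | v \notin u :: T) (c u v)%:C * green F (u :: T) v.
  move=> uin uT.
  have [n0 gr] := IH (u :: T) (leq_trans (count_del uin uT) leT).
  split=> //; exists (x u - \sum_(v <- F | v \notin u :: T)
      (c u v)%:C * green F (u :: T) v).
    rewrite {1}/muC (muD_expand _ c_symC uF uin uT) mulrBl; congr (_ - _).
    by rewrite mulr_suml; apply: eq_bigr => v _; rewrite /green -mulrA divfK.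
  split=> //; rewrite ImD ImN Im_sum lerDl oppr_ge0 big_seq_cond sumr_le0 //.
  move=> v /andP[vF vT]; have [_ _ h] := gr v vF vT.
  by rewrite Im_mul /= mul0r addr0 mulr_ge0_le0 // ltW.
have imn0 (w : R[i]) : 0 < complex.Im w -> w != 0.
  by apply: contraTneq => ->; rewrite /= ltxx.
have nT : muC F T != 0.
  have [/hasP[u uin uT]|] := boolP (has (fun v => v \notin T) F).
    have [n0 [w -> [xw _]]] := key u uin uT.
    by rewrite mulf_neq0 // imn0 // (lt_le_trans _ xw).
  rewrite has_filter negbK /muC /muD => /eqP ->.
  by rewrite mu_nil oner_neq0.
split=> // u uin uT; have [n0 [w e [xw we]]] := key u uin uT.
have wi : (green F T u)^-1 = w by rewrite /green invf_div e mulfK.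
rewrite wi; split=> //; rewrite -[green _ _ _]invrK wi ImV mulNr oppr_lt0.
have Iw : 0 < complex.Im w by rewrite (lt_le_trans _ xw).
by rewrite divr_gt0 // nsq_gt0 imn0.
Qed.

Lemma muC_neq0 T : muC F T != 0.
Proof. by case: (upper_half_plane T). Qed.

Lemma green_inv T u : u \in F -> u \notin T ->
  (green F T u)^-1 = x u - \sum_(v <- F | v \notin u :: T)
                            (c u v)%:C * green F (u :: T) v.
Proof. by move=> uin uT; case: (upper_half_plane T) => _ /(_ u uin uT)[]. Qed.

Lemma green_Im T u : u \in F -> u \notin T -> complex.Im (green F T u) < 0.
Proof. by move=> uin uT; case: (upper_half_plane T) => _ /(_ u uin uT)[]. Qed.

Lemma green_neq0 T u : green F T u != 0.
Proof. by rewrite mulf_neq0 ?invr_eq0 ?muC_neq0. Qed.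

Lemma greenV_Im_ge T u : u \in F -> u \notin T ->
  complex.Im (x u) <= complex.Im (green F T u)^-1.
Proof. by move=> uin uT; case: (upper_half_plane T) => _ /(_ u uin uT)[]. Qed.

(* The part of the self-energy at [u] that comes from a subset of the edges is
   again in the closed lower half-plane. *)
Lemma greenV_Im_part T u (A : pred nat) : u \in F -> u \notin T ->
  complex.Im (x u) <= complex.Im ((green F T u)^-1
    + \sum_(v <- F | (v \notin u :: T) && A v) (c u v)%:C * green F (u :: T) v).
Proof.
move=> uin uT; rewrite green_inv // (bigID A) /= opprD addrA addrAC subrK.
rewrite ImD ImN Im_sum lerDl oppr_ge0 big_seq_cond sumr_le0 //.
move=> v /andP[vF /andP[vT _]]; rewrite Im_mul /= mul0r addr0 mulr_ge0_le0 //.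
by rewrite ltW // green_Im.
Qed.

(** Im (1/G) equals -Im G / |G|^2, so the lower bound on it becomes a Ward inequality, the source of
    the a priori bounds on G. *)
Lemma green_ward T u : u \in F -> u \notin T ->
  complex.Im (x u) * nsq (green F T u) <= - complex.Im (green F T u).
Proof.
move=> uin uT; have := greenV_Im_ge uin uT; rewrite ImV.
by rewrite ler_pdivlMr // nsq_gt0 green_neq0.
Qed.

End FiniteGraph.

(** * Nevanlinna-Pick positivity of the Green function *)

Lemma del_ind (F : seq nat) (P : seq nat -> Prop) :
  (forall T, (forall u, u \in F -> u \notin T -> P (u :: T)) -> P T) ->
  forall T, P T.
Proof.
move=> H T; elim: {T}_.+1 {-2}T (ltnSn (count (fun v => v \notin T) F)) => // n IH T leT.
apply: H => u uin uT; apply: IH; rewrite ltnS in leT; apply: leq_trans leT.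
elim: F uin => // w F IHF uwF.
have le F' : (count (fun v => v \notin u :: T) F' <= count (fun v => v \notin T) F')%N.
  by apply: sub_count => v; rewrite inE negb_or => /andP[].
rewrite /= [w \in u :: T]inE negb_or; case: (eqVneq w u) => [->|wu] /=.
  by rewrite uT add0n add1n ltnS.
by rewrite ltn_add2l IHF //; move: uwF; rewrite inE eq_sym (negPf wu).
Qed.

Lemma psd2M (R : realType) (p q z : R[i]) (a b : R) :
  psd2 z a b -> psd2 (p * q * z) (nsq p * a) (nsq q * b).
Proof.
move=> [a0 b0 h]; split; rewrite ?mulr_ge0 ?nsq_ge0 // !nsqM.
have := ler_wpM2l (mulr_ge0 (nsq_ge0 p) (nsq_ge0 q)) h; lra.
Qed.

Lemma psd2_le (R : realType) (z : R[i]) (a b a' b' : R) :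
  psd2 z a b -> a <= a' -> b <= b' -> psd2 z a' b'.
Proof.
move=> [a0 b0 h] aa bb; split; try exact: le_trans aa; try exact: le_trans bb.
by apply: le_trans h _; apply: ler_pM.
Qed.

Lemma subr_invM (K : fieldType) (a b : K) : a != 0 -> b != 0 ->
  a - b = a * b * (b^-1 - a^-1).
Proof. by move=> a0 b0; field; rewrite a0. Qed.

Lemma subr_shuffle (V : zmodType) (a b p q : V) :
  a - p - (b - q) = (a - b) + (q - p).
Proof. by rewrite opprB addrACA [RHS]addrACA [- p - b]addrC. Qed.

Lemma mul_divi (K : fieldType) (i a y : K) : i * i = -1 -> a != 0 ->
  i / a * (- i * a * y) = y.
Proof.
move=> i2 a0; have -> : i / a * (- i * a * y) = - (i * i) * (a / a) * y by ring.
by rewrite i2 opprK mulfV // !mul1r.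
Qed.

Lemma conj_subZ (R : realType) (a : R[i]) I (r : seq I) (P : pred I) (k : I -> R)
    (z : I -> R[i]) :
  (conjc (a - \sum_(j <- r | P j) (k j)%:C * z j)) =
  (conjc a) - \sum_(j <- r | P j) (k j)%:C * (conjc (z j)).
Proof.
have jD : {morph @conjc R : p q / p + q} by move=> [p q] [p' q']; rewrite /= opprD.
have j0 : (conjc (0 : R[i])) = 0 by rewrite conjc0.
have -> (p q : R[i]) : (conjc (p - q)) = (conjc p) - (conjc q) by case: p q => p p' [q q']; rewrite /= opprD.
congr (_ - _); rewrite (big_morph _ jD j0).
by apply: eq_bigr => j _; case: (z j) => p q; congr (_ +i* _); ring.
Qed.

(** Off-diagonal entry -(a - conj b) / (z - conj z') of the Pick matrix of the negated Green
    function at z = theta + i s and z' = theta + i t, where z - conj z' = i (s + t). For s = t and a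
    = b it reduces to -Im a / s. *)
Definition pick_kernel (R : realType) (s t : R) (a b : R[i]) : R[i] :=
  (0 +i* 1) / (s + t)%:C * (a - conjc b).

(** From a - conj b = a conj b (1 / conj b - 1 / a), the kernel at a vertex is a rank-one factor
    times a nonnegative combination of [y] and the kernels at the neighbours; both operations
    preserve [psd2]. *)
Lemma pick_step (R : realType) (I : eqType) (r : seq I) (P : pred I) (k : I -> R)
    (p q : I -> R[i]) (a b : R[i]) (th s t y : R) :
  (forall j, 0 <= k j) -> 0 < s -> 0 < t -> 0 < y -> a != 0 -> b != 0 ->
  a^-1 = (th +i* (s * y)) - \sum_(j <- r | P j) (k j)%:C * p j ->
  b^-1 = (th +i* (t * y)) - \sum_(j <- r | P j) (k j)%:C * q j ->
  (forall j, j \in r -> P j -> psd2 (pick_kernel s t (p j) (q j))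
     (- complex.Im (p j) / s) (- complex.Im (q j) / t)) ->
  psd2 (pick_kernel s t a b) (- complex.Im a / s) (- complex.Im b / t).
Proof.
move=> k0 s0 t0 y0 a0 b0 ea eb H.
have im d w e : 0 < d -> w != 0 -> w^-1 = (th +i* (d * y)) - \sum_(j <- r | P j) (k j)%:C * e j ->
    - complex.Im w / d = nsq w * (y + \sum_(j <- r | P j) k j * (- complex.Im (e j) / d)).
  move=> d0 w0 /(congr1 (@complex.Im R)); rewrite ImV ImD ImN Im_sum /= => h.
  have n0 : nsq w != 0 by rewrite gt_eqF // nsq_gt0.
  have -> : - complex.Im w = (- complex.Im w / nsq w) * nsq w by rewrite divfK.
  rewrite h mulrAC mulrC; congr (_ * _).
  rewrite mulrDl mulrAC mulfV ?gt_eqF // mul1r; congr (_ + _).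
  rewrite mulNr mulr_suml -sumrN; apply: eq_bigr => v _.
  by rewrite Im_mul /= mul0r addr0 mulNr mulrN mulrA.
rewrite (im s a p) // (im t b q) //.
have -> : pick_kernel s t a b = a * conjc b *
    (y%:C + \sum_(j <- r | P j) (k j)%:C * pick_kernel s t (p j) (q j)).
  have bJ : conjc b != 0 by rewrite conjc_eq0.
  move/(congr1 (@conjc R)): eb; rewrite conjc_inv conj_subZ => eb.
  have st0 : (s + t)%:C != 0 :> R[i] by rewrite -nsq_gt0 nsqR exprn_gt0 // addr_gt0.
  rewrite {1}/pick_kernel (subr_invM a0 bJ) mulrCA; congr (_ * _).
  rewrite ea eb subr_shuffle.
  have -> : conjc (th +i* (t * y)) - (th +i* (s * y)) = - (0 +i* 1) * (s + t)%:C * y%:C.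
    by congr (_ +i* _); ring.
  rewrite -sumrB mulrDr; congr (_ + _).
    by apply: mul_divi => //; congr (_ +i* _); ring.
  rewrite mulr_sumr; apply: eq_bigr => v _; rewrite /pick_kernel -mulrBr.
  by rewrite mulrCA.
rewrite -(nsqJ b); apply: psd2M; apply: psd2D; first exact: psd2R (ltW _).
exact: psd2_sum.
Qed.

Lemma pick_real (R : realType) (s t : R) (a b : R[i]) : 0 < s -> 0 < t ->
  psd2 (pick_kernel s t a b) (- complex.Im a / s) (- complex.Im b / t) ->
  let p := (0 +i* s) * a in let q := (0 +i* t) * b in
  (t * complex.Im p - s * complex.Im q) ^+ 2
    + (t * complex.Re p + s * complex.Re q) ^+ 2
  <= (s + t) ^+ 2 * (complex.Re p * complex.Re q).
Proof.
move=> s0 t0 [_ _]; case: a b => a a' [b b'] /=.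
have st0 : s + t != 0 by rewrite gt_eqF // addr_gt0.
rewrite /pick_kernel nsqM nsqM nsqV nsqR.
have -> : nsq (0 +i* 1 : R[i]) = 1 by rewrite /nsq /=; ring.
rewrite mul1r mulrC ler_pdivrMr ?exprn_gt0 ?addr_gt0 // /nsq /= => h.
have st2 : 0 < (s * t) ^+ 2 by rewrite exprn_gt0 // mulr_gt0.
have := ler_wpM2l (ltW st2) h.
have -> : (s * t) ^+ 2 * (- a' / s * (- b' / t) * (s + t) ^+ 2) =
   (s + t) ^+ 2 * (s * a' * (t * b')) by field; rewrite !gt_eqF.
by move=> h'; lra.
Qed.

Section Pick.
Variables (R : realType) (th y : nat -> R) (c : nat -> nat -> R).
Hypothesis c_sym : forall u v, c u v = c v u.
Hypothesis c_ge0 : forall u v, 0 <= c u v.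
Hypothesis y_gt0 : forall v, 0 < y v.

(** Each vertex moves with its own speed [y v], so that the Pick inequality also covers graphs in
    which some masses have i t replaced by i (1 + sigma) t. *)
Definition wline (t : R) (v : nat) : R[i] := th v +i* (t * y v).

Lemma wline_gt0 t v : 0 < t -> 0 < complex.Im (wline t v).
Proof. by move=> t0; rewrite mulr_gt0. Qed.

(* Nevanlinna-Pick positivity at the two points [s], [t]. *)
Lemma green_pick (s t : R) (F : seq nat) T u : 0 < s -> 0 < t -> uniq F ->
  u \in F -> u \notin T ->
  psd2 (pick_kernel s t (green (wline s) c F T u) (green (wline t) c F T u))
       (- complex.Im (green (wline s) c F T u) / s)
       (- complex.Im (green (wline t) c F T u) / t).
Proof.
move=> s0 t0 uF; elim/(@del_ind F): T u => T IH u uin uT.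
have inv d (d0 : 0 < d) := green_inv c_sym c_ge0 (fun v => wline_gt0 v d0) uF uin uT.
have nz d (d0 : 0 < d) := green_neq0 c_sym c_ge0 (fun v => wline_gt0 v d0) uF T u.
apply: (pick_step (c_ge0 u) s0 t0 (y_gt0 u) (nz s s0) (nz t t0) (inv s s0) (inv t t0)).
by move=> v vF vT; apply: IH.
Qed.

End Pick.

(* In terms of [f t = i t G(theta + i t)], the Pick inequality forces [Re f] to be
   monotone and controls [Im f]. *)
Lemma pick_mono (R : realType) (s t a b g h : R) : 0 < s -> s <= t -> 0 <= b ->
  (t * g - s * h) ^+ 2 + (t * a + s * b) ^+ 2 <= (s + t) ^+ 2 * (a * b) ->
  a <= b.
Proof.
move=> s0 st b0 H; rewrite leNgt; apply/negP => ba.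
have H1 : 0 <= (b - a) * (t ^+ 2 * a - s ^+ 2 * b).
  by have := sqr_ge0 (t * g - s * h); nra.
have : s ^+ 2 * b < t ^+ 2 * a.
  apply: (@lt_le_trans _ _ (s ^+ 2 * a)); first by rewrite ltr_pM2l ?exprn_gt0.
  by rewrite ler_wpM2r ?ler_sqr ?nnegrE; lra.
nra.
Qed.

(** * Contraction of the Green function recursion *)

Lemma nsq_sub_le (R : realType) (z w : R[i]) (k : R) :
  nsq z <= k -> nsq w <= k -> nsq (z - w) <= 4 * k.
Proof.
case: z w => p q [p' q']; rewrite /nsq /= => h1 h2.
have := sqr_ge0 (p + p'); have := sqr_ge0 (q + q'); nra.
Qed.

Section Contraction.
Variables (R : realType) (x : nat -> R[i]) (c : nat -> nat -> R) (nb : nat -> seq nat).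
Variables (tau C : R).
Hypothesis c_sym : forall u v, c u v = c v u.
Hypothesis c_ge0 : forall u v, 0 <= c u v.
Hypothesis nb_uniq : forall u, uniq (nb u).
Hypothesis c_nb : forall u v, v \notin nb u -> c u v = 0.
Hypothesis tau_gt0 : 0 < tau.
Hypothesis x_tau : forall v, tau <= complex.Im (x v).
Hypothesis c_le : forall u, \sum_(v <- nb u) c u v <= C.

Let x_gt0 v : 0 < complex.Im (x v). Proof. exact: lt_le_trans (x_tau v). Qed.
Let C_ge0 : 0 <= C.
Proof. by apply: le_trans (c_le 0); rewrite sumr_ge0. Qed.

Lemma sum_nb (V : nmodType) F u (P : pred nat) (g : nat -> V) :
  uniq F -> {subset nb u <= F} -> (forall v, v \notin nb u -> g v = 0) ->
  \sum_(v <- F | P v) g v = \sum_(v <- nb u | P v) g v.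
Proof.
move=> uF nF g0; rewrite (bigID (mem (nb u))) /= [X in _ + X]big1 ?addr0; last first.
  by move=> v /andP[_ vn]; rewrite g0.
under eq_bigl do rewrite andbC.
rewrite -big_filter_cond; apply: perm_big; apply: uniq_perm => //.
  exact: filter_uniq.
by move=> v; rewrite mem_filter /=; case: (boolP (v \in nb u)) => // /nF.
Qed.

Fixpoint ball_list (r : nat) (u : nat) : seq nat :=
  if r is r'.+1 then u :: flatten [seq ball_list r' v | v <- nb u] else [:: u].

Lemma ball_list_self r u : u \in ball_list r u.
Proof. by case: r => [|r] /=; rewrite mem_head. Qed.

Lemma ball_listS r u v : v \in nb u -> {subset ball_list r v <= ball_list r.+1 u}.
Proof.
move=> vu w wr /=; rewrite inE; apply/orP; right; apply/flattenP.
by exists (ball_list r v) => //; apply/mapP; exists v.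
Qed.

Lemma green_le F T u : uniq F -> u \in F -> u \notin T ->
  - complex.Im (green x c F T u) <= tau^-1 /\ nsq (green x c F T u) <= tau^-2.
Proof.
move=> uF uin uT; have W := green_ward c_sym c_ge0 x_gt0 uF uin uT.
have I0 := green_Im c_sym c_ge0 x_gt0 uF uin uT.
set g := green _ _ _ _ _ in W I0 *.
have W' : tau * nsq g <= - complex.Im g.
  by apply: le_trans W; rewrite ler_wpM2r ?nsq_ge0.
have h : - complex.Im g <= tau^-1.
  rewrite -div1r ler_pdivlMr //.
  have i2 : complex.Im g ^+ 2 <= nsq g by rewrite lerDr sqr_ge0.
  have := ler_wpM2l (ltW tau_gt0) i2; nra.
split=> //; rewrite -exprVn expr2 -ler_pdivrMl ?invr_gt0 // invrK.
exact: le_trans W' h.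
Qed.

Lemma green_inv_nb F T u : uniq F -> u \in F -> u \notin T -> {subset nb u <= F} ->
  (green x c F T u)^-1 = x u - \sum_(v <- nb u | v \notin u :: T)
                               (c u v)%:C * green x c F (u :: T) v.
Proof.
move=> uF uin uT nF; rewrite (green_inv c_sym c_ge0 x_gt0 uF uin uT).
by rewrite (@sum_nb _ _ u) // => v vn; rewrite c_nb // mul0r.
Qed.

Lemma green_Im_nb F T u : uniq F -> u \in F -> u \notin T -> {subset nb u <= F} ->
  let S := \sum_(v <- nb u | v \notin u :: T)
             c u v * - complex.Im (green x c F (u :: T) v) in
  [/\ 0 <= S, S <= C / tau
    & - complex.Im (green x c F T u) = nsq (green x c F T u) * (complex.Im (x u) + S)].
Proof.
move=> uF uin uT nF S; split.
- rewrite /S big_seq_cond sumr_ge0 // => v /andP[vn vT].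
  by rewrite mulr_ge0 // oppr_ge0 ltW // (green_Im c_sym c_ge0 x_gt0) // nF.
- rewrite (@le_trans _ _ (\sum_(v <- nb u) c u v * tau^-1)) //.
    rewrite /S big_mkcond /= [X in X <= _]big_seq [X in _ <= X]big_seq ler_sum // => v vn.
    case: ifP => vT; last by rewrite mulr_ge0 // invr_ge0 ltW.
    by rewrite ler_wpM2l //; case: (green_le uF (nF _ vn) vT).
  by rewrite -mulr_suml ler_wpM2r // invr_ge0 ltW.
- have n0 : nsq (green x c F T u) != 0.
    by rewrite gt_eqF // nsq_gt0 (green_neq0 c_sym c_ge0 x_gt0 uF).
  have := congr1 (@complex.Im R) (green_inv_nb uF uin uT nF).
  rewrite ImV ImD ImN Im_sum => h.
  rewrite -[LHS](divfK n0) h mulrC; congr (_ * (_ + _)); rewrite /S -sumrN.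
  by apply: eq_bigr => v _; rewrite Im_mul /= mul0r addr0 mulrN.
Qed.

(** The prefactor comes from the crude bound 2 / tau for differences at the neighbours, which starts
    the induction. The ratio is the largest value of S / (Im x + S) for Im x >= tau and S <= C /
    tau, where S is the contribution of the neighbours to -Im G / |G|^2. *)
Definition kappa (r : nat) : R := 2 * C / tau ^+ 2 * (C / (tau ^+ 2 + C)) ^+ r.

Lemma kappa_ge0 r : 0 <= kappa r.
Proof.
by rewrite !mulr_ge0 ?exprn_ge0 ?divr_ge0 ?invr_ge0 ?exprn_ge0 ?addr_ge0 // ?sqr_ge0 // ltW.
Qed.

(* Contraction for the hyperbolic metric of the half-plane: the recursion for the
   Green function forgets the graph outside a ball exponentially fast. *)
Lemma green_contract r F1 F2 T u : uniq F1 -> uniq F2 ->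
  {subset ball_list r.+1 u <= F1} -> {subset ball_list r.+1 u <= F2} -> u \notin T ->
  psd2 (green x c F1 T u - green x c F2 T u)
       (kappa r * - complex.Im (green x c F1 T u))
       (kappa r * - complex.Im (green x c F2 T u)).
Proof.
move=> u1 u2; elim: r u T => [|r IH] u T s1 s2 uT.
all: have uF1 := s1 _ (ball_list_self _ _); have uF2 := s2 _ (ball_list_self _ _).
all: have nF1 : {subset nb u <= F1} by move=> v vn; apply/s1/(ball_listS vn)/ball_list_self.
all: have nF2 : {subset nb u <= F2} by move=> v vn; apply/s2/(ball_listS vn)/ball_list_self.
all: have [a0 aC ea] := green_Im_nb u1 uF1 uT nF1;
  have [b0 bC eb] := green_Im_nb u2 uF2 uT nF2.
all: have nz1 := green_neq0 c_sym c_ge0 x_gt0 u1 T u.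
all: have nz2 := green_neq0 c_sym c_ge0 x_gt0 u2 T u.
all: have -> : green x c F1 T u - green x c F2 T u =
  green x c F1 T u * green x c F2 T u * (\sum_(v <- nb u | v \notin u :: T)
   (c u v)%:C * (green x c F1 (u :: T) v - green x c F2 (u :: T) v)) by
  rewrite (subr_invM nz1 nz2) !green_inv_nb // subr_shuffle subrr add0r -sumrB;
  congr (_ * _); apply: eq_bigr => v _; rewrite mulrBr.
all: rewrite ea eb [kappa _ * _]mulrCA [X in psd2 _ _ X]mulrCA; apply: psd2M.
- have cs w S : tau <= w -> 0 <= S ->
      \sum_(v <- nb u | v \notin u :: T) c u v * (2 / tau) <= kappa 0 * (w + S).
    move=> tw S0; apply: (@le_trans _ _ (C * (2 / tau))).
      rewrite -mulr_suml ler_wpM2r ?divr_ge0 ?(ltW tau_gt0) //.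
      by apply: le_trans (c_le u); rewrite big_mkcond ler_sum // => v _; case: ifP.
    apply: (@le_trans _ _ (kappa 0 * tau)); last by rewrite ler_wpM2l ?kappa_ge0; lra.
    rewrite /kappa expr0 mulr1 le_eqVlt; apply/orP; left; apply/eqP; field.
    by rewrite gt_eqF.
  apply: psd2_le (cs _ _ (x_tau u) a0) (cs _ _ (x_tau u) b0).
  apply: psd2_sum => // v vn vT; split; rewrite ?divr_ge0 ?(ltW tau_gt0) //.
  have [_ h1] := green_le u1 (nF1 _ vn) vT; have [_ h2] := green_le u2 (nF2 _ vn) vT.
  have -> : 2 / tau * (2 / tau) = 4 * tau^-2 by rewrite -exprVn; ring.
  exact: nsq_sub_le.
- have tC : 0 < tau ^+ 2 + C by rewrite ltr_wpDr // exprn_gt0.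
  have ks w S : tau <= w -> S <= C / tau -> kappa r * S <= kappa r.+1 * (w + S).
    move=> tw SC; have -> : kappa r.+1 = kappa r * (C / (tau ^+ 2 + C)).
      by rewrite /kappa (exprSr _ r) mulrA.
    rewrite -[X in _ <= X]mulrA ler_wpM2l ?kappa_ge0 //.
    rewrite mulrAC ler_pdivlMr //.
    have tS : tau * S <= C by rewrite mulrC -ler_pdivlMr.
    have := ler_wpM2l C_ge0 tw; have := ler_wpM2l (ltW tau_gt0) tS; nra.
  apply: psd2_le (ks _ _ (x_tau u) aC) (ks _ _ (x_tau u) bC).
  rewrite !mulr_sumr.
  under [X in psd2 _ X _]eq_bigr do rewrite mulrCA.
  under [X in psd2 _ _ X]eq_bigr do rewrite mulrCA.
  apply: psd2_sum => // v vn vT; apply: IH => // w wv;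
    by [apply/s1/(ball_listS vn) | apply/s2/(ball_listS vn)].
Qed.

End Contraction.

(** * Infinite-volume limits *)

Section ComplexLimits.
Variable R : realType.
Implicit Types (u v : nat -> R[i]) (l m : R[i]).

(** Convergence is kept coordinatewise so that order and monotonicity arguments for real sequences
    apply directly. *)
Definition ccvg u l :=
  (complex.Re (u n) @[n --> \oo] --> complex.Re l) /\
  (complex.Im (u n) @[n --> \oo] --> complex.Im l).

Lemma ccvg_cst l : ccvg (fun=> l) l.
Proof. by split; apply: cvg_cst. Qed.

Lemma ccvgD u v l m : ccvg u l -> ccvg v m -> ccvg (fun n => u n + v n) (l + m).
Proof.
move=> [ur ui] [vr vi]; split; rewrite ?ReD ?ImD.
  by under eq_fun do rewrite ReD; apply: cvgD.
by under eq_fun do rewrite ImD; apply: cvgD.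
Qed.

Lemma ccvgN u l : ccvg u l -> ccvg (fun n => - u n) (- l).
Proof.
move=> [ur ui]; split; rewrite ?ReN ?ImN.
  by under eq_fun do rewrite ReN; apply: cvgN.
by under eq_fun do rewrite ImN; apply: cvgN.
Qed.

Lemma ccvgB u v l m : ccvg u l -> ccvg v m -> ccvg (fun n => u n - v n) (l - m).
Proof. by move=> hu hv; apply: ccvgD => //; apply: ccvgN. Qed.

Lemma ccvgM u v l m : ccvg u l -> ccvg v m -> ccvg (fun n => u n * v n) (l * m).
Proof.
move=> [ur ui] [vr vi]; split; rewrite ?Re_mul ?Im_mul.
  by under eq_fun do rewrite Re_mul; apply: cvgB; apply: cvgM.
by under eq_fun do rewrite Im_mul; apply: cvgD; apply: cvgM.
Qed.

Lemma ccvg_real (a : nat -> R) (b : R) :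
  a n @[n --> \oo] --> b -> ccvg (fun n => (a n)%:C) b%:C.
Proof. by move=> h; split => //=; apply: cvg_cst. Qed.

Lemma ccvg_sum I (r : seq I) (P : pred I) (u : I -> nat -> R[i]) (l : I -> R[i]) :
  (forall i, P i -> ccvg (u i) (l i)) ->
  ccvg (fun n => \sum_(i <- r | P i) u i n) (\sum_(i <- r | P i) l i).
Proof.
move=> h; elim: r => [|i r IH].
  under eq_fun do rewrite big_nil; rewrite big_nil; exact: ccvg_cst.
under eq_fun do rewrite big_cons; rewrite big_cons; case: ifP => // Pi.
by apply: ccvgD => //; apply: h.
Qed.

Lemma ccvg_nsq u l : ccvg u l -> nsq (u n) @[n --> \oo] --> nsq l.
Proof.
move=> [ur ui]; rewrite /nsq !expr2.
by under eq_fun do rewrite !expr2; apply: cvgD; apply: cvgM.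
Qed.

Lemma ccvgV u l : l != 0 -> ccvg u l -> ccvg (fun n => (u n)^-1) l^-1.
Proof.
move=> l0 hu; have hn := ccvg_nsq hu; case: hu => ur ui.
have n0 : nsq l != 0 by rewrite gt_eqF // nsq_gt0.
split; rewrite ?ReV ?ImV.
  by under eq_fun do rewrite ReV; apply: cvgM => //; apply: cvgV.
under eq_fun do rewrite ImV; apply: cvgM; first exact: cvgN.
exact: cvgV.
Qed.

Lemma ccvg_unique u l m : ccvg u l -> ccvg u m -> l = m.
Proof.
move=> [ur ui] [vr vi]; apply/eqP; rewrite eq_complex.
by rewrite (cvg_unique _ ur vr) ?(cvg_unique _ ui vi) ?eqxx.
Qed.

Lemma ccvg_near u v l : (\forall n \near \oo, u n = v n) -> ccvg u l -> ccvg v l.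
Proof.
move=> h [ur ui]; split; (apply: cvg_trans; last first; [exact: ur || exact: ui|]).
  by apply: near_eq_cvg; near=> n; have -> //: u n = v n by near: n.
by apply: near_eq_cvg; near=> n; have -> //: u n = v n by near: n.
Unshelve. all: by end_near. Qed.

Lemma ccvg0P u : ccvg u 0 <-> nsq (u n) @[n --> \oo] --> 0.
Proof.
split=> [/ccvg_nsq|h]; first by rewrite /nsq /= expr0n addr0.
have sq (a : nat -> R) : (forall n, a n ^+ 2 <= nsq (u n)) -> a n @[n --> \oo] --> 0.
  move=> ha; apply/cvgrPdist_lt => e e0; near=> n; rewrite sub0r normrN.
  have : `|0 - nsq (u n)| < e ^+ 2.
    by near: n; move/cvgrPdist_lt: h; apply; rewrite exprn_gt0.
  rewrite sub0r normrN ger0_norm ?nsq_ge0 // => hn.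
  rewrite -ltr_sqr ?nnegrE ?(ltW e0) // real_normK ?num_real //.
  exact: le_lt_trans (ha n) hn.
by split; apply: sq => n; rewrite /nsq ?lerDl ?lerDr sqr_ge0.
Unshelve. all: by end_near. Qed.

Lemma ccvg0_le u (a : nat -> R) :
  (\forall n \near \oo, nsq (u n) <= a n) -> a n @[n --> \oo] --> 0 -> ccvg u 0.
Proof.
move=> h ha; apply/ccvg0P; apply: (squeeze_cvgr _ (cvg_cst 0) ha).
by near=> n; rewrite nsq_ge0 /=; near: n.
Unshelve. all: by end_near. Qed.

Lemma ccvg0M u v (B : R) : (forall n, nsq (v n) <= B) ->
  ccvg u 0 -> ccvg (fun n => u n * v n) 0.
Proof.
move=> hv /ccvg0P hu; apply: (@ccvg0_le _ (fun n => nsq (u n) * B)).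
  by apply: nearW => n; rewrite nsqM ler_wpM2l ?nsq_ge0.
by rewrite -(mul0r B); apply: cvgM => //; apply: cvg_cst.
Qed.

Lemma cauchy_ccvg u (k : nat -> R) : k n @[n --> \oo] --> 0 ->
  (forall r, \forall n \near \oo, forall m : nat, (n <= m)%N -> nsq (u n - u m) <= k r) ->
  exists l, ccvg u l.
Proof.
move=> hk hu.
have cau (a : nat -> R) : (forall n m : nat, (a n - a m) ^+ 2 <= nsq (u n - u m)) ->
    cvgn a.
  move=> ha; apply: cauchy_cvg; apply: cauchy_exP => e e0.
  have [r hr] : exists r, k r < e ^+ 2.
    have : \forall r \near \oo, `|0 - k r| < e ^+ 2.
      by move/cvgrPdist_lt: hk; apply; rewrite exprn_gt0.
    case=> N _ /(_ N (leqnn N)) /=; rewrite sub0r normrN => h.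
    by exists N; apply: le_lt_trans (ler_norm _) h.
  have [N _ hN] := hu r; exists (a N); exists N => // m /= Nm.
  rewrite /ball /= -ltr_sqr ?nnegrE ?(ltW e0) // real_normK ?num_real //.
  apply: le_lt_trans (ha N m) _; apply: le_lt_trans (hN N (leqnn N) m Nm) hr.
have /cvg_ex[a ha] : cvgn (fun n => complex.Re (u n)).
  by apply: cau => n m; rewrite -ReN -ReD /nsq lerDl sqr_ge0.
have /cvg_ex[b hb] : cvgn (fun n => complex.Im (u n)).
  by apply: cau => n m; rewrite -ImN -ImD /nsq lerDr sqr_ge0.
by exists (a +i* b).
Qed.

End ComplexLimits.

Definition adj (g : lgraph) (i j : nat) : bool := [&& lV g i, lV g j & ladj g i j].

(* Adjacency outside [lV] is ignored, so that the property is invariant under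
   [graph_iso]; [nb] enumerates the neighbours. *)
Record good_graph (D : nat) (g : lgraph) (nb : nat -> seq nat) : Prop := GoodGraph {
  adj_sym : forall u v, adj g u v = adj g v u;
  adj_irr : forall u, adj g u u = false;
  nbE : forall u v, (v \in nb u) = adj g u v;
  nb_uniq : forall u, uniq (nb u);
  nb_size : forall u, (size (nb u) <= D)%N }.

Definition exhausts (g : lgraph) (F : nat -> seq nat) :=
  [/\ forall n, uniq (F n), forall n, {subset F n <= lV g}
    & forall v, lV g v -> \forall n \near \oo, v \in F n].

Definition window (g : lgraph) (n : nat) : seq nat := [seq v <- iota 0 n | lV g v].

Lemma window_exhausts g : exhausts g (window g).
Proof.
split=> [n|n v|v gv]; first by rewrite filter_uniq ?iota_uniq.
  by rewrite mem_filter => /andP[].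
by exists v.+1 => // n /= vn; rewrite mem_filter gv mem_iota add0n.
Qed.

Section InfiniteVolume.
Variables (R : realType) (g : lgraph).

Definition ew (u v : nat) : R := (adj g u v)%:R.

Definition ratio (z : R[i]) (F T : seq nat) : R[i] :=
  muC (fun=> z) ew F T / muC (fun=> z) ew F [::].

(* The infinite-volume limit of mu(G - T) / mu(G) at [z]; locked below to prevent
   unfolding during conversion. *)
Definition rr_def (z : R[i]) (T : seq nat) : R[i] :=
  lim (complex.Re (ratio z (window g n) T) @[n --> \oo]) +i*
  lim (complex.Im (ratio z (window g n) T) @[n --> \oo]).

Fact rr_key : unit. Proof. exact: tt. Qed.
Definition rr := locked_with rr_key rr_def.

Lemma rrE z T : rr z T =
  lim (complex.Re (ratio z (window g n) T) @[n --> \oo]) +i*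
  lim (complex.Im (ratio z (window g n) T) @[n --> \oo]).
Proof. by rewrite /rr locked_withE. Qed.

Lemma rr_lim z T l : ccvg (fun n => ratio z (window g n) T) l -> rr z T = l.
Proof.
by case=> hr hi; apply/eqP; rewrite rrE eq_complex /= (cvg_lim _ hr) // (cvg_lim _ hi) // !eqxx.
Qed.

Variables (D : nat) (nb : nat -> seq nat).
Hypothesis gG : good_graph D g nb.

Lemma ew_sym u v : ew u v = ew v u. Proof. by rewrite /ew (adj_sym gG). Qed.
Lemma ew_ge0 u v : 0 <= ew u v. Proof. exact: ler0n. Qed.
Lemma ew_nb u v : v \notin nb u -> ew u v = 0.
Proof. by rewrite (nbE gG) /ew => /negbTE ->. Qed.
Lemma ew_le u : \sum_(v <- nb u) ew u v <= D%:R.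
Proof.
rewrite big_seq (eq_bigr (fun=> 1)) => [|v]; last by rewrite (nbE gG) /ew => ->.
by rewrite -big_seq big_const_seq count_predT iter_addr_0 ler_nat (nb_size gG).
Qed.

Lemma nb_V u v : v \in nb u -> lV g u && lV g v.
Proof. by rewrite (nbE gG) => /and3P[-> ->]. Qed.

Lemma ball_list_V r u : lV g u -> {subset ball_list nb r u <= lV g}.
Proof.
elim: r u => [|r IH] u gu v /=; first by rewrite inE => /eqP ->.
rewrite inE => /predU1P[-> //|/flattenP[s /mapP[w wu ->]]].
by apply: IH; case/andP: (nb_V wu).
Qed.

Lemma exhausts_sub F (s : seq nat) : exhausts g F -> {subset s <= lV g} ->
  \forall n \near \oo, {subset s <= F n}.
Proof.
move=> [_ _ hF]; elim: s => [|v s IH] sV; first by apply: nearW.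
have hs : {subset s <= lV g} by move=> w ws; apply: sV; rewrite inE ws orbT.
near=> n => w; rewrite inE => /predU1P[->|].
  by near: n; apply: hF; apply: sV; rewrite mem_head.
by move: w; near: n; apply: IH.
Unshelve. all: by end_near. Qed.

Variable z : R[i].
Hypothesis z0 : 0 < complex.Im z.

Let x_gt0 (v : nat) : 0 < complex.Im ((fun=> z) v). Proof. exact: z0. Qed.

Lemma ratio_green F T u : uniq F ->
  ratio z F (u :: T) = green (fun=> z) ew F T u * ratio z F T.
Proof.
move=> uF; rewrite /ratio /green mulrA divfK //.
exact: (muC_neq0 ew_sym ew_ge0 x_gt0 uF).
Qed.

Let tau := complex.Im z.

Lemma kappa_cvg0 : (kappa tau D%:R n / tau) ^+ 2 @[n --> \oo] --> (0 : R).
Proof.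
have t2 : 0 < tau ^+ 2 by rewrite exprn_gt0.
have D0 : 0 <= D%:R :> R by [].
have -> : (0 : R) = (2 * D%:R / tau ^+ 2 * 0 / tau) ^+ 2.
  by rewrite mulr0 mul0r expr0n.
under eq_fun do rewrite expr2; rewrite expr2.
have h : kappa tau D%:R n / tau @[n --> \oo] --> 2 * D%:R / tau ^+ 2 * 0 / tau.
  apply: cvgM; last exact: cvg_cst.
  apply: cvgM; first exact: cvg_cst.
  apply: cvg_expr; rewrite ger0_norm ?divr_ge0 ?addr_ge0 ?(ltW t2) //.
  by rewrite ltr_pdivrMr ?mul1r ?ltrDr // ltr_wpDr.
exact: cvgM.
Qed.

Lemma green_diff r F1 F2 T u : uniq F1 -> uniq F2 ->
  {subset ball_list nb r.+1 u <= F1} -> {subset ball_list nb r.+1 u <= F2} -> u \notin T ->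
  nsq (green (fun=> z) ew F1 T u - green (fun=> z) ew F2 T u) <= (kappa tau D%:R r / tau) ^+ 2.
Proof.
move=> u1 u2 s1 s2 uT; pose x : nat -> R[i] := fun=> z.
have tz (v : nat) : tau <= complex.Im (x v) by [].
have [a0 b0 h] := green_contract ew_sym ew_ge0 (nb_uniq gG) ew_nb z0 tz ew_le u1 u2 s1 s2 uT.
 apply: le_trans h _; rewrite expr2.
have g1 := green_le ew_sym ew_ge0 z0 tz u1 (s1 _ (ball_list_self _ _ _)) uT.
have g2 := green_le ew_sym ew_ge0 z0 tz u2 (s2 _ (ball_list_self _ _ _)) uT.
have k0 : 0 <= kappa tau D%:R r by apply: (kappa_ge0 (nb:=nb) ew_ge0 _ ew_le).
by apply: ler_pM => //; rewrite ler_wpM2l //; case: g1; case: g2.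
Qed.

(** Two finite sets that contain a large ball around [u] have exponentially close Green functions.
    One limit serves all exhaustions; this is what later gives invariance under relabelling. *)
Lemma green_cvg T u : lV g u -> u \notin T ->
  exists l, forall F, exhausts g F -> ccvg (fun n => green (fun=> z) ew (F n) T u) l.
Proof.
move=> gu uT.
have near_ball F r : exhausts g F -> \forall n \near \oo,
    {subset ball_list nb r.+1 u <= F n}.
  by move=> hF; apply: exhausts_sub => //; apply: ball_list_V.
have uE F n : exhausts g F -> uniq (F n) by case.
have hw := window_exhausts g.
have [l hl] : exists l, ccvg (fun n => green (fun=> z) ew (window g n) T u) l.
  apply: (cauchy_ccvg kappa_cvg0) => r; have [N _ hN] := near_ball _ r hw.
  exists N => // n /= Nn m nm; apply: green_diff => //; rewrite ?uE //; apply: hN => //=.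
  exact: leq_trans Nn nm.
exists l => F hF.
suff d0 : ccvg (fun n => green (fun=> z) ew (F n) T u - green (fun=> z) ew (window g n) T u) 0.
  by rewrite -[l]add0r; apply: ccvg_near (ccvgD d0 hl); apply: nearW => n; rewrite subrK.
apply/ccvg0P/cvgrPdist_lt => e e0.
have [r _ hr] : \forall r \near \oo, `|0 - (kappa tau D%:R r / tau) ^+ 2| < e.
  by move/cvgrPdist_lt: kappa_cvg0; apply.
have [N1 _ h1] := near_ball _ r hF; have [N2 _ h2] := near_ball _ r hw.
exists (maxn N1 N2) => // n /=; rewrite geq_max => /andP[n1 n2].
rewrite sub0r normrN ger0_norm ?nsq_ge0 //.
apply: le_lt_trans (_ : _ <= (kappa tau D%:R r / tau) ^+ 2) _.
  by apply: green_diff => //; rewrite ?uE //; [exact: h1|exact: h2].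
by have := hr r (leqnn r); rewrite /= sub0r normrN ger0_norm ?sqr_ge0.
Qed.

Lemma ratio_dup F T u : (u \in T) || (u \notin F) -> ratio z F (u :: T) = ratio z F T.
Proof.
move=> /orP[uT|uF]; rewrite /ratio /muC; congr (_ / _); last exact: muD_notin.
by apply: eq_muD => v; rewrite inE; case: eqVneq => // ->.
Qed.

Lemma ratio_cvg T : exists l, forall F, exhausts g F -> ccvg (fun n => ratio z (F n) T) l.
Proof.
elim: T => [|u T [l IH]].
  exists 1 => F [uF _ _]; apply: ccvg_near (ccvg_cst 1); apply: nearW => n.
  by rewrite /ratio divff // (muC_neq0 ew_sym ew_ge0 x_gt0).
have [uT|uT] := boolP (u \in T).
  by exists l => F hF; apply: ccvg_near (IH F hF); apply: nearW => n; rewrite ratio_dup ?uT.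
have [gu|gu] := boolP (lV g u); last first.
  exists l => F hF; apply: ccvg_near (IH F hF); apply: nearW => n; rewrite ratio_dup //.
  by case: hF => _ sF _; apply/orP; right; apply: contra gu => /sF.
have [m hm] := green_cvg gu uT; exists (m * l) => F hF.
apply: ccvg_near (ccvgM (hm F hF) (IH F hF)); apply: nearW => n.
by rewrite ratio_green //; case: hF.
Qed.

Lemma rr_cvg F T : exhausts g F -> ccvg (fun n => ratio z (F n) T) (rr z T).
Proof.
move=> hF; have [l hl] := ratio_cvg T.
by rewrite (rr_lim (hl _ (window_exhausts g))); apply: hl.
Qed.

End InfiniteVolume.

(** * Resolvent identities in infinite volume *)

Section Resolvent.
Variables (R : realType) (g : lgraph) (D : nat) (nb : nat -> seq nat).
Hypothesis gG : good_graph D g nb.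
Variable z : R[i].
Hypothesis z0 : 0 < complex.Im z.

Let esym := @ew_sym R _ _ _ gG.
Let ege0 := @ew_ge0 R g.
Let x_gt0 (v : nat) : 0 < complex.Im ((fun=> z) v). Proof. exact: z0. Qed.
Let hw := window_exhausts g.
Let ccw T := rr_cvg gG z0 T hw.

Definition gg (T : seq nat) (u : nat) : R[i] := rr g z (u :: T) / rr g z T.

Lemma rr_nil : rr g z [::] = 1.
Proof.
apply: rr_lim; apply: ccvg_near (ccvg_cst 1); apply: nearW => n.
by rewrite /ratio divff // (muC_neq0 esym ege0 x_gt0) //; case: hw.
Qed.

Lemma rr_eq T T' : T =i T' -> rr g z T = rr g z T'.
Proof.
move=> e; apply: rr_lim; apply: ccvg_near (ccw T'); apply: nearW => n.
by rewrite /ratio /muC (eq_muD _ _ _ e).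
Qed.

Lemma rr_dup T u : (u \in T) || ~~ lV g u -> rr g z (u :: T) = rr g z T.
Proof.
move=> h; apply: rr_lim; apply: ccvg_near (ccw T); apply: nearW => n.
rewrite ratio_dup //; case/orP: h => [-> //|gu]; apply/orP; right.
by apply: contra gu; case: hw => _ s _ /s.
Qed.

Lemma near_window u : lV g u ->
  \forall n \near \oo, u \in window g n /\ {subset nb u <= window g n}.
Proof.
move=> gu; near=> n; split; first by near: n; case: hw => _ _; apply.
near: n; apply: (exhausts_sub hw) => v vu; by case/andP: (nb_V gG vu).
Unshelve. all: by end_near. Qed.

Lemma rr_expand T u : lV g u -> u \notin T ->
  rr g z T = z * rr g z (u :: T)
             - \sum_(v <- nb u | v \notin u :: T) rr g z (v :: u :: T).
Proof.
move=> gu uT; apply: rr_lim.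
have h := ccvgB (ccvgM (ccvg_cst z) (ccw (u :: T)))
  (@ccvg_sum R _ (nb u) (fun v => v \notin u :: T) _ _ (fun v _ => ccw (v :: u :: T))).
apply: ccvg_near h; near=> n.
have [uin nF] : u \in window g n /\ {subset nb u <= window g n}.
  by near: n; apply: near_window.
have uF : uniq (window g n) by case: hw.
have esymC a b : (ew R g a b)%:C = (ew R g b a)%:C :> R[i] by rewrite esym.
rewrite {3}/ratio {1}/muC (muD_expand _ esymC uF uin uT) mulrBl mulrA; congr (_ - _).
rewrite mulr_suml (@sum_nb nb (nb_uniq gG) _ (window g n) u) //.
  rewrite [LHS]big_seq_cond [RHS]big_seq_cond; apply: eq_bigr => v /andP[vn _].
  by rewrite /ew -(nbE gG) vn mul1r.
by move=> v vn; rewrite (ew_nb _ gG vn) !mul0r.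
Unshelve. all: by end_near. Qed.

Lemma gg_lim T u : lV g u -> u \notin T -> rr g z T != 0 ->
  ccvg (fun n => green (fun=> z) (ew R g) (window g n) T u) (gg T u).
Proof.
move=> gu uT n0; apply: ccvg_near (ccvgM (ccw (u :: T)) (ccvgV n0 (ccw T))).
apply: nearW => n; rewrite (ratio_green gG z0) //; last by case: hw.
rewrite mulfK // /ratio mulf_neq0 ?invr_eq0 //; apply: (muC_neq0 esym ege0 x_gt0);
by case: hw.
Qed.

(** A limit of nonzero ratios could vanish. It does not, because the reciprocals of the finite Green
    functions also converge, by the recursion through the neighbours, so the limiting Green function
    is invertible. *)
Lemma rr_neq0 T : rr g z T != 0.
Proof.
elim: T => [|u T IH]; first by rewrite rr_nil oner_neq0.
have [h|] := boolP ((u \in T) || ~~ lV g u); first by rewrite rr_dup.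
rewrite negb_or negbK => /andP[uT gu].
have uF n : uniq (window g n) by case: hw.
have [l hl] := green_cvg gG z0 gu uT.
have hg := gg_lim gu uT IH.
have lim v : v \in nb u -> v \notin u :: T ->
    exists m, ccvg (fun n => green (fun=> z) (ew R g) (window g n) (u :: T) v) m.
  move=> vn vT; have [|m hm] := green_cvg gG z0 _ vT.
    by case/andP: (nb_V gG vn).
  by exists m; apply: hm.
have [W hW] : exists W, ccvg (fun n => (green (fun=> z) (ew R g) (window g n) T u)^-1) W.
  have /boolp.choice[m hm] v : exists m, (v \in nb u) && (v \notin u :: T) ->
      ccvg (fun n => green (fun=> z) (ew R g) (window g n) (u :: T) v) m.
    have [/andP[vn vT]|_] := boolP ((v \in nb u) && (v \notin u :: T)); last by exists 0.
    by have [m hm] := lim v vn vT; exists m.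
  exists (z - \sum_(v <- nb u | (v \in nb u) && (v \notin u :: T)) m v).
  have h := ccvgB (ccvg_cst z) (@ccvg_sum R _ (nb u) _ _ _ hm).
  apply: ccvg_near h; near=> n.
  have [uin nF] : u \in window g n /\ {subset nb u <= window g n}.
    by near: n; apply: near_window.
  rewrite (green_inv esym ege0 x_gt0 (uF n) uin uT) (@sum_nb nb (nb_uniq gG) _ (window g n) u) //.
    congr (_ - _); rewrite [RHS]big_seq_cond; apply: eq_bigr => v /andP[vn _].
    by rewrite /ew -(nbE gG) vn mul1r.
  by move=> v vn; rewrite (ew_nb _ gG vn) mul0r.
have e1 : gg T u * W = 1.
  apply: ccvg_unique (ccvgM hg hW) _; apply: ccvg_near (ccvg_cst 1).
  by apply: nearW => n; rewrite mulfV // (green_neq0 esym ege0 x_gt0).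
by apply: contra_eq_neq e1 => r0; rewrite /gg r0 !mul0r eq_sym oner_neq0.
Unshelve. all: by end_near. Qed.

Lemma gg_neq0 T u : gg T u != 0.
Proof. by rewrite mulf_neq0 ?invr_eq0 ?rr_neq0. Qed.

Lemma rr_cons T u : rr g z (u :: T) = gg T u * rr g z T.
Proof. by rewrite /gg divfK ?rr_neq0. Qed.

Lemma gg_comm T u v : gg T u * gg (u :: T) v = gg T v * gg (v :: T) u.
Proof.
have e : rr g z (v :: u :: T) = rr g z (u :: v :: T).
  by apply: rr_eq => w; rewrite !inE orbCA.
have := rr_neq0 T; have := rr_neq0 (u :: T); have := rr_neq0 (v :: T).
by rewrite /gg e => h1 h2 h3; field; rewrite h1 h2 h3.
Qed.

Lemma gg_inv T u : lV g u -> u \notin T ->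
  (gg T u)^-1 = z - \sum_(v <- nb u | v \notin u :: T) gg (u :: T) v.
Proof.
move=> gu uT; rewrite /gg invf_div (rr_expand gu uT) mulrBl mulfK ?rr_neq0 //.
by rewrite mulr_suml.
Qed.

Lemma gg_ward T u : lV g u -> u \notin T ->
  complex.Im z * nsq (gg T u) <= - complex.Im (gg T u).
Proof.
move=> gu uT; have h := gg_lim gu uT (rr_neq0 T).
have h1 := ccvg_nsq h; case: h => _ hI.
rewrite -subr_ge0.
have : - complex.Im (green (fun=> z) (ew R g) (window g n) T u)
   - complex.Im z * nsq (green (fun=> z) (ew R g) (window g n) T u) @[n --> \oo]
   --> - complex.Im (gg T u) - complex.Im z * nsq (gg T u).
  by apply: cvgB; [exact: cvgN|apply: cvgM => //; exact: cvg_cst].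
move/cvgr_to_ge; apply; near=> n; rewrite subr_ge0.
apply: (green_ward esym ege0 x_gt0) => //; first by case: hw.
have [] // : u \in window g n /\ {subset nb u <= window g n}.
by near: n; apply: near_window.
Unshelve. all: by end_near. Qed.

Lemma gg_Im T u : lV g u -> u \notin T -> complex.Im (gg T u) < 0.
Proof.
move=> gu uT; have := gg_ward gu uT; rewrite -oppr_gt0; apply: lt_le_trans.
by rewrite mulr_gt0 // nsq_gt0 gg_neq0.
Qed.

Lemma gg_le T u : lV g u -> u \notin T ->
  - complex.Im (gg T u) <= (complex.Im z)^-1 /\ nsq (gg T u) <= (complex.Im z)^-2.
Proof.
move=> gu uT; have W := gg_ward gu uT.
have h : - complex.Im (gg T u) <= (complex.Im z)^-1.
  rewrite -div1r ler_pdivlMr //; have I0 := gg_Im gu uT.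
  have i2 : complex.Im (gg T u) ^+ 2 <= nsq (gg T u) by rewrite lerDr sqr_ge0.
  have := ler_wpM2l (ltW z0) i2; nra.
split=> //; rewrite -exprVn expr2 -ler_pdivrMl ?invr_gt0 // invrK.
exact: le_trans W h.
Qed.

(** The other neighbours contribute with the same sign, so one neighbour suffices for a lower bound:
    if its -Im G is large, then G(u) is small. *)
Lemma gg_edge T u v : lV g u -> u \notin T -> v \in nb u -> v \notin u :: T ->
  complex.Im z - complex.Im (gg (u :: T) v) <= complex.Im (gg T u)^-1.
Proof.
move=> gu uT vn vT; rewrite gg_inv // ImD ImN Im_sum lerD2l lerN2.
rewrite big_mkcond /= (bigD1_seq v) ?(nb_uniq gG) //= vT gerDl.
rewrite big_seq_cond sumr_le0 // => w /andP[wn _]; case: ifP => // wT.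
by rewrite ltW // gg_Im //; case/andP: (nb_V gG wn).
Qed.

Lemma ggV_le T u : lV g u -> u \notin T ->
  nsq (gg T u)^-1 <= 2 * (nsq z + (D%:R / complex.Im z) ^+ 2).
Proof.
move=> gu uT; rewrite gg_inv //; set S := \sum_(_ <- _ | _) _.
have hS : nsq S <= (D%:R / complex.Im z) ^+ 2.
  have : psd2 S (\sum_(v <- nb u | v \notin u :: T) 1 * (complex.Im z)^-1)
                (\sum_(v <- nb u | v \notin u :: T) 1 * (complex.Im z)^-1).
    rewrite /S; under eq_bigr do rewrite -[gg _ _]mul1r.
    apply: (@psd2_sum R _ _ _ (fun=> 1) _ (fun=> _) (fun=> _)) => // v vn vT.
    split; rewrite ?invr_ge0 ?(ltW z0) //.
    have [|_] := gg_le _ vT; first by case/andP: (nb_V gG vn).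
    by rewrite -exprVn expr2.
  case=> [h0 _]; rewrite -expr2 => h; apply: le_trans h _.
  rewrite ler_sqr ?nnegrE ?divr_ge0 ?(ltW z0) // -mulr_suml ler_wpM2r ?invr_ge0 ?(ltW z0) //.
  rewrite big_const_seq iter_addr_0 ler_nat (leq_trans (count_size _ _)) //.
  exact: (nb_size gG).
move: hS; case: z S => a b [c d]; rewrite /nsq /= => hS.
by have := sqr_ge0 (a + c); have := sqr_ge0 (b + d); lra.
Qed.

End Resolvent.

(** * Perturbed masses and edge weights in infinite volume *)

Section Perturbation.
Variables (R : realType) (g : lgraph) (D : nat) (nb : nat -> seq nat).
Hypothesis gG : good_graph D g nb.
Let esym := @ew_sym R _ _ _ gG.
Let hw := window_exhausts g.

(* The graph perturbed on [S]: the masses on [S] are shifted by [s], the weights of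
   the edges between [S] and [A] are multiplied by [1 + rho]. *)
Definition px (z s : R[i]) (S : seq nat) (v : nat) : R[i] := if v \in S then z + s else z.
Definition pc (rho : R) (A : pred nat) (S : seq nat) (u v : nat) : R :=
  ew R g u v * (if (u \in S) && A v || (v \in S) && A u then 1 + rho else 1).

Definition pratio z s rho A (F S T : seq nat) : R[i] :=
  muC (px z s S) (pc rho A S) F T / muC (fun=> z) (ew R g) F [::].

(** The infinite-volume limit of [pratio], written by expanding the perturbation one vertex of [S]
    at a time. Being a finite combination of the unperturbed limits [rr], it needs no new
    contraction argument. *)
Fixpoint zeta (z s : R[i]) (rho : R) (A : pred nat) (S T : seq nat) : R[i] :=
  if S is v :: S' then
    zeta z s rho A S' T + s * zeta z s rho A S' (v :: T)
    - rho%:C * \sum_(w <- nb v | (w \notin v :: T) && A w) zeta z s rho A S' (w :: v :: T)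
  else rr g z T.

Lemma pc_sym rho A S u v : pc rho A S u v = pc rho A S v u.
Proof. by rewrite /pc esym orbC. Qed.

Lemma pc_ge0 rho A S u v : -1 <= rho -> 0 <= pc rho A S u v.
Proof. by move=> r1; rewrite mulr_ge0 ?ew_ge0 //; case: ifP => // _; lra. Qed.

Lemma px_gt0 (z s : R[i]) S v : 0 < complex.Im z -> 0 < complex.Im (z + s) ->
  0 < complex.Im (px z s S v).
Proof. by move=> z0 zs0; rewrite /px; case: ifP. Qed.

Lemma muC_del z s rho A F S v T : v \in T ->
  muC (px z s (v :: S)) (pc rho A (v :: S)) F T = muC (px z s S) (pc rho A S) F T.
Proof.
move=> vT; apply: eq_mu => [w|w w']; rewrite !mem_filter => /andP[wT _].
  by rewrite /px inE; case: eqVneq => // wv; rewrite wv vT in wT.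
move=> /andP[wT' _]; rewrite /pc !inE.
by case: eqVneq => [wv|_]; [rewrite wv vT in wT|case: eqVneq => // wv; rewrite wv vT in wT'].
Qed.

(** Expanding at [v] with and without its perturbation produces the same deleted graphs, so the two
    expansions are subtracted term by term. As [v] lies neither in [S] nor in [A], its edges still
    carry their original weights before this step. *)
Lemma pratio_cons z s rho A F S v T : uniq F -> v \in F -> {subset nb v <= F} ->
  v \notin T -> v \notin S -> ~~ A v ->
  pratio z s rho A F (v :: S) T = pratio z s rho A F S T
    + s * pratio z s rho A F S (v :: T)
    - rho%:C * \sum_(w <- nb v | (w \notin v :: T) && A w) pratio z s rho A F S (w :: v :: T).
Proof.
move=> uF vF nF vT vS Av.
have symC S' a b : (pc rho A S' a b)%:C = (pc rho A S' b a)%:C :> R[i] by rewrite pc_sym.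
have pcv w : pc rho A S v w = ew R g v w by rewrite /pc (negPf vS) (negPf Av) andbF mulr1.
have pcv' w : pc rho A (v :: S) v w = ew R g v w + rho * (ew R g v w *+ A w).
  rewrite /pc mem_head (negPf Av) andbF orbF andTb; case: (A w); last by rewrite mulr0n; ring.
  by rewrite mulr1n; ring.
pose M := muC (px z s S) (pc rho A S) F.
have e1 : muC (px z s (v :: S)) (pc rho A (v :: S)) F T =
    (z + s) * M (v :: T) - (\sum_(w <- F | w \notin v :: T) (ew R g v w)%:C * M (w :: v :: T)
       + rho%:C * \sum_(w <- nb v | (w \notin v :: T) && A w) M (w :: v :: T)).
  apply: etrans (muD_expand _ (symC (v :: S)) uF vF vT) _.
  apply: (f_equal2 (fun a b : R[i] => a - b)).
    by rewrite [px _ _ _ v]/px mem_head -/(muC _ _ _ _) muC_del ?mem_head.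
  have -> : \sum_(w <- nb v | (w \notin v :: T) && A w) M (w :: v :: T) =
      \sum_(w <- F | w \notin v :: T) (ew R g v w *+ A w)%:C * M (w :: v :: T).
    rewrite [RHS](sum_nb (nb_uniq gG) (u := v)) //; last first.
      by move=> w wn; rewrite (ew_nb _ gG wn) mul0rn mul0r.
    rewrite big_mkcondr /= [LHS]big_seq_cond [RHS]big_seq_cond; apply: eq_bigr => w /andP[wn _].
    rewrite /ew -(nbE gG) wn; case: (A w); last by rewrite mulr0n mul0r.
    by rewrite mulr1n mul1r.
  rewrite mulr_sumr -big_split /=; apply: eq_bigr => w _.
  rewrite -/(muC _ _ _ _) muC_del; last by rewrite !inE eqxx orbT.
  by rewrite pcv' rmorphD rmorphM mulrDl mulrA.
have e2 : M T = z * M (v :: T)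
    - \sum_(w <- F | w \notin v :: T) (ew R g v w)%:C * M (w :: v :: T).
  rewrite {1}/M {1}/muC (@muD_expand _ _ _ (symC S) _ _ _ uF vF vT) {1}/px (negPf vS).
  by congr (_ - _); apply: eq_bigr => w _; rewrite pcv.
rewrite /pratio e1 -mulr_suml -!/(M _) e2; ring.
Qed.

Lemma mulcJ_nsq (w : R[i]) : w * conjc w = (nsq w)%:C.
Proof. by case: w => a b; congr (_ +i* _); rewrite /nsq /=; ring. Qed.

Lemma ccvgJ (u : nat -> R[i]) l : ccvg u l -> ccvg (fun n => conjc (u n)) (conjc l).
Proof.
have eR (w : R[i]) : complex.Re (conjc w) = complex.Re w by case: w.
have eI (w : R[i]) : complex.Im (conjc w) = - complex.Im w by case: w.
case=> hr hi; split; rewrite ?eR ?eI; first by under eq_fun do rewrite eR.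
by under eq_fun do rewrite eI; apply: cvgN.
Qed.

Variables (z s : R[i]) (rho : R) (A : pred nat).
Hypotheses (z0 : 0 < complex.Im z) (zs0 : 0 < complex.Im (z + s)) (rho1 : -1 <= rho).

Definition padm (S T : seq nat) :=
  [&& uniq S, all (lV g) S, all (fun v => ~~ A v) S & ~~ has (mem S) T].

Lemma zeta_cvg S T : padm S T ->
  ccvg (fun n => pratio z s rho A (window g n) S T) (zeta z s rho A S T).
Proof.
elim: S T => [|v S IH] T.
  move=> _; apply: ccvg_near (rr_cvg gG z0 T hw); apply: nearW => n.
  rewrite /ratio /pratio; congr (_ / _); apply: eq_mu => // a b _ _.
  by rewrite /pc mulr1.
case/and4P => /= /andP[vS uS] /andP[gv VS] /andP[Av AS] vT.
have [vT' sT] : v \notin T /\ ~~ has (mem S) T.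
  split; first by apply: contra vT => vT; apply/hasP; exists v; rewrite //= mem_head.
  by apply: contra vT => /hasP[w wT /= wS]; apply/hasP; exists w; rewrite //= inE wS orbT.
have ad T' : ~~ has (mem S) T' -> padm S T' by move=> h; rewrite /padm uS VS AS.
have h : ccvg (fun n => pratio z s rho A (window g n) S T
    + s * pratio z s rho A (window g n) S (v :: T)
    - rho%:C * \sum_(w <- nb v | (w \notin v :: T) && A w)
         pratio z s rho A (window g n) S (w :: v :: T)) (zeta z s rho A (v :: S) T).
  apply: ccvgB.
    apply: ccvgD; first by apply/IH/ad.
    by apply: ccvgM; [exact: ccvg_cst|apply/IH/ad; rewrite /= negb_or vS].
  apply: ccvgM; [exact: ccvg_cst|apply: ccvg_sum => w /andP[_ Aw]].
  apply/IH/ad; rewrite /= !negb_or vS sT !andbT.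
  by apply: contraL Aw => wS; move/allP: AS => /(_ w wS).
apply: ccvg_near h; near=> n.
have [vin nF] : v \in window g n /\ {subset nb v <= window g n}.
  by near: n; apply: (near_window gG).
by rewrite pratio_cons //; case: hw.
Unshelve. all: by end_near. Qed.

Let pgreen n S := green (px z s S) (pc rho A S) (window g n).

Lemma pratio_green n S T u :
  pratio z s rho A (window g n) S (u :: T) = pgreen n S T u * pratio z s rho A (window g n) S T.
Proof.
rewrite /pratio /pgreen /green mulrA divfK //.
apply: (muC_neq0 (@pc_sym _ _ _)) => [a b|v|]; [exact: pc_ge0|exact: px_gt0|by case: hw].
Qed.

Lemma pratio_neq0 n S T : pratio z s rho A (window g n) S T != 0.
Proof.
have uF : uniq (window g n) by case: hw.
rewrite /pratio mulf_neq0 ?invr_eq0 //.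
  apply: (muC_neq0 (@pc_sym _ _ _)) => // [a b|v]; [exact: pc_ge0|exact: px_gt0].
by apply: (muC_neq0 esym (@ew_ge0 _ _)).
Qed.

(** At finite volume the quotient of the two factors is a Green function of the perturbed graph.
    Multiplying by the conjugate instead of dividing lets its sign pass to a limit whose denominator
    might vanish. *)
Lemma zeta_Im S T u : padm S (u :: T) -> lV g u -> u \notin T ->
  complex.Im (zeta z s rho A S (u :: T) * conjc (zeta z s rho A S T)) <= 0.
Proof.
move=> ad gu uT.
have ad' : padm S T by case/and4P: ad => a b c; rewrite /= negb_or => /andP[_ d]; apply/and4P.
have [_ h] := ccvgM (zeta_cvg ad) (ccvgJ (zeta_cvg ad')).
apply: (cvgr_to_le h); near=> n.
have uin : u \in window g n by near: n; case: hw => _ _; apply.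
rewrite pratio_green -mulrA.
rewrite mulcJ_nsq.
rewrite Im_mul /= mulr0 add0r mulr_le0_ge0 ?nsq_ge0 // ltW //.
apply: (green_Im (@pc_sym _ _ _)) => // [a b|v|]; [exact: pc_ge0|exact: px_gt0|by case: hw].
Unshelve. all: by end_near. Qed.

(* The limit form of the positivity of the self-energy coming from the edges that
   do not lead to [A]. *)
Lemma zeta_part S u : padm S [:: u] -> lV g u -> ~~ A u ->
  let Z := zeta z s rho A S in
  0 <= complex.Im ((Z [::] + \sum_(v <- nb u | A v) Z [:: v; u]
                    - (0 +i* complex.Im z) * Z [:: u]) * conjc (Z [:: u])).
Proof.
move=> ad gu Au /=; set Z := zeta z s rho A S.
have [uS US VS AS] : [/\ u \notin S, uniq S, all (lV g) S & all (fun v => ~~ A v) S].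
  by case/and4P: ad => a b c; rewrite /= orbF.
have ad0 : padm S [::] by apply/and4P.
have ada v : A v -> padm S [:: v; u].
  move=> Av; apply/and4P; split=> //=; rewrite !negb_or uS !andbT.
  by apply: contraL Av => vS; move/allP: AS => /(_ v vS).
have [_ h] := ccvgM (ccvgB (ccvgD (zeta_cvg ad0) (@ccvg_sum R _ (nb u) _ _ _ (fun v Av => zeta_cvg (ada v Av))))
   (ccvgM (ccvg_cst (0 +i* complex.Im z)) (zeta_cvg ad))) (ccvgJ (zeta_cvg ad)).
apply: (cvgr_to_ge h); near=> n.
have [uin nF] : u \in window g n /\ {subset nb u <= window g n}.
  by near: n; apply: (near_window gG).
have uF : uniq (window g n) by case: hw.
set r := pratio z s rho A (window g n) S [::].
have n0 : pgreen n S [::] u != 0.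
  by apply: (green_neq0 (@pc_sym _ _ _)) => // [a b|v]; [exact: pc_ge0|exact: px_gt0].
have e1 : pratio z s rho A (window g n) S [:: u] = pgreen n S [::] u * r.
  exact: pratio_green.
have -> : r + \sum_(v <- nb u | A v) pratio z s rho A (window g n) S [:: v; u]
    - (0 +i* complex.Im z) * pratio z s rho A (window g n) S [:: u]
  = ((pgreen n S [::] u)^-1 + \sum_(v <- window g n | (v \notin [:: u]) && A v)
        (pc rho A S u v)%:C * pgreen n S [:: u] v - (0 +i* complex.Im z))
    * pratio z s rho A (window g n) S [:: u].
  rewrite mulrBl mulrDl; congr (_ + _ - _); first by rewrite e1 mulKf.
  rewrite mulr_suml (sum_nb (F := window g n) (nb_uniq gG) (u := u)) //; last first.
    by move=> v vn; rewrite /pc (ew_nb _ gG vn) !mul0r.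
  rewrite [LHS]big_seq_cond [RHS]big_seq_cond; apply: eq_big => v.
    case vn: (v \in nb u) => //=; rewrite inE; case: eqVneq => // vu.
    by move: vn; rewrite vu (nbE gG) (adj_irr gG).
  move=> /andP[vn Av]; rewrite pratio_green; congr (_ * _).
  by rewrite /pc (negPf uS) (negPf Au) andbF /= mulr1 /ew -(nbE gG) vn mul1r.
rewrite -mulrA mulcJ_nsq.
rewrite Im_mul /= mulr0 add0r mulr_ge0 ?nsq_ge0 // ImD ImN /= subr_ge0.
have := @greenV_Im_part R (px z s S) (pc rho A S) (@pc_sym _ _ _) (fun a b => pc_ge0 A S a b rho1)
  (fun v => px_gt0 S v z0 zs0) _ uF [::] u A uin isT.
by rewrite {1}/px (negPf uS).
Unshelve. all: by end_near. Qed.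

End Perturbation.

Lemma scaled_sqr_le (R : realFieldType) (t a : R) : 0 <= t -> t <= 1 ->
  t * (a ^+ 2 + t) <= a ^+ 2 + 1.
Proof. by move=> t0 t1; have := sqr_ge0 a; nra. Qed.

Lemma Im_realM (R : realType) (t : R) (z : R[i]) : complex.Im (t%:C * z) = t * complex.Im z.
Proof. by case: z => a b; rewrite /= mul0r addr0. Qed.

Lemma eps_arith (R : realFieldType) (a b w e x p : R) :
  p <= 2 * (b - a) + 2 * x -> b - w < e / 4 -> x < e / 4 -> w <= a -> p < e.
Proof. by lra. Qed.

(** For [s / t] small, the Pick inequality bounds Im f at [s] by the increment of Re f between [s]
    and [t]. Hence convergence of Re f forces Im f to 0. *)
Lemma pick_im (R : realType) (s t a b p q : R) : 0 < t -> 0 <= a -> a <= b ->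
  a ^+ 2 + p ^+ 2 <= 1 -> b ^+ 2 + q ^+ 2 <= 1 ->
  (t * p - s * q) ^+ 2 + (t * a + s * b) ^+ 2 <= (s + t) ^+ 2 * (a * b) ->
  p ^+ 2 <= 2 * (b - a) + 2 * (s / t) ^+ 2.
Proof.
move=> t0 a0 ab ha hb H; have t2 : 0 < t ^+ 2 by rewrite exprn_gt0.
rewrite -(ler_pM2l t2).
have -> : t ^+ 2 * (2 * (b - a) + 2 * (s / t) ^+ 2) = 2 * (t ^+ 2 * (b - a)) + 2 * s ^+ 2.
  by field; rewrite gt_eqF.
have h1 : (t * p - s * q) ^+ 2 <= (b - a) * (t ^+ 2 * a - s ^+ 2 * b).
  by move: H; lra.
have a1 : a <= 1 by have := sqr_ge0 p; nra.
have h2 : (b - a) * (t ^+ 2 * a - s ^+ 2 * b) <= t ^+ 2 * (b - a).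
  rewrite mulrC ler_wpM2r ?subr_ge0 //; have := sqr_ge0 s.
  have : t ^+ 2 * a <= t ^+ 2 by rewrite ler_piMr // ltW.
  move=> h3 h4; have : 0 <= s ^+ 2 * b by rewrite mulr_ge0 // (le_trans a0).
  lra.
have h3 : s ^+ 2 * q ^+ 2 <= s ^+ 2.
  by rewrite ler_piMr ?sqr_ge0 //; have := sqr_ge0 b; lra.
have := sqr_ge0 (t * p - 2 * (s * q)); lra.
Qed.

Lemma Re_imul (R : realType) (t : R) (z : R[i]) :
  complex.Re ((0 +i* t) * z) = - (t * complex.Im z).
Proof. by case: z => a b; rewrite /= mul0r sub0r. Qed.

Lemma nsqD_ge (R : realType) (z w : R[i]) :
  0 <= complex.Re (w * conjc z) -> nsq z <= nsq (z + w).
Proof.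
case: z w => a b [c d]; rewrite /nsq /= => h.
by have := sqr_ge0 c; have := sqr_ge0 d; lra.
Qed.

Lemma divCJ (R : realType) (z w : R[i]) : w != 0 -> z / w = (nsq w)^-1%:C * (z * conjc w).
Proof.
move=> w0; have n0 : nsq w != 0 by rewrite gt_eqF // nsq_gt0.
apply: (mulIf w0); rewrite divfK // -!mulrA [conjc w * w]mulrC mulcJ_nsq.
by rewrite mulrCA -rmorphM /= mulVf // mulr1.
Qed.

(** * Atoms of the Green function *)

Section Atom.
Variables (R : realType) (g : lgraph) (D : nat) (nb : nat -> seq nat).
Hypothesis gG : good_graph D g nb.
Variable theta : R.

Definition zt (t : R) : R[i] := theta +i* t.
Definition st (sigma t : R) : R[i] := 0 +i* (sigma * t).
Let ze (sigma t : R) := zeta g nb (zt t) (st sigma t) 0 pred0.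
Let hw := window_exhausts g.

Let z0 t : 0 < t -> 0 < complex.Im (zt t). Proof. by []. Qed.
Let zs0 sigma t : 0 <= sigma -> 0 < t -> 0 < complex.Im (zt t + st sigma t).
Proof. by move=> s0 t0; rewrite ImD /= ltr_wpDr // mulr_ge0 // ltW. Qed.
Let r1 : -1 <= 0 :> R. Proof. lra. Qed.

Lemma ze_cons sigma t v S T : ze sigma t (v :: S) T =
  ze sigma t S T + st sigma t * ze sigma t S (v :: T).
Proof. by rewrite /ze /= mul0r subr0. Qed.

Lemma padm_cons A S v T : padm g A (v :: S) T -> padm g A S T /\ padm g A S (v :: T).
Proof.
case/and4P => /= /andP[vS uS] /andP[gv VS] /andP[Av AS] vT.
have sT : ~~ has (mem S) T.
  by apply: contra vT => /hasP[w wT /= wS]; apply/hasP; exists w; rewrite //= inE wS orbT.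
by rewrite /padm uS VS AS sT /= negb_or vS sT.
Qed.

(** Each mass shift adds a term whose product with the conjugate of the previous value has
    nonnegative real part, so moduli can only grow. In particular the perturbed ratios never
    vanish. *)
Lemma ze_ge sigma t S T : 0 <= sigma -> 0 < t -> padm g pred0 S T ->
  nsq (rr g (zt t) T) <= nsq (ze sigma t S T).
Proof.
move=> s0 t0; elim: S => [|v S IH] // ad; have [ad1 ad2] := padm_cons ad.
have [gv vT] : lV g v /\ v \notin T.
  case/and4P: ad => _ /andP[gv _] _ h; split=> //; apply: contra h => vT.
  by apply/hasP; exists v; rewrite //= mem_head.
apply: (le_trans (IH ad1)); rewrite ze_cons; apply: nsqD_ge.
have h := zeta_Im gG (z0 t0) (zs0 s0 t0) r1 ad2 gv vT.
by rewrite -mulrA Re_mul /= mul0r add0r oppr_ge0 mulr_ge0_le0 // mulr_ge0 // ltW.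
Qed.

Lemma ze_neq0 sigma t S T : 0 <= sigma -> 0 < t -> padm g pred0 S T -> ze sigma t S T != 0.
Proof.
move=> s0 t0 ad; rewrite -nsq_gt0; apply: lt_le_trans (ze_ge s0 t0 ad).
by rewrite nsq_gt0 (rr_neq0 gG (z0 t0)).
Qed.

(** Scaling the imaginary masses on [S] by 1 + sigma only changes the speeds in [wline], so the
    two-point inequality holds at finite volume; it passes to the limit because the limiting
    denominators are nonzero by [ze_neq0]. *)
Lemma ze_pick sigma s t S T u : 0 <= sigma -> 0 < s -> 0 < t ->
  padm g pred0 S (u :: T) -> lV g u -> u \notin T ->
  let f r := (0 +i* r) * (ze sigma r S (u :: T) / ze sigma r S T) in
  (t * complex.Im (f s) - s * complex.Im (f t)) ^+ 2
    + (t * complex.Re (f s) + s * complex.Re (f t)) ^+ 2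
  <= (s + t) ^+ 2 * (complex.Re (f s) * complex.Re (f t)).
Proof.
move=> sg0 s0 t0 ad gu uT /=; set f := fun r : R => (0 +i* r) * (ze sigma r S (u :: T) / ze sigma r S T).
rewrite -![_ * (ze sigma _ S (u :: T) / _)]/(f _).
have ad' : padm g pred0 S T.
  by case/and4P: ad => a b c; rewrite /= negb_or => /andP[_ d]; apply/and4P.
pose y (v : nat) : R := if v \in S then 1 + sigma else 1.
have y0 v : 0 < y v by rewrite /y; case: ifP => // _; lra.
pose gr r n := green (wline (fun=> theta) y r) (pc g 0 pred0 S) (window g n) T u.
have cf r : 0 < r -> ccvg (fun n => (0 +i* r) * gr r n) (f r).
  move=> r0; apply: ccvgM; first exact: ccvg_cst.
  have c1 := zeta_cvg gG (st sigma r) 0 (z0 r0) ad.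
  have c2 := ccvgV (ze_neq0 sg0 r0 ad') (zeta_cvg gG (st sigma r) 0 (z0 r0) ad').
  apply: ccvg_near (ccvgM c1 c2); apply: nearW => n.
  rewrite (pratio_green gG _ (z0 r0) (zs0 sg0 r0)) // mulfK; last first.
    exact: (pratio_neq0 gG _ (z0 r0) (zs0 sg0 r0)).
  have eqx : px (zt r) (st sigma r) S = wline (fun=> theta) y r.
    apply/funext => v; rewrite /px /wline /y; case: ifP => _; congr (_ +i* _); ring.
  by rewrite /gr -eqx.
have [sR sI] := cf s s0; have [tR tI] := cf t t0.
rewrite -subr_ge0.
set L := (X in 0 <= X).
suff h : (s + t) ^+ 2 * (complex.Re ((0 +i* s) * gr s n) * complex.Re ((0 +i* t) * gr t n))
  - ((t * complex.Im ((0 +i* s) * gr s n) - s * complex.Im ((0 +i* t) * gr t n)) ^+ 2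
    + (t * complex.Re ((0 +i* s) * gr s n) + s * complex.Re ((0 +i* t) * gr t n)) ^+ 2)
   @[n --> \oo] --> L.
  apply: (cvgr_to_ge h); near=> n; rewrite subr_ge0; apply: pick_real => //.
  apply: green_pick => //; first exact: pc_sym gG _ _ _.
  - by move=> a b; apply: pc_ge0.
  - by case: hw.
  - by near: n; case: hw => _ _; apply.
have lin (c d lp lq : R) (p q : nat -> R) : p n @[n --> \oo] --> lp -> q n @[n --> \oo] --> lq ->
    (c * p n + d * q n) ^+ 2 @[n --> \oo] --> (c * lp + d * lq) ^+ 2.
  move=> hp hq; have h : c * p n + d * q n @[n --> \oo] --> c * lp + d * lq.
    by apply: cvgD; (apply: cvgM; first exact: cvg_cst).
  by rewrite expr2; under eq_fun do rewrite expr2; apply: cvgM.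
have hI := lin t (- s) _ _ _ _ sI tI; have hR := lin t s _ _ _ _ sR tR.
have comb (p q a b : nat -> R) (lp lq la lb : R) : p n @[n --> \oo] --> lp ->
    q n @[n --> \oo] --> lq -> a n @[n --> \oo] --> la -> b n @[n --> \oo] --> lb ->
    (s + t) ^+ 2 * (p n * q n) - (a n + b n) @[n --> \oo] --> (s + t) ^+ 2 * (lp * lq) - (la + lb).
  move=> hp hq ha hb; apply: cvgB; last exact: cvgD.
  by apply: cvgM; [exact: cvg_cst|exact: cvgM].
have hL := comb _ _ _ _ _ _ _ _ sR tR hI hR.
have -> : L = (s + t) ^+ 2 * (complex.Re (f s) * complex.Re (f t)) -
  ((t * complex.Im (f s) + - s * complex.Im (f t)) ^+ 2 +
   (t * complex.Re (f s) + s * complex.Re (f t)) ^+ 2) by rewrite /L mulNr.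
by under eq_fun do rewrite -[- (s * _)]mulNr; exact: hL.
Unshelve. all: by end_near. Qed.

Definition tk (k : nat) : R := k.+1%:R^-1.

Lemma tk_gt0 k : 0 < tk k. Proof. by rewrite invr_gt0 ltr0n. Qed.

Lemma tk_cvg0 : tk k @[k --> \oo] --> (0 : R).
Proof. exact: cvg_harmonic. Qed.

Lemma tk_mono k m : (k <= m)%N -> tk m <= tk k.
Proof. by move=> km; rewrite lef_pV2 ?posrE ?ltr0n // ler_nat. Qed.

Lemma tk_le1 k : tk k <= 1.
Proof. by rewrite invf_le1 ?ltr0n // ler1n. Qed.

Lemma tk2_le1 k : tk k ^+ 2 <= 1.
Proof. by rewrite expr_le1 // ?tk_le1 // ltW // tk_gt0. Qed.

Definition fk (T : seq nat) (u k : nat) : R[i] := (0 +i* tk k) * gg g (zt (tk k)) T u.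

(** Resolvent form of the mass at [theta] of the matching measure at [u] in the graph minus [T]. The
    limit exists because the real parts decrease along [tk]; it is 0 when [u] is deleted. *)
Definition atom_def (T : seq nat) (u : nat) : R :=
  lim (complex.Re (fk T u k) @[k --> \oo]).
Fact atom_key : unit. Proof. exact: tt. Qed.
Definition atom := locked_with atom_key atom_def.

Lemma atomE T u : atom T u = lim (complex.Re (fk T u k) @[k --> \oo]).
Proof. by rewrite /atom locked_withE. Qed.

Lemma fk_dup T u k : (u \in T) || ~~ lV g u -> fk T u k = 0 +i* tk k.
Proof.
move=> h; rewrite /fk /gg (rr_dup gG (z0 (tk_gt0 k)) h) divff ?mulr1 //.
exact: (rr_neq0 gG (z0 (tk_gt0 k))).
Qed.

Lemma Re_fk T u k : complex.Re (fk T u k) = tk k * - complex.Im (gg g (zt (tk k)) T u).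
Proof. by rewrite /fk Re_imul mulrN. Qed.

Lemma nsq_fk_le T u k : nsq (fk T u k) <= 1.
Proof.
have t0 := tk_gt0 k.
have [h|] := boolP ((u \in T) || ~~ lV g u).
  by rewrite fk_dup // /nsq /=; have := tk_le1 k; nra.
rewrite negb_or negbK => /andP[uT gu].
have [_ h] := gg_le gG (z0 t0) gu uT.
have ni : nsq (0 +i* tk k : R[i]) = tk k ^+ 2 by rewrite /nsq /= expr0n add0r.
rewrite /fk nsqM ni -[leRHS](mulfV (_ : tk k ^+ 2 != 0)) ?ler_wpM2l ?sqr_ge0 //.
by rewrite expf_neq0 // gt_eqF.
Qed.

Lemma Re_fk_ge0 T u k : 0 <= complex.Re (fk T u k).
Proof.
have [h|] := boolP ((u \in T) || ~~ lV g u); first by rewrite fk_dup.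
rewrite negb_or negbK => /andP[uT gu].
by rewrite Re_fk mulr_ge0 ?(ltW (tk_gt0 k)) // oppr_ge0 ltW // (gg_Im gG (z0 (tk_gt0 k))).
Qed.

Lemma fk_pick T u k m : lV g u -> u \notin T ->
  (tk k * complex.Im (fk T u m) - tk m * complex.Im (fk T u k)) ^+ 2
    + (tk k * complex.Re (fk T u m) + tk m * complex.Re (fk T u k)) ^+ 2
  <= (tk m + tk k) ^+ 2 * (complex.Re (fk T u m) * complex.Re (fk T u k)).
Proof.
move=> gu uT; have ad : padm g pred0 [::] (u :: T) by rewrite /padm /=; elim: (T).
exact: (@ze_pick 0 _ _ _ _ _ (lexx 0) (tk_gt0 m) (tk_gt0 k) ad gu uT).
Qed.

Lemma Re_fk_mono T u k m : (k <= m)%N -> complex.Re (fk T u m) <= complex.Re (fk T u k).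
Proof.
move=> km; have [h|] := boolP ((u \in T) || ~~ lV g u); first by rewrite !fk_dup.
rewrite negb_or negbK => /andP[uT gu].
exact: pick_mono (tk_gt0 m) (tk_mono km) (Re_fk_ge0 T u k) (fk_pick k m gu uT).
Qed.

Lemma Re_fk_cvg T u : complex.Re (fk T u k) @[k --> \oo] --> atom T u.
Proof.
rewrite atomE; apply: nonincreasing_is_cvgn; first by move=> k m; apply: Re_fk_mono.
by exists 0 => _ [k _ <-]; apply: Re_fk_ge0.
Qed.

Lemma atom_le T u k : atom T u <= complex.Re (fk T u k).
Proof.
rewrite atomE; apply: (nonincreasing_cvgn_ge (u_ := fun k => complex.Re (fk T u k))).
  by move=> n m; apply: Re_fk_mono.
by apply/cvg_ex; exists (atom T u); apply: Re_fk_cvg.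
Qed.

Lemma atom_ge0 T u : 0 <= atom T u.
Proof.
by rewrite atomE; apply: limr_ge; [apply/cvg_ex; exists (atom T u); apply: Re_fk_cvg|apply: nearW => k; apply: Re_fk_ge0].
Qed.

Lemma fk_cvg T u : ccvg (fk T u) (atom T u)%:C.
Proof.
split; first exact: Re_fk_cvg.
have [h|] := boolP ((u \in T) || ~~ lV g u).
  by under eq_fun do rewrite fk_dup //; exact: tk_cvg0.
rewrite negb_or negbK => /andP[uT gu] /=.
suff : ccvg (fun k => (complex.Im (fk T u k))%:C) 0 by case.
apply/ccvg0P/cvgrPdist_lt => e e0.
have [k hk] : exists k, complex.Re (fk T u k) - atom T u < e / 4.
  have : \forall k \near \oo, `|atom T u - complex.Re (fk T u k)| < e / 4.
    by move/cvgrPdist_lt: (@Re_fk_cvg T u); apply; rewrite divr_gt0.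
  case=> k _ /(_ k (leqnn k)) /= h; exists k; apply: le_lt_trans h.
  by rewrite distrC ler_norm.
have tt : (tk m / tk k) ^+ 2 @[m --> \oo] --> (0 : R).
  have h : tk m / tk k @[m --> \oo] --> (0 : R).
    by rewrite -(mul0r (tk k)^-1); apply: cvgM; [exact: tk_cvg0|exact: cvg_cst].
  by under eq_fun do rewrite expr2; rewrite -(mulr0 0); apply: cvgM.
near=> m; rewrite sub0r normrN nsqR ger0_norm ?sqr_ge0 //.
have km : (k <= m)%N by near: m; exists k.
have small : (tk m / tk k) ^+ 2 < e / 4.
  have : `|0 - (tk m / tk k) ^+ 2| < e / 4.
    by near: m; move/cvgrPdist_lt: tt; apply; rewrite divr_gt0.
  by rewrite sub0r normrN ger0_norm ?sqr_ge0.
have P := fk_pick k m gu uT; have Nk := nsq_fk_le T u k; have Nm := nsq_fk_le T u m.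
have am := atom_le T u m; have Rm := Re_fk_mono T u km.
have Rk0 := Re_fk_ge0 T u k; have Rm0 := Re_fk_ge0 T u m.
exact: eps_arith (pick_im (tk_gt0 k) Rm0 Rm Nm Nk P) hk small am.
Unshelve. all: by end_near. Qed.

Lemma atom_le1 T u : atom T u <= 1.
Proof.
apply: le_trans (atom_le T u 0) _; have := nsq_fk_le T u 0; rewrite /nsq.
by move: (complex.Re _) (complex.Im _) => a b h; have := sqr_ge0 b; nra.
Qed.

End Atom.

Lemma Re_realM (R : realType) (t : R) (z : R[i]) : complex.Re (t%:C * z) = t * complex.Re z.
Proof. by case: z => a b; rewrite /= mul0r subr0. Qed.

Lemma mulcJ_div (R : realType) (a b r : R[i]) :
  (a / r) * conjc (b / r) = (nsq r)^-1%:C * (a * conjc b).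
Proof.
have cM (z w : R[i]) : conjc (z * w) = conjc z * conjc w.
  by case: z w => p q [p' q']; congr (_ +i* _); ring.
rewrite cM mulrACA mulrC; congr (_ * _).
by rewrite mulcJ_nsq nsqV.
Qed.

(** * Essential vertices under deletion *)

Section Essential.
Variables (R : realType) (g : lgraph) (D : nat) (nb : nat -> seq nat).
Hypothesis gG : good_graph D g nb.
Variable theta : R.

Local Notation tk := (@tk R).
Local Notation it k := ((0 +i* tk k) : R[i]).
Local Notation zk k := (zt theta (tk k)).
Local Notation w := (atom g theta).

Let z0 k : 0 < complex.Im (zk k). Proof. exact: tk_gt0. Qed.

Lemma it_neq0 k : it k != 0.
Proof. by rewrite -nsq_gt0 /nsq /= expr0n add0r exprn_gt0 // tk_gt0. Qed.

Lemma nsq_it k : nsq (it k) = tk k ^+ 2.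
Proof. by rewrite /nsq /= expr0n add0r. Qed.

Fixpoint fprod (B T : seq nat) (k : nat) : R[i] :=
  if T is u :: T' then fk g theta (T' ++ B) u k * fprod B T' k else 1.

Lemma fprodE B T k :
  fprod B T k = it k ^+ size T * (rr g (zk k) (T ++ B) / rr g (zk k) B).
Proof.
elim: T => [|u T IH] /=; first by rewrite mul1r divff // (rr_neq0 gG (z0 k)).
rewrite IH exprS (rr_cons gG (z0 k)) /fk; ring.
Qed.

Lemma fprod_perm B T T' k : perm_eq T T' -> fprod B T k = fprod B T' k.
Proof.
move=> p; rewrite !fprodE (perm_size p); congr (_ * (_ / _)).
by apply: (rr_eq gG (z0 k)) => v; rewrite !mem_cat (perm_mem p).
Qed.

Lemma fprod_cat B T T' k : fprod B (T ++ T') k = fprod (T' ++ B) T k * fprod B T' k.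
Proof. by elim: T => [|u T IH] /=; rewrite ?mul1r // IH catA mulrA. Qed.

Lemma nsq_fprod B T k : nsq (fprod B T k) <= 1.
Proof.
elim: T => [|u T IH] /=; first by rewrite /nsq /= expr0n addr0 expr1n.
by rewrite nsqM mulr_ile1 ?nsq_ge0 // (nsq_fk_le gG).
Qed.

(** The product is (i t)^|T| mu(G - T - B) / mu(G - B), hence independent of the order of deletion,
    and its factors have modulus at most 1. So it tends to 0 as soon as the product over some subset
    does. *)
Lemma fprod_cvg0 B T0 T : uniq T0 -> {subset T0 <= T} ->
  ccvg (fprod B T0) 0 -> ccvg (fprod B T) 0.
Proof.
move=> u0 sub h0.
have [T1 p1] : exists T1, perm_eq T (T1 ++ T0).
  elim: T0 u0 T sub {h0} => [|u T0 IH] /=; first by move=> _ T _; exists T; rewrite cats0.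
  move=> /andP[uT0 uT] T sub.
  have uin : u \in T by apply: sub; rewrite mem_head.
  have [|T1 p1] := IH uT (rem u T).
    move=> v vT0; have vT : v \in T by apply: sub; rewrite inE vT0 orbT.
    have := perm_mem (perm_to_rem uin) v; rewrite vT inE.
    by case: eqVneq vT0 uT0 => [-> ->|].
  exists T1; rewrite (permPl (perm_to_rem uin)) perm_sym -cat1s perm_catCA /= perm_cons.
  by rewrite perm_sym.
apply: ccvg_near (ccvg0M (nsq_fprod (T0 ++ B) T1) h0); apply: nearW => k.
by rewrite (fprod_perm _ _ p1) fprod_cat mulrC.
Qed.

Lemma fk_cvg0 T u : w T u = 0 -> ccvg (fk g theta T u) 0.
Proof. by move=> e; have := fk_cvg gG theta T u; rewrite e. Qed.

Lemma fk_atom0 T u : ccvg (fk g theta T u) 0 -> w T u = 0.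
Proof. by move=> h; have [] := ccvg_unique (fk_cvg gG theta T u) h. Qed.

Section DeleteInessential.
Variables (S : seq nat) (b : nat).
Hypotheses (uS : uniq S) (VS : all (lV g) S) (S0 : {in S, forall a, w [::] a = 0}).
Hypotheses (gb : lV g b) (bS : b \notin S).

Let ze sigma k := zeta g nb (zk k) (st sigma (tk k)) 0 pred0.

(** Every term that uses the perturbation deletes an inessential vertex and vanishes by
    [fprod_cvg0]: heavier masses on [S] are invisible at the scale of the atom. *)
Lemma ze_lim sigma T :
  ccvg (fun k => it k ^+ size T * ze sigma k S T - fprod [::] T k) 0.
Proof.
elim: S S0 T => [|v S' IH] S0' T.
  apply: ccvg_near (ccvg_cst 0); apply: nearW => k.
  by rewrite fprodE cats0 (rr_nil gG (z0 k)) divr1 subrr.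
have S1 : {in S', forall a, w [::] a = 0} by move=> a aS; apply: S0'; rewrite inE aS orbT.
have h1 := IH S1 T; have h2 := IH S1 (v :: T).
have h3 : ccvg (fprod [::] (v :: T)) 0.
  apply: (@fprod_cvg0 _ [:: v]) => //; first by move=> x; rewrite inE => /eqP ->; rewrite mem_head.
  apply: ccvg_near (fk_cvg0 (S0' v (mem_head _ _))); apply: nearW => k.
  by rewrite /= mulr1.
have h4 := ccvgM (ccvg_cst sigma%:C) (ccvgD h2 h3).
have := ccvgD h1 h4; rewrite addr0 add0r mulr0; apply: ccvg_near; apply: nearW => k.
have e : st sigma (tk k) = sigma%:C * it k by congr (_ +i* _); ring.
rewrite /ze ze_cons /= e exprS; ring.
Qed.

(** The right-hand side decreases to the atom as t tends to 0, by the Pick inequality, so the bound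
    holds at each fixed t and uniformly in sigma. This is what permits sigma to tend to infinity
    before t tends to 0. *)
Lemma ze_atom sigma i : 0 <= sigma ->
  w [::] b <= complex.Re (it i * (ze sigma i S [:: b] / ze sigma i S [::])).
Proof.
move=> sg0; have ad : padm g pred0 S [:: b].
  by apply/and4P; split=> //=; rewrite ?orbF //; apply/allP.
have ad0 : padm g pred0 S [::] by apply/and4P; split => //; apply/allP.
pose f j := it j * (ze sigma j S [:: b] / ze sigma j S [::]).
have nz j : ze sigma j S [::] != 0 by apply: (ze_neq0 gG) => //; exact: tk_gt0.
have hf : ccvg f (w [::] b)%:C.
  have h1 := ze_lim sigma [::]; have h2 := ze_lim sigma [:: b].
  have c1 : ccvg (fun k => ze sigma k S [::]) 1.
    rewrite -[1]add0r; apply: ccvg_near (ccvgD h1 (ccvg_cst 1)); apply: nearW => k.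
    by rewrite /= mul1r subrK.
  have c2 : ccvg (fun k => it k * ze sigma k S [:: b]) (w [::] b)%:C.
    rewrite -[X in ccvg _ X]add0r; apply: ccvg_near (ccvgD h2 (fk_cvg gG theta [::] b)).
    by apply: nearW => m; rewrite /= mulr1 expr1 subrK.
  have := ccvgM c2 (ccvgV (oner_neq0 _) c1); rewrite invr1 mulr1.
  by apply: ccvg_near; apply: nearW => m; rewrite /f mulrA.
have ge0 m : 0 <= complex.Re (f m).
  have zs : 0 < complex.Im (zk m + st sigma (tk m)).
    by rewrite ImD /= ltr_wpDr ?tk_gt0 // mulr_ge0 // ltW // tk_gt0.
  have r1 : -1 <= 0 :> R by lra.
  have := zeta_Im gG (z0 m) zs r1 ad gb isT; rewrite -!/(ze _ _ _ _) => h.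
  rewrite /f divCJ // Re_imul oppr_ge0 mulr_ge0_le0 ?(ltW (tk_gt0 R m)) //.
  by rewrite Im_realM mulr_ge0_le0 // invr_ge0 nsq_ge0.
have mono m n : (m <= n)%N -> complex.Re (f n) <= complex.Re (f m).
  move=> mn; apply: pick_mono (tk_gt0 R n) (tk_mono R mn) (ge0 m) _.
    exact: (ze_pick gG theta sg0 (tk_gt0 R n) (tk_gt0 R m) ad gb isT).
have [hR _] := hf.
have -> : w [::] b = lim (complex.Re (f m) @[m --> \oo]) by rewrite (cvg_lim _ hR).
apply: (nonincreasing_cvgn_ge (u_ := fun k => complex.Re (f k))) => //.
by apply/cvg_ex; exists (w [::] b).
Qed.

(** With sigma = n + 1 and the normalisation (n + 1)^-|S'|, only the term deleting all of [S']
    survives: infinitely heavy vertices are removed from the graph. *)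
Lemma ze_infty k S' T :
  ccvg (fun n => ze n.+1%:R k S' T * (tk n)%:C ^+ size S')
       (it k ^+ size S' * rr g (zk k) (S' ++ T)).
Proof.
elim: S' T => [|v S' IH] T.
  by apply: ccvg_near (ccvg_cst _); apply: nearW => n; rewrite mulr1 mul1r.
have h := ccvgD (ccvgM (ccvg_real (@tk_cvg0 R)) (IH T)) (ccvgM (ccvg_cst (it k)) (IH (v :: T))).
rewrite mul0r add0r in h.
have -> : it k ^+ size (v :: S') * rr g (zk k) ((v :: S') ++ T) =
   it k * (it k ^+ size S' * rr g (zk k) (S' ++ v :: T)).
  rewrite /= exprS mulrA; congr (_ * _); apply: (rr_eq gG (z0 k)) => x.
  by rewrite !(mem_cat, inE) orbCA.
apply: ccvg_near h; apply: nearW => n.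
have e : st n.+1%:R (tk k) * (tk n)%:C = it k.
  congr (_ +i* _); first by ring.
  by rewrite mulr0 add0r mulrAC -[tk n]/(n.+1%:R^-1) mulfV ?mul1r // pnatr_eq0.
rewrite /ze ze_cons /= exprS -e; ring.
Qed.

(* Deleting inessential vertices does not decrease the mass of the atom: give them a
   mass [1 + sigma], which does not affect the atom, and let sigma tend to infinity. *)
Lemma atom_del : w [::] b <= w S b.
Proof.
suff h k : w [::] b <= complex.Re (fk g theta S b k).
  by rewrite [leRHS]atomE; apply: limr_ge; [by apply/cvg_ex; exists (w S b); apply: (Re_fk_cvg gG)|apply: nearW].
have nr T := rr_neq0 gG (z0 k) T.
have i1 := ze_infty k S [:: b]; have i2 := ze_infty k S [::].
have n0 : it k ^+ size S * rr g (zk k) (S ++ [::]) != 0.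
  by rewrite mulf_neq0 ?expf_neq0 ?it_neq0.
have := ccvgM (ccvg_cst (it k)) (ccvgM i1 (ccvgV n0 i2)).
have -> : it k * (it k ^+ size S * rr g (zk k) (S ++ [:: b]) /
    (it k ^+ size S * rr g (zk k) (S ++ [::]))) = fk g theta S b k.
  rewrite /fk /gg cats0 -(rr_eq gG (z0 k) (T := b :: S)); last first.
    by move=> x; rewrite mem_cat !inE orbC.
  by have := nr S; have := it_neq0 k; move=> h1 h2; field; rewrite h2 expf_neq0.
case=> hR _; apply: (cvgr_to_ge hR); apply: nearW => n.
have -> : it k * (ze n.+1%:R k S [:: b] * (tk n)%:C ^+ size S *
     (ze n.+1%:R k S [::] * (tk n)%:C ^+ size S)^-1) =
   it k * (ze n.+1%:R k S [:: b] / ze n.+1%:R k S [::]).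
  have tn : (tk n)%:C ^+ size S != 0 :> R[i].
    by rewrite expf_neq0 // -nsq_gt0 nsqR exprn_gt0 // tk_gt0.
  by rewrite invfM mulrACA divff // mulr1.
exact: ze_atom.
Qed.

End DeleteInessential.

(* A neighbour that is essential after the deletion of [u] forces the Green function
   at [u] to be of order [t]. *)
Lemma gg_small B u v : lV g u -> u \notin B -> v \in nb u -> v \notin u :: B ->
  0 < w (u :: B) v -> forall k, nsq (gg g (zk k) B u) <= (tk k / w (u :: B) v) ^+ 2.
Proof.
move=> gu uB vn vT w0 k; have t0 := tk_gt0 R k.
have := gg_edge gG (z0 k) gu uB vn vT.
have := atom_le gG theta (u :: B) v k; rewrite Re_fk.
set c := w (u :: B) v in w0 *; set y := complex.Im (gg _ _ (u :: B) v).
set x := complex.Im _^-1 => h1 h2.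
have h : c / tk k <= x.
  rewrite ler_pdivrMr //; have : tk k * (tk k - y) <= tk k * x by rewrite ler_pM2l.
  have := sqr_ge0 (tk k); nra.
have n0 : 0 < nsq (gg g (zk k) B u) by rewrite nsq_gt0 (gg_neq0 gG (z0 k)).
have h3 : (c / tk k) ^+ 2 <= nsq (gg g (zk k) B u)^-1.
  apply: (@le_trans _ _ (x ^+ 2)); last by rewrite /nsq lerDr sqr_ge0.
  have ct0 : 0 <= c / tk k := divr_ge0 (ltW w0) (ltW t0).
  by rewrite ler_sqr ?nnegrE // (le_trans ct0 h).
rewrite nsqV in h3; rewrite -[leLHS]invrK -[leRHS]invrK lef_pV2 ?posrE ?invr_gt0 //.
  by rewrite -exprVn invf_div.
by rewrite exprn_gt0 // divr_gt0.
Qed.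

Lemma edge_inessential B u v : lV g u -> u \notin B -> v \in nb u -> v \notin u :: B ->
  0 < w (u :: B) v -> w B u = 0.
Proof.
move=> gu uB vn vT w0; apply: fk_atom0.
apply: (@ccvg0_le _ _ (fun k => (tk k / w (u :: B) v) ^+ 2)).
  apply: nearW => k; rewrite /fk nsqM nsq_it; apply: le_trans (gg_small gu uB vn vT w0 k).
  by rewrite ler_piMl ?nsq_ge0 // tk2_le1.
have h : tk k / w (u :: B) v @[k --> \oo] --> (0 : R).
  by rewrite -(mul0r (w (u :: B) v)^-1); apply: cvgM; [exact: tk_cvg0|exact: cvg_cst].
by under eq_fun do rewrite expr2; rewrite -(mulr0 0); apply: cvgM.
Qed.

(** Deleting such an [a] creates no essential vertex. If [v] were inessential, [b] would stay
    essential after deleting [a] and [v], so G(a) in the graph minus [v] would be O(t), while 1/G(a)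
    in the full graph is O(1/t). Exchanging the order of deletion, i t G(v) after deleting [a] is
    then a bounded multiple of i t G(v) before, which tends to 0. *)
Lemma essential_stable a b v : lV g a -> w [::] a = 0 -> b \in nb a -> 0 < w [::] b ->
  lV g v -> v != a -> 0 < w [:: a] v -> 0 < w [::] v.
Proof.
move=> ga wa ba wb gv va wav; rewrite lt_neqAle (atom_ge0 gG) andbT eq_sym.
apply/negP => /eqP wv.
have gb : lV g b by case/andP: (nb_V gG ba).
have bav : b \notin [:: a; v].
  by rewrite !inE negb_or; apply/andP; split; apply: contraTneq wb => ->; rewrite ?wa ?wv ltxx.
have hN : w [::] b <= w [:: a; v] b.
  apply: (@atom_del [:: a; v] b) => //.
  - by rewrite /= inE eq_sym va.
  - by rewrite /= ga gv.
  - by move=> x; rewrite !inE => /orP[]/eqP ->.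
have c0 := lt_le_trans wb hN; set c := w [:: a; v] b in hN c0.
have av : a \notin [:: v] by rewrite inE eq_sym.
suff e : w [:: a] v = 0 by rewrite e ltxx in wav.
apply: fk_atom0.
pose q k := gg g (zk k) [:: v] a / gg g (zk k) [::] a.
have hq k : nsq (q k) <= 2 / c ^+ 2 * (theta ^+ 2 + 1 + D%:R ^+ 2).
  rewrite /q nsqM.
  have h1 := gg_small ga av ba bav c0 k.
  have h2 := ggV_le gG (z0 k) ga (isT : a \notin [::]).
  apply: (@le_trans _ _ ((tk k / c) ^+ 2 * (2 * (nsq (zk k) + (D%:R / tk k) ^+ 2)))).
    by apply: ler_pM; rewrite ?nsq_ge0.
  have t0 := tk_gt0 R k; have t1 := tk_le1 R k.
  have -> : (tk k / c) ^+ 2 * (2 * (nsq (zk k) + (D%:R / tk k) ^+ 2)) =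
    2 / c ^+ 2 * (tk k ^+ 2 * nsq (zk k) + D%:R ^+ 2) by field; rewrite !gt_eqF.
  rewrite ler_wpM2l ?divr_ge0 ?sqr_ge0 // lerD2r /nsq /=.
  exact: scaled_sqr_le (sqr_ge0 _) (tk2_le1 R k).
apply: ccvg_near (ccvg0M hq (fk_cvg0 wv)); apply: nearW => k.
rewrite /fk /q -mulrA; congr (_ * _).
have := gg_comm gG (z0 k) [::] a v; have := gg_neq0 gG (z0 k) [::] a => n0 e.
by apply: (mulfI n0); rewrite e; field.
Qed.

(* The analogue of Gallai's lemma on factor-critical graphs. *)
Lemma gallai B u p : all (fun x => (x \notin B) && (0 < w B x)) (u :: p) ->
  lV g u -> path (adj g) u p -> last u p != u -> w (u :: B) (last u p) = 0.
Proof.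
have adj0 x y : adj g x y -> x \notin B -> 0 < w B x -> y \notin B -> w (x :: B) y = 0.
  move=> xy xB wx yB; apply/eqP; rewrite eq_le (atom_ge0 gG) andbT leNgt; apply/negP => wy.
  suff e : w B x = 0 by rewrite e ltxx in wx.
  apply: edge_inessential wy => //; first by case/and3P: xy.
    by rewrite (nbE gG).
  by rewrite inE negb_or yB andbT; apply: contraTneq xy => ->; rewrite (adj_irr gG).
elim: p u => [|x p IH] u /=; first by rewrite eqxx.
case/and3P => /andP[uB wu] /andP[xB wx] hp gu /andP[ux px] vu.
set v := last x p in vu *.
have gx : lV g x by case/and3P: ux.
have [vx|vx] := eqVneq v x; first by rewrite vx; apply: adj0.
have xv0 : w (x :: B) v = 0 by apply: IH => //; rewrite /= xB wx.
have xu0 : w (x :: B) u = 0 by apply: adj0 => //; rewrite (adj_sym gG).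
have [vB wv] : v \notin B /\ 0 < w B v.
  have : v \in x :: p by apply: mem_last.
  rewrite inE (negPf vx) /= => vp; move/allP: hp => /(_ v vp) /andP[]; done.
have gv : lV g v.
  rewrite /v; elim: (p) (x) gx px => //= y q IHq x' gx' /andP[xy].
  by apply: IHq; case/and3P: xy.
set W := w (u :: B) v * w B u.
suff W0 : W = 0 by move/eqP: W0; rewrite mulf_eq0 [w B u == 0]gt_eqF // orbF => /eqP.
have xu : x != u by apply: contraTneq ux => ->; rewrite (adj_irr gG).
have pair a b : a != b -> w (b :: B) a = 0 -> forall T, a \in T -> b \in T ->
    ccvg (fprod B T) 0.
  move=> ab wab T aT bT; apply: (@fprod_cvg0 _ [:: a; b]); rewrite /= ?inE ?ab //.
    by move=> y; rewrite !inE => /orP[]/eqP ->.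
  exact: ccvg0M (nsq_fprod B [:: b]) (fk_cvg0 wab).
pose T0 L k := zeta g nb (zk k) ((- (L * tk k)) +i* 0 : R[i]) 0 pred0 [:: u; v].
pose iL L : R[i] := 0 +i* L.
have zE L T k : T0 L k T = rr g (zk k) T + (iL L * it k) * (rr g (zk k) (v :: T) + rr g (zk k) (u :: T))
      + (iL L * it k) ^+ 2 * rr g (zk k) (v :: u :: T).
  have -> : iL L * it k = (- (L * tk k)) +i* 0 by congr (_ +i* _); ring.
  rewrite /T0 /= !mul0r !subr0; ring.
have lim1 L : ccvg (fun k => T0 L k B / rr g (zk k) B)
    (1 + iL L * ((w B v)%:C + (w B u)%:C) + (iL L) ^+ 2 * W%:C).
  have c1 := ccvgM (ccvg_cst (iL L)) (ccvgD (fk_cvg gG theta B v) (fk_cvg gG theta B u)).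
  have c2 := ccvgM (ccvg_cst (iL L ^+ 2))
     (ccvgM (fk_cvg gG theta (u :: B) v) (fk_cvg gG theta B u)).
  rewrite -rmorphM in c2; apply: ccvg_near (ccvgD (ccvgD (ccvg_cst 1) c1) c2).
  apply: nearW => k; rewrite zE /fk /gg.
  by have := rr_neq0 gG (z0 k) (u :: B); have := rr_neq0 gG (z0 k) B => h1 h2; field; rewrite h1 h2.
have ux' : u != x by rewrite eq_sym.
have [m1 m2 m3] : [/\ x \in [:: v; x], x \in [:: u; x] & x \in [:: v; u; x]].
  by rewrite !inE eqxx !orbT.
have lim2 L : ccvg (fun k => it k * T0 L k (x :: B) / rr g (zk k) B) (w B x)%:C.
  have c1 := ccvgM (ccvg_cst (iL L)) (ccvgD
     (pair v x vx xv0 [:: v; x] (mem_head _ _) m1)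
     (pair u x ux' xu0 [:: u; x] (mem_head _ _) m2)).
  have c2 := ccvgM (ccvg_cst (iL L ^+ 2))
     (pair v x vx xv0 [:: v; u; x] (mem_head _ _) m3).
  have := ccvgD (ccvgD (fk_cvg gG theta B x) c1) c2.
  rewrite addr0 !mulr0 !addr0; apply: ccvg_near; apply: nearW => k.
  rewrite !fprodE zE /fk /gg /=; ring.
(* With [x] deleted only the constant term survives, because [x] forms a vanishing pair with both
   [u] and [v]. The sign of the Green function at [x] then bounds 1 - L^2 W from below for every
   real [L], which leaves no room for W > 0. *)
have key L : 0 <= w B x * (1 - L ^+ 2 * W).
  have [hR _] := ccvgM (lim2 L) (ccvgJ (lim1 L)).
  have -> : w B x * (1 - L ^+ 2 * W) = complex.Re ((w B x)%:C *
     conjc (1 + iL L * ((w B v)%:C + (w B u)%:C) + (iL L) ^+ 2 * W%:C)).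
    by rewrite /iL /=; ring.
  apply: (cvgr_to_ge hR); apply: nearW => k.
  have ad : padm g pred0 [:: u; v] (x :: B).
    apply/and4P; split; rewrite /= ?inE ?gu ?gv //; first by rewrite eq_sym vu.
    rewrite !negb_or (negPf xu) [x == v]eq_sym vx /=.
    by apply/hasPn => y yB; rewrite /= !inE negb_or; apply/andP; split;
       apply: contraTneq yB => ->.
  have zs : 0 < complex.Im (zk k + ((- (L * tk k)) +i* 0)).
    by rewrite ImD /= addr0 tk_gt0.
  have r1 : -1 <= 0 :> R by lra.
  have := zeta_Im gG (z0 k) zs r1 ad gx xB; rewrite -!/(T0 L k _) => h.
  rewrite mulcJ_div -mulrA Re_realM mulr_ge0 ?invr_ge0 ?nsq_ge0 //.
  by rewrite Re_imul oppr_ge0 mulr_ge0_le0 // ltW // tk_gt0.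
have W0 : 0 <= W by rewrite mulr_ge0 ?(ltW wu) // (atom_ge0 gG).
have [//|Wp] := eqVneq W 0; have {}W0 : 0 < W by rewrite lt_neqAle eq_sym Wp.
(* For W > 0 this choice gives L^2 W = W + 2 + 1/W > 1. *)
have := key (1 + W^-1); rewrite pmulr_rge0 // subr_ge0 => h.
have e : (1 + W^-1) ^+ 2 * W = W + 2 + W^-1 by field.
have p0 : 0 < W^-1 by rewrite invr_gt0.
by move: h W0 p0; rewrite e; move: W^-1 (W) => a b h1 h2 h3; exfalso; lra.
Qed.

End Essential.

Lemma Re_J_imul (R : realType) (t : R) (a b : R[i]) :
  complex.Re (a * conjc ((0 +i* t) * b)) = t * complex.Im (a * conjc b).
Proof. by case: a b => p q [p' q'] /=; ring. Qed.

(** * Loads of essential components *)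

Section MassBound.
Variables (R : realType) (g : lgraph) (D : nat) (nb : nat -> seq nat).
Hypothesis gG : good_graph D g nb.
Variable theta : R.

Local Notation tk := (@tk R).
Local Notation it k := ((0 +i* tk k) : R[i]).
Local Notation zk k := (zt theta (tk k)).
Local Notation w := (atom g theta).
Local Notation fprod := (fprod g theta).

Let z0 k : 0 < complex.Im (zk k). Proof. exact: tk_gt0. Qed.

Definition ess (u : nat) : bool := lV g u && (0 < w [::] u).
Definition special (a : nat) : bool := [&& lV g a, ~~ ess a & has ess (nb a)].
Definition share (a v : nat) : R := w [:: a] v / \sum_(x <- nb a) w [:: a] x.
Definition load (u : nat) : R := w [::] u + \sum_(a <- nb u | special a) share a u.

Lemma special_atom0 a : special a -> w [::] a = 0.
Proof.
case/and3P => ga; rewrite /ess ga /= -leNgt => h _.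
by apply/eqP; rewrite eq_le h (atom_ge0 gG).
Qed.

Lemma special_nb a : special a -> exists2 b, b \in nb a & ess b.
Proof. by case/and3P => _ _ /hasP[b bn eb]; exists b. Qed.

Lemma special_del Q a b : special a -> uniq (a :: Q) -> all special Q -> ess b ->
  0 < w (a :: Q) b.
Proof.
move=> sa uQ sQ /andP[gb wb]; apply: (lt_le_trans wb).
have sp : {in a :: Q, forall x, special x}.
  by move=> x; rewrite inE => /predU1P[-> //|]; apply/allP.
apply: (atom_del gG) => //.
- by apply/allP => x /sp /and3P[].
- by move=> x /sp /special_atom0.
- by apply/negP => /sp /and3P[_]; rewrite /ess gb wb.
Qed.

Lemma nb_neq u v : v \in nb u -> v != u.
Proof. by rewrite (nbE gG); apply: contraTneq => ->; rewrite (adj_irr gG). Qed.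

Lemma share_den a : special a -> 0 < \sum_(x <- nb a) w [:: a] x.
Proof.
move=> sa; have [b bn eb] := special_nb sa.
rewrite (bigD1_seq b) ?(nb_uniq gG) //= ltr_pwDl ?sumr_ge0 //.
  exact: (special_del (Q := [::])).
by move=> x _; apply: (atom_ge0 gG).
Qed.

Lemma share_ge0 a v : 0 <= share a v.
Proof. by rewrite divr_ge0 ?(atom_ge0 gG) // sumr_ge0 // => x _; apply: (atom_ge0 gG). Qed.

Lemma share_sum a : special a -> \sum_(v <- nb a) share a v = 1.
Proof. by move=> sa; rewrite -mulr_suml mulfV // gt_eqF // share_den. Qed.

Lemma share_ess a v : special a -> v \in nb a -> ~~ ess v -> share a v = 0.
Proof.
move=> sa vn; apply: contraNeq => s0; have [b bn /andP[gb wb]] := special_nb sa.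
have [ga gv] : lV g a /\ lV g v by have /andP := nb_V gG vn.
rewrite /ess gv /=; apply: (essential_stable gG ga (special_atom0 sa) bn wb gv).
  exact: nb_neq.
rewrite lt_neqAle (atom_ge0 gG) andbT eq_sym; apply: contraNneq s0 => e.
by rewrite /share e mul0r.
Qed.

(** For special [a], i t / G(a) tends to minus the sum of the atoms of its neighbours in the graph
    minus [a]; dividing i t G(v) by it yields the share. In this form shares appear as coefficients
    of the perturbed polynomial. *)
Lemma share_cvg a v : special a -> v \in nb a ->
  ccvg (fun k => - rr g (zk k) [:: v; a]) (share a v)%:C.
Proof.
move=> sa vn; have ga : lV g a by case/and3P: sa.
set s := \sum_(x <- nb a) w [:: a] x; have s0 : s != 0 by rewrite gt_eqF // share_den.
have h : ccvg (fun k => it k * (gg g (zk k) [::] a)^-1) (- s%:C).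
  have c1 := ccvgM (ccvg_real (@tk_cvg0 R)) (ccvg_cst (0 +i* 1 : R[i])).
  have c0 : ccvg (fun k => zk k) theta%:C by split; [exact: cvg_cst|exact: tk_cvg0].
  have c2 := ccvgB (ccvgM c1 c0) (@ccvg_sum R _ (nb a) predT _ _
     (fun x _ => fk_cvg gG theta [:: a] x)).
  rewrite !mul0r sub0r -rmorph_sum in c2; apply: ccvg_near c2; apply: nearW => k.
  rewrite (gg_inv gG (z0 k)) // mulrBr; congr (_ - _).
    by congr (_ * _); congr (_ +i* _); ring.
  rewrite mulr_sumr [LHS]big_seq [RHS]big_seq_cond; apply: eq_bigl => x.
  by rewrite inE; case xn: (x \in nb a); rewrite //= nb_neq.
have s0' : - s%:C != 0 :> R[i] by rewrite -nsq_gt0 nsqN nsqR exprn_gt0 // share_den.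
have := ccvgN (ccvgM (fk_cvg gG theta [:: a] v) (ccvgV s0' h)).
have -> : - ((w [:: a] v)%:C * (- s%:C)^-1) = (share a v)%:C.
  by rewrite /share invrN mulrN opprK rmorphM fmorphV.
apply: ccvg_near; apply: nearW => k.
rewrite (rr_cons gG (z0 k)) (rr_cons gG (z0 k)) (rr_nil gG (z0 k)) mulr1 /fk.
have := gg_neq0 gG (z0 k) [::] a; have := @it_neq0 R k => h1 h2.
by congr (- _); field; rewrite h1 h2.
Qed.

(** A special vertex keeps an essential neighbour after other special vertices are deleted, so each
    deletion contributes a Green function of order t. *)
Lemma special_bounded Q : uniq Q -> all special Q ->
  exists B, forall k, nsq (rr g (zk k) Q / it k ^+ size Q) <= B.
Proof.
elim: Q => [|a Q IH] uQ /=.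
  by exists 1 => k; rewrite (rr_nil gG (z0 k)) divr1 nsqR expr1n.
move=> /andP[sa sQ]; have [|B hB] := IH _ sQ; first by case/andP: uQ.
have [b bn eb] := special_nb sa; have c0 := special_del sa uQ sQ eb.
have ga : lV g a by case/and3P: sa.
have aQ : a \notin Q by case/andP: uQ.
have bQ : b \notin a :: Q.
  rewrite inE negb_or nb_neq //=; apply: contraL eb => bQ.
  by move/allP: sQ => /(_ b bQ) /and3P[].
exists ((w (a :: Q) b)^-1 ^+ 2 * B) => k.
have -> : rr g (zk k) (a :: Q) / it k ^+ (size Q).+1 =
    (gg g (zk k) Q a / it k) * (rr g (zk k) Q / it k ^+ size Q).
  by rewrite (rr_cons gG (z0 k)) exprS; have := @it_neq0 R k => h; field; rewrite h expf_neq0.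
rewrite nsqM; apply: ler_pM; rewrite ?nsq_ge0 // nsqM nsqV nsq_it.
have t2 : 0 < tk k ^+ 2 by rewrite exprn_gt0 // tk_gt0.
rewrite ler_pdivrMr //; apply: le_trans (gg_small gG ga aQ bn bQ c0 k) _.
by rewrite exprMn mulrC.
Qed.

(** [F] is any finite set of vertices in one essential component, not necessarily all of it; the
    linking paths may leave [F]. Infinite components are thereby treated through finite pieces. *)
Variable F : seq nat.
Hypotheses (uF : uniq F) (essF : all ess F).
Hypothesis linkF : forall u v, u \in F -> v \in F ->
  exists p, [/\ path (adj g) u p, all ess p & last u p = v].

Lemma pair_vanish Q u v : uniq Q -> all special Q -> u \in F -> v \in F -> u != v ->
  ccvg (fprod Q [:: v; u]) 0.
Proof.
move=> uQ sQ uinF vinF uv.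
have eF x : x \in F -> ess x by move/allP: essF; apply.
have eQ x : ess x -> (x \notin Q) && (0 < w Q x).
  move=> ex; have xQ : x \notin Q.
    by apply: contraL ex => xQ; move/allP: sQ => /(_ x xQ) /and3P[].
  rewrite xQ /=; case/andP: ex => gx wx; apply: lt_le_trans wx _.
  apply: (atom_del gG) => //; first by apply/allP => y yQ; move/allP: sQ => /(_ y yQ) /and3P[].
  by move=> y yQ; move/allP: sQ => /(_ y yQ) /special_atom0.
have [p [hp ep lp]] := linkF uinF vinF.
have h : w (u :: Q) v = 0.
  rewrite -lp; apply: (gallai gG) => //.
  - by rewrite /= eQ ?eF //=; apply/allP => x xp; apply: eQ; move/allP: ep; apply.
  - by case/andP: (eF u uinF).
  - by rewrite lp eq_sym.
exact: ccvg0M (nsq_fprod gG theta Q [:: u]) (fk_cvg0 gG h).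
Qed.

Section Scaled.
Variable sigma : R.
Hypothesis sg1 : -1 < sigma.

Let Z k := zeta g nb (zk k) (st sigma (tk k)) sigma special.
(** Deleting a vertex of [F] has size 1/t and deleting a special vertex has size t. The powers of i
    t normalise both, [U] collecting the former and [Q] the latter, so that all terms have finite
    limits. *)
Let sz S Q U k := it k ^+ size U / it k ^+ size Q * Z k S (Q ++ U).

Lemma Z_eq S T T' k : T =i T' -> Z k S T = Z k S T'.
Proof.
rewrite /Z; elim: S T T' => [|v S IH] T T' e /=; first exact: (rr_eq gG (z0 k)).
rewrite (IH T T') // (IH (v :: T) (v :: T')); last by move=> x; rewrite !inE e.
congr (_ + _ - _ * _); apply: eq_big => x; first by rewrite !inE e.
by move=> _; apply: IH => y; rewrite !inE e.
Qed.

Lemma sz_cons v S Q U k : sz (v :: S) Q U k = sz S Q U k + sigma%:C * (sz S Q (v :: U) k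
   - \sum_(x <- nb v | (x \notin v :: Q ++ U) && special x) sz S (x :: Q) (v :: U) k).
Proof.
have ei : st sigma (tk k) = sigma%:C * it k by congr (_ +i* _); ring.
have i0 := @it_neq0 R k.
have -> : sz S Q (v :: U) k = it k ^+ (size U).+1 / it k ^+ size Q * Z k S (v :: Q ++ U).
  by congr (_ * _); apply: Z_eq => x; rewrite !(inE, mem_cat) orbCA.
pose X := \sum_(x <- nb v | (x \notin v :: Q ++ U) && special x) Z k S (x :: v :: Q ++ U).
have -> : \sum_(x <- nb v | (x \notin v :: Q ++ U) && special x) sz S (x :: Q) (v :: U) k
    = it k ^+ (size U).+1 / it k ^+ (size Q).+1 * X.
  rewrite mulr_sumr; apply: eq_bigr => x _; congr (_ * _); apply: Z_eq => y.
  by rewrite !(inE, mem_cat); case: (y == x); case: (y == v); rewrite ?orbT.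
have -> : sz (v :: S) Q U k = it k ^+ size U / it k ^+ size Q *
   (Z k S (Q ++ U) + st sigma (tk k) * Z k S (v :: Q ++ U) - sigma%:C * X) by [].
rewrite ei /sz; move: (Z k S (Q ++ U)) (Z k S (v :: Q ++ U)) X => A B X.
rewrite !exprS; move: (it k ^+ size U) (expf_neq0 (size Q) i0) => p; move: (it k ^+ size Q) => q q0.
by move: (it k) i0 => i i0; field; rewrite i0 q0.
Qed.

(** Two deleted vertices of one essential component make the unperturbed term vanish, by Gallai's
    lemma in the graph minus [Q]; the deletions of special vertices stay bounded after
    normalisation. Expanding the perturbation never makes [U] smaller. *)
Lemma sz_vanish S Q U : uniq S -> {subset S <= F} -> uniq Q -> all special Q ->
  uniq U -> {subset U <= F} -> (1 < size U)%N -> ~~ has (mem S) U ->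
  ccvg (sz S Q U) 0.
Proof.
elim: S Q U => [|v S IH] Q U uS sS uQ sQ uU sU U1 SU.
  case: U uU sU U1 {SU} => [|u [|v U]] //= /andP[uvU uU] sU _.
  have uv : u != v by move: uvU; rewrite inE negb_or => /andP[].
  have h : ccvg (fprod Q (u :: v :: U)) 0.
    apply: (@fprod_cvg0 _ _ _ _ gG _ _ [:: v; u]); rewrite /= ?inE 1?eq_sym ?uv //.
      by move=> x; rewrite !inE => /orP[]/eqP ->; rewrite eqxx ?orbT.
    by apply: pair_vanish => //; apply: sU; rewrite !inE eqxx ?orbT.
  have [B hB] := special_bounded uQ sQ.
  apply: ccvg_near (ccvg0M hB h); apply: nearW => k.
  rewrite (fprodE gG) /sz /Z /= (rr_eq gG (z0 k) (T := (u :: v :: U) ++ Q) (T' := Q ++ u :: v :: U)); last first.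
    by move=> x; rewrite !mem_cat orbC.
  have := rr_neq0 gG (z0 k) Q; have := @it_neq0 R k => i0 r0.
  by field; rewrite r0 expf_neq0.
have [vS uS'] : v \notin S /\ uniq S by case/andP: uS.
have sS' : {subset S <= F} by move=> x xS; apply: sS; rewrite inE xS orbT.
have vF : v \in F by apply: sS; rewrite mem_head.
have vU : v \notin U.
  by apply: contra SU => vU; apply/hasP; exists v => //=; rewrite inE eqxx.
have SU' : ~~ has (mem S) U.
  by apply: contra SU => /hasP[x xU xS]; apply/hasP; exists x => //=; rewrite inE [x \in S]xS orbT.
have uvU : uniq (v :: U) by rewrite /= vU.
have svU : {subset v :: U <= F} by move=> x; rewrite inE => /predU1P[->|/sU].
have SvU : ~~ has (mem S) (v :: U) by rewrite /= negb_or vS.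
have h1 := IH Q U uS' sS' uQ sQ uU sU U1 SU'.
have h2 := IH Q (v :: U) uS' sS' uQ sQ uvU svU (leqW U1) SvU.
have h3 := @ccvg_sum R _ (nb v) (fun x => (x \notin v :: Q ++ U) && special x)
  (fun x => sz S (x :: Q) (v :: U)) (fun=> 0).
rewrite big1 // in h3.
have := ccvgD h1 (ccvgM (ccvg_cst sigma%:C) (ccvgB h2 (h3 _))).
rewrite subr0 mulr0 addr0 => h; apply: ccvg_near (h _); first by apply: nearW => k; rewrite -sz_cons.
move=> x /andP[xT sx]; apply: IH => //.
- by rewrite /= uQ andbT; apply: contra xT => xQ; rewrite inE mem_cat xQ orbT.
- by rewrite /= sx.
- exact: leqW U1.
Qed.

Lemma sz_self S u : uniq S -> {subset S <= F} -> u \in F -> u \notin S ->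
  ccvg (sz S [::] [:: u]) (w [::] u)%:C.
Proof.
elim: S => [|v S IH] uS sS uin uS0.
  apply: ccvg_near (fk_cvg gG theta [::] u); apply: nearW => k.
  rewrite /sz /Z /fk /gg (rr_nil gG (z0 k)) /= expr0 expr1; by field.
have [vS uS'] : v \notin S /\ uniq S by case/andP: uS.
have sS' : {subset S <= F} by move=> x xS; apply: sS; rewrite inE xS orbT.
have vF : v \in F by apply: sS; rewrite mem_head.
have [uv uS1] : u != v /\ u \notin S by apply/andP; move: uS0; rewrite inE negb_or.
have uU : uniq [:: v; u] by rewrite /= inE eq_sym uv.
have sU : {subset [:: v; u] <= F} by move=> x; rewrite !inE => /orP[]/eqP ->.
have SU : ~~ has (mem S) [:: v; u] by rewrite /= !negb_or vS uS1.
have h3 := @ccvg_sum R _ (nb v) (fun x => (x \notin v :: [::] ++ [:: u]) && special x)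
  (fun x => sz S [:: x] [:: v; u]) (fun=> 0).
rewrite big1 // in h3.
have h2 := sz_vanish uS' sS' (isT : uniq [::]) (isT : all special [::]) uU sU isT SU.
have := ccvgD (IH uS' sS' uin uS1) (ccvgM (ccvg_cst sigma%:C) (ccvgB h2 (h3 _))).
rewrite subr0 mulr0 addr0 => h; apply: ccvg_near (h _); first by apply: nearW => k; rewrite -sz_cons.
by move=> x /andP[xT sx]; apply: sz_vanish => //=; rewrite sx.
Qed.

Lemma sz_edge S a u : uniq S -> {subset S <= F} -> u \in F -> u \notin S ->
  special a -> a \in nb u -> ccvg (sz S [:: a] [:: u]) (- (share a u)%:C).
Proof.
move=> + + uin + sa an; elim: S => [|v S IH] uS sS uS0.
  have un : u \in nb a by rewrite (nbE gG) (adj_sym gG) -(nbE gG).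
  apply: ccvg_near (ccvgN (share_cvg sa un)); apply: nearW => k.
  rewrite opprK /sz /Z /= !expr1 divff ?mul1r ?it_neq0 //; apply: (rr_eq gG (z0 k)) => x.
  by rewrite !inE orbC.
have [vS uS'] : v \notin S /\ uniq S by case/andP: uS.
have sS' : {subset S <= F} by move=> x xS; apply: sS; rewrite inE xS orbT.
have vF : v \in F by apply: sS; rewrite mem_head.
have [uv uS1] : u != v /\ u \notin S by apply/andP; move: uS0; rewrite inE negb_or.
have uU : uniq [:: v; u] by rewrite /= inE eq_sym uv.
have sU : {subset [:: v; u] <= F} by move=> x; rewrite !inE => /orP[]/eqP ->.
have SU : ~~ has (mem S) [:: v; u] by rewrite /= !negb_or vS uS1.
have h3 := @ccvg_sum R _ (nb v) (fun x => (x \notin v :: [:: a] ++ [:: u]) && special x)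
  (fun x => sz S [:: x; a] [:: v; u]) (fun=> 0).
rewrite big1 // in h3.
have sa' : all special [:: a] by rewrite /= sa.
have h2 := sz_vanish uS' sS' (isT : uniq [:: a]) sa' uU sU isT SU.
have := ccvgD (IH uS' sS' uS1) (ccvgM (ccvg_cst sigma%:C) (ccvgB h2 (h3 _))).
rewrite subr0 mulr0 addr0 => h; apply: ccvg_near (h _); first by apply: nearW => k; rewrite -sz_cons.
move=> x /andP[xT sx]; apply: sz_vanish => //=; last by rewrite sx sa.
by rewrite inE andbT; apply: contra xT => /eqP ->; rewrite !inE eqxx orbT.
Qed.

(** Perturbing [v] adds sigma times its atom plus the shares it receives. Terms using the
    perturbation at two vertices delete two elements of [F] and vanish, so the limit is affine in
    sigma. *)
Lemma sz_empty S : uniq S -> {subset S <= F} ->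
  ccvg (sz S [::] [::]) (1 + sigma * \sum_(u <- S) load u)%:C.
Proof.
elim: S => [|v S IH] uS sS.
  rewrite big_nil mulr0 addr0; apply: ccvg_near (ccvg_cst 1); apply: nearW => k.
  by rewrite /sz /Z /= (rr_nil gG (z0 k)) divr1 mulr1.
have [vS uS'] : v \notin S /\ uniq S by case/andP: uS.
have sS' : {subset S <= F} by move=> x xS; apply: sS; rewrite inE xS orbT.
have vF : v \in F by apply: sS; rewrite mem_head.
have h3 := @ccvg_sum R _ (nb v) (fun x => [&& x \in nb v, (x \notin v :: [::] ++ [::]) & special x])
  (fun x => sz S [:: x] [:: v]) (fun x => - (share x v)%:C).
have := ccvgD (IH uS' sS') (ccvgM (ccvg_cst sigma%:C) (ccvgB (sz_self uS' sS' vF vS) (h3 _))).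
have -> : (1 + sigma * \sum_(u <- S) load u)%:C + sigma%:C * ((w [::] v)%:C -
    \sum_(x <- nb v | [&& x \in nb v, (x \notin v :: [::] ++ [::]) & special x]) - (share x v)%:C)
   = (1 + sigma * \sum_(u <- v :: S) load u)%:C.
  rewrite sumrN opprK -rmorph_sum -rmorphD -rmorphM -rmorphD; congr (_%:C).
  rewrite big_cons {2}/load.
  have -> : \sum_(x <- nb v | [&& x \in nb v, (x \notin v :: [::] ++ [::]) & special x]) share x v
     = \sum_(x <- nb v | special x) share x v.
    rewrite [RHS]big_seq_cond; apply: eq_bigl => x; case xn: (x \in nb v) => //=.
    by rewrite inE nb_neq.
  ring.
move=> h; apply: ccvg_near (h _); last by move=> x /and3P[xn _ sx]; apply: sz_edge.
apply: nearW => k; rewrite sz_cons; congr (_ + _ * (_ - _)).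
by rewrite [RHS]big_seq_cond.
Qed.

(** The limit of [zeta_part] at [u], the set [A] being the special vertices, divided by the positive
    atom of [u]. *)
Lemma load_le_aux S u : uniq S -> {subset S <= F} -> u \in F -> u \notin S -> sigma <= 0 ->
  load u <= 1 + sigma * \sum_(v <- S) load v.
Proof.
move=> uS sS uin uS0 sg0; have /andP[gu wu] : ess u by move/allP: essF; apply.
have h3 : ccvg (fun k => \sum_(x <- nb u | (x \in nb u) && special x) sz S [:: x] [:: u] k)
    (\sum_(x <- nb u | (x \in nb u) && special x) - (share x u)%:C).
  by apply: ccvg_sum => x /andP[xn sx]; apply: sz_edge.
have c1 := ccvgB (ccvgD (sz_empty uS sS) h3) (sz_self uS sS uin uS0).
have := ccvgM c1 (ccvgJ (sz_self uS sS uin uS0)).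
set L := (X in ccvg _ X -> _); set f := (X in ccvg X _ -> _) => -[hR _].
have eL : complex.Re L = (1 + sigma * \sum_(v <- S) load v - load u) * w [::] u.
  rewrite /L conjc_real sumrN -rmorph_sum -!rmorphB -rmorphM /=; congr (_ * _).
  rewrite /load -big_seq_cond; ring.
suff : 0 <= complex.Re L by rewrite eL pmulr_lge0 // subr_ge0.
apply: (cvgr_to_ge hR); apply: nearW => k.
have sAll : {subset S <= lV g} by move=> x /sS xF; move/allP: essF => /(_ x xF) /andP[].
have ad : padm g special S [:: u].
  apply/and4P; split=> //; first by apply/allP.
    apply/allP => x /sS xF; apply/negP => /and3P[_ /negP[]]; by move/allP: essF; apply.
  by rewrite /= orbF.
have nsu : ~~ special u by apply/negP => /and3P[_ /negP[]]; rewrite /ess gu.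
have zs : 0 < complex.Im (zk k + st sigma (tk k)).
  rewrite ImD /= -{1}[tk k]mul1r -mulrDl mulr_gt0 ?tk_gt0 //; move: sg1; lra.
have := zeta_part gG (z0 k) zs (ltW sg1) ad gu nsu; rewrite /= -!/(Z k _ _).
set X := (X in conjc X); set Y := (Y in Y * conjc _) => h.
have -> : f k = Y * conjc (it k * X).
  rewrite /f /sz /= !expr1 expr0 !divr1 !mul1r; congr (_ * _); rewrite /Y; congr (_ + _ - _).
  by rewrite -big_seq_cond; apply: eq_bigr => x _; rewrite divff ?mul1r ?it_neq0.
by rewrite Re_J_imul mulr_ge0 // ltW // tk_gt0.
Qed.

End Scaled.

Lemma load_ge0 u : 0 <= load u.
Proof. by rewrite addr_ge0 ?(atom_ge0 gG) // sumr_ge0 // => a _; apply: share_ge0. Qed.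

(* Perturbing by the factor [1 + sigma] and letting sigma tend to -1. *)
Lemma sum_load_le1 : \sum_(u <- F) load u <= 1.
Proof.
have ld u S : uniq S -> {subset S <= F} -> u \in F -> u \notin S ->
    load u <= 1 - \sum_(v <- S) load v.
  move=> uS sS uin uS0; set M := \sum_(v <- S) load v.
  have M0 : 0 <= M by rewrite sumr_ge0 // => v _; apply: load_ge0.
  apply/ler_addgt0Pr => e e0; pose d := Num.min 1 (e / (M + 1)).
  have M1 : 0 < M + 1 by rewrite ltr_wpDl.
  have d0 : 0 < d by rewrite lt_min ltr01 divr_gt0.
  have d1 : d <= 1 by rewrite ge_min lexx.
  have dM : d * M <= e.
    have : d <= e / (M + 1) by rewrite ge_min lexx orbT.
    rewrite ler_pdivlMr // => h; apply: le_trans h.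
    by rewrite ler_wpM2l ?(ltW d0) // lerDl.
  have s1 : -1 < d - 1 by rewrite ltrBrDr addNr.
  have s0 : d - 1 <= 0 by rewrite subr_le0.
  apply: le_trans (load_le_aux s1 uS sS uin uS0 s0) _.
  by rewrite mulrBl mul1r addrA -addrA [d * M - M]addrC addrA lerD2l.
have gen S : uniq S -> {subset S <= F} -> \sum_(u <- S) load u <= 1.
  case: S => [|u S]; first by rewrite big_nil.
  move=> /= /andP[uS US] sS; rewrite big_cons -lerBrDr; apply: ld => //.
    by move=> x xS; apply: sS; rewrite inE xS orbT.
  by apply: sS; rewrite mem_head.
exact: gen.
Qed.

End MassBound.

(** * Finite essential components and roots of their matching polynomials *)

Lemma ccvg_mu (R : realType) (x : nat -> nat -> R[i]) (l : nat -> R[i]) c s :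
  (forall v, ccvg (fun k => x k v) (l v)) -> ccvg (fun k => mu (x k) c s) (mu l c s).
Proof.
move=> h; elim: {s}(size s) {-2}s (leqnn (size s)) => [|n IH] s.
  by rewrite leqn0 => /nilP ->; apply: ccvg_cst.
case: s => [|u s] ls; first exact: ccvg_cst.
rewrite mu_cons; under eq_fun do rewrite mu_cons.
apply: ccvgB; first by apply: ccvgM => //; apply: IH.
rewrite big_seq; under eq_fun do rewrite big_seq.
apply: ccvg_sum => v vs; apply: ccvgM; first exact: ccvg_cst.
by apply: IH; rewrite size_rem // (leq_trans (leq_pred _)).
Qed.

Section FiniteComponent.
Variables (R : realType) (g : lgraph) (D : nat) (nb : nat -> seq nat).
Hypothesis gG : good_graph D g nb.
Variable theta : R.

Let z0 k : 0 < complex.Im (zt theta (tk R k)). Proof. exact: tk_gt0. Qed.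

(** [S] contains every neighbour of [K] outside [K], so once [S] is deleted the recursion never
    leaves [K]. *)
Lemma green_component z (F K S T : seq nat) u : 0 < complex.Im z ->
  uniq F -> uniq K -> {subset K <= F} -> {subset T <= K} ->
  (forall x y, x \in K -> y \in nb x -> (y \in K) || (y \in S)) ->
  ~~ has (mem S) K -> u \in K -> u \notin T ->
  green (fun=> z) (ew R g) F (T ++ S) u = green (fun=> z) (ew R g) K T u.
Proof.
move=> zp uF uK KF TK cl SK.
have KS x : x \in K -> x \notin S by move/hasPn: SK; apply.
elim/(@del_ind K): T u TK => T IH u TK uinK uT.
have uTS : u \notin T ++ S by rewrite mem_cat negb_or uT KS.
have xp (v : nat) : 0 < complex.Im ((fun=> z) v) by [].
apply: invr_inj.
rewrite (green_inv (ew_sym _ gG) (@ew_ge0 _ _) xp uF (KF _ uinK) uTS).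
rewrite (green_inv (ew_sym _ gG) (@ew_ge0 _ _) xp uK uinK uT); congr (_ - _).
rewrite (bigID (mem K)) /= [X in _ + X]big1 ?addr0; last first.
  move=> v /andP[vT vK]; rewrite (ew_nb _ gG) ?mul0r //.
  apply: contra vK => /(cl _ _ uinK) /orP[//|vS].
  by move: vT; rewrite inE mem_cat vS !orbT.
under eq_bigl do rewrite andbC.
have pK : perm_eq [seq v <- F | v \in K] K.
  apply: uniq_perm; rewrite ?filter_uniq // => v; rewrite mem_filter.
  by case vK: (v \in K) => //=; rewrite KF.
rewrite -big_filter_cond (perm_big _ pK) [LHS]big_seq_cond [RHS]big_seq_cond.
apply: eq_big => v.
  by case vK: (v \in K) => //=; rewrite !inE mem_cat (negPf (KS _ vK)) orbF.
move=> /andP[vK]; rewrite !inE mem_cat !negb_or => /and3P[vu vT _]; congr (_ * _).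
apply: (IH u uinK uT v) => //; last by rewrite inE negb_or vu.
by move=> x; rewrite inE => /predU1P[->|/TK].
Qed.

(** The outer boundary [S] of [K] is inessential, so deleting it preserves the atom at [u]. The
    Green function that remains is a rational function given by [K] alone, and i t G would tend to 0
    if its denominator did not vanish at [theta]. *)
Lemma finite_component_root (K : seq nat) : uniq K -> K != [::] ->
  all (ess g theta) K ->
  (forall x y, x \in K -> y \in nb x -> ess g theta y -> y \in K) ->
  mu (fun=> theta%:C) (fun u v => (ew R g u v)%:C) K = 0.
Proof.
move=> uK K0 eK cl; have [u uinK] : exists u, u \in K.
  by case: K K0 {uK eK cl} => // u K _; exists u; rewrite mem_head.
pose S := undup [seq y <- [seq y | x <- K, y <- nb x] | y \notin K].
have VK : {subset K <= lV g} by move=> x xK; move/allP: eK => /(_ x xK) /andP[].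
have memS y : y \in S -> [/\ lV g y, y \notin K & exists2 x, x \in K & y \in nb x].
  rewrite mem_undup mem_filter => /andP[yK /allpairsPdep[x [y' [xK yx e]]]].
  by rewrite e in yK *; split=> //; [case/andP: (nb_V gG yx)|exists x].
have uS : u \notin S by apply/negP => /memS[_ /negP].
have S0 : {in S, forall a, atom g theta [::] a = 0}.
  move=> y yS; have [gy yK [x xK yx]] := memS y yS.
  apply/eqP; rewrite eq_le (atom_ge0 gG) andbT leNgt; apply: contra yK => wy.
  by apply: cl xK yx _; rewrite /ess gy.
have VS : all (lV g) S by apply/allP => y /memS[].
have /andP[gu wu] : ess g theta u by move/allP: eK; apply.
have wS := lt_le_trans wu (atom_del gG (undup_uniq _) VS S0 gu uS).
pose c := fun a b => (ew R g a b)%:C : R[i].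
pose M z T := muC (fun=> z) (ew R g) K T.
have gM k : gg g (zt theta (tk R k)) S u = M (zt theta (tk R k)) [:: u] / M (zt theta (tk R k)) [::].
  have h := gg_lim gG (z0 k) gu uS (rr_neq0 gG (z0 k) S).
  apply: (ccvg_unique h); apply: ccvg_near (ccvg_cst _).
  have hs := exhausts_sub (window_exhausts g) VK.
  near=> n; symmetry; apply: (green_component (T := [::])) => //.
  - by case: (window_exhausts g).
  - by near: n.
  - move=> x y xK yx; case yK: (y \in K) => //=.
    by rewrite mem_undup mem_filter yK /=; apply/allpairsPdep; exists x, y.
  - by apply/hasPn => x xK /=; apply/negP => /memS[_ /negP].
apply/eqP/negPn/negP => nz.
have cz : ccvg (fun k => zt theta (tk R k)) theta%:C by split; [exact: cvg_cst|exact: tk_cvg0].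
have c1 T : ccvg (fun k => M (zt theta (tk R k)) T) (M theta%:C T).
  exact: (ccvg_mu _ _ (fun _ => cz)).
have nz' : M theta%:C [::] != 0 by rewrite /M /muC /muD filter_predT.
have ci : ccvg (fun k => (0 +i* tk R k : R[i])) 0 by split; [exact: cvg_cst|exact: tk_cvg0].
have := ccvgM ci (ccvgM (c1 [:: u]) (ccvgV nz' (c1 [::]))); rewrite mul0r => h.
have e0 : atom g theta S u = 0.
  apply: (fk_atom0 gG); apply: ccvg_near h; apply: nearW => k.
  by rewrite /fk gM.
by rewrite e0 ltxx in wS.
Unshelve. all: by end_near. Qed.

End FiniteComponent.

(* Up to relabelling there are finitely many graphs with fewer than [N] vertices. *)
Lemma finite_roots (R : realType) (N : nat) :
  finite_set [set theta : R | exists (K : seq nat) (e : rel nat),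
    [/\ uniq K, (size K < N)%N, forall u v, e u v = e v u
      & mu (fun=> theta%:C) (fun u v => (e u v)%:R : R[i]) K = 0]].
Proof.
(* One polynomial for each size below [N] and each adjacency table on ['I_N]; indices outside ['I_N]
   count as non-adjacent. *)
pose P (n : nat) (b : {ffun 'I_N * 'I_N -> bool}) : {poly R[i]} :=
  mu (fun=> 'X) (fun i j => (if insub i is Some i' then
       if insub j is Some j' then b (i', j') else false else false)%:R) (iota 0 n).
pose rts (p : {poly R[i]}) := sval (closed_field_poly_normal p).
pose L := [seq complex.Re r | r <- flatten [seq rts (P p.1 p.2) |
   p <- [seq (val n, b) | n <- enum 'I_N, b <- enum {ffun 'I_N * 'I_N -> bool}]]].
apply: (@sub_finite_set _ _ [set` L]); last exact: finite_seq.
move=> theta [K [e [uK sK esym muK]]] /=.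
pose b : {ffun 'I_N * 'I_N -> bool} := [ffun p : 'I_N * 'I_N => e (nth 0%N K (val p.1)) (nth 0%N K (val p.2))].
have eP : (P (size K) b).[theta%:C] = 0.
  rewrite -muK -[in RHS](mkseq_nth 0%N K) /mkseq mu_map; last first.
    by move=> i j; rewrite !mem_iota !add0n => iK jK /eqP; rewrite nth_uniq // => /eqP.
  rewrite -[LHS]/(horner_eval theta%:C _) mu_rmorph; apply: eq_mu.
    by move=> i _; rewrite /= /horner_eval hornerX.
  move=> i j; rewrite !mem_iota !add0n /= => iK jK.
  have iN := ltn_trans iK sK; have jN := ltn_trans jK sK.
  by rewrite /horner_eval !insubT ffunE /= -polyCMn hornerC.
(* The zero polynomial, for which root extraction says nothing, is excluded by nonvanishing at the
   point i of the upper half-plane. *)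
have P0 : P (size K) b != 0.
  apply/negP => /eqP P0.
  pose c (i j : nat) : R := (if insub i is Some i' then
       if insub j is Some j' then b (i', j') else false else false)%:R.
  have cs i j : c i j = c j i.
    rewrite /c; case: (insub i) => [i'|]; case: (insub j) => [j'|] //.
    by rewrite !ffunE esym.
  have c0 i j : 0 <= c i j by apply: ler0n.
  have x0 (v : nat) : 0 < complex.Im ((fun=> (0 +i* 1 : R[i])) v) by rewrite /= ltr01.
  have := muC_neq0 cs c0 x0 (iota_uniq 0 (size K)) [::]; rewrite /muC /muD filter_predT.
  suff -> : mu (fun=> 0 +i* 1) (fun u v => (c u v)%:C) (iota 0 (size K)) =
      (P (size K) b).[0 +i* 1] by rewrite P0 horner0 eqxx.
  rewrite -[RHS]/(horner_eval (0 +i* 1) _) mu_rmorph; apply: eq_mu.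
    by move=> i _; rewrite /= /horner_eval hornerX.
  by move=> i j _ _; rewrite /c !rmorph_nat.
apply/mapP; exists theta%:C => //; apply/flattenP; exists (rts (P (size K) b)).
  apply/mapP; exists (size K, b) => //; apply/allpairsPdep.
  by exists (Ordinal sK), b; rewrite !mem_enum.
rewrite /rts; case: closed_field_poly_normal => r /= er.
move: eP; rewrite er hornerZ => /eqP; rewrite mulf_eq0 lead_coef_eq0 (negPf P0) /=.
by rewrite -[_ == 0]/(root _ _) root_prod_XsubC.
Qed.

(** * Truncated path trees and their resolvents *)

Section PathTree.
Variables (R : realType) (g : lgraph) (D : nat) (nb : nat -> seq nat).
Hypothesis gG : good_graph D g nb.

(** The path tree from [u] that avoids [T], truncated after [n] further vertices so that all sums
    over it are finite. *)
Fixpoint btree (n : nat) (T : seq nat) (u : nat) : seq (seq nat) :=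
  [:: u] :: (if n is n'.+1 then
    [seq u :: q | v <- [seq v <- nb u | v \notin u :: T], q <- btree n' (u :: T) v]
  else [::]).

Lemma btree_nil n T u : [::] \notin btree n T u.
Proof.
by case: n => [|n] //=; rewrite inE /=; apply/allpairsPdep => -[x [y []]].
Qed.

Lemma has_memU (u : nat) T r : has (mem (u :: T)) r = (u \in r) || has (mem T) r.
Proof.
apply/hasP/orP => [[y yr /=]|[ur|/hasP[y yr yT]]].
- by rewrite inE => /predU1P[<-|yT]; [left|right; apply/hasP; exists y].
- by exists u; rewrite //= mem_head.
- by exists y => //=; rewrite inE [y \in T]yT orbT.
Qed.

Lemma btreeP n T u u' r : u \notin T ->
  (u' :: r \in btree n T u) = [&& u' == u, path (adj g) u r, uniq (u :: r),
                            ~~ has (mem T) r & (size r <= n)%N].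
Proof.
elim: n T u u' r => [|n IH] T u u' r uT.
  rewrite /= inE eqseq_cons leqn0 size_eq0; case: eqVneq => //= _.
  by case: r => //= v r; rewrite !andbF.
rewrite inE eqseq_cons; case: eqVneq => [->|u'u] /=; last first.
  by apply/allpairsPdep => -[x [y [_ _ [e _]]]]; rewrite e eqxx in u'u.
case: r => [|v r] /=; first by [].
have key x : x \in nb u -> x \notin u :: T -> v :: r \in btree n (u :: T) x =
    [&& v == x, path (adj g) x r, uniq (x :: r), ~~ has (mem (u :: T)) r & (size r <= n)%N].
  by move=> _; apply: IH.
apply/allpairsPdep/idP => [[x [q [xu qx [e]]]]|].
  move: xu; rewrite mem_filter => /andP[xuT xn].
  rewrite -e key // in qx; case/and5P: qx => /eqP -> hp /= /andP[xr ur].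
  rewrite has_memU negb_or => /andP[nur hT] sr.
  have ux : adj g u x by rewrite -(nbE gG).
  move: xuT; rewrite inE negb_or => /andP[xu xT].
  by rewrite ux hp inE negb_or eq_sym xu nur xr ur negb_or hT ltnS sr !andbT.
case/and4P => /andP[uv hp]; rewrite inE !negb_or.
move=> /andP[/andP[vu ur] /andP[vr Ur]] /andP[vT hT] sr.
have vuT : v \notin u :: T by rewrite inE negb_or eq_sym vu.
have vn : v \in nb u by rewrite (nbE gG).
exists v, (v :: r); split=> //; first by rewrite mem_filter vuT.
by rewrite key // eqxx hp /= vr Ur has_memU negb_or ur hT.
Qed.

Section Energy.
Variable z : R[i].
Hypothesis z0 : 0 < complex.Im z.

(** An iterated Ward inequality: -Im G(u) / |G(u)|^2 is Im z plus the values of -Im G at the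
    children, and each of those is bounded in the same way. It bounds the squared norm of the root
    column of the resolvent. *)
Lemma btree_energy n T u : lV g u -> u \notin T ->
  complex.Im z * (\sum_(p <- btree n T u) nsq (rr g z (p ++ T)))
    <= - complex.Im (gg g z T u) * nsq (rr g z T).
Proof.
elim: n T u => [|n IH] T u gu uT.
  rewrite big_seq1 /= (rr_cons gG z0) nsqM mulrA ler_wpM2r ?nsq_ge0 //.
  exact: (gg_ward gG z0).
rewrite /= big_cons big_allpairs_dep /= mulrDr.
have n0 : nsq (gg g z T u) != 0 by rewrite gt_eqF // nsq_gt0 (gg_neq0 gG z0).
have -> : - complex.Im (gg g z T u) = nsq (gg g z T u) *
    (complex.Im z + \sum_(v <- nb u | v \notin u :: T) - complex.Im (gg g z (u :: T) v)).
  have := congr1 (@complex.Im R) (gg_inv gG z0 gu uT); rewrite ImV ImD ImN Im_sum => h.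
  by rewrite sumrN -h mulrC divfK.
set S := \sum_(v <- nb u | v \notin u :: T) - complex.Im _.
have -> : nsq (gg g z T u) * (complex.Im z + S) * nsq (rr g z T) =
   nsq (gg g z T u) * complex.Im z * nsq (rr g z T) + S * (nsq (gg g z T u) * nsq (rr g z T)).
  ring.
apply: lerD.
  by rewrite (rr_cons gG z0) nsqM mulrA [nsq _ * _]mulrC.
rewrite -nsqM -(rr_cons gG z0) big_filter mulr_sumr /S mulr_suml.
rewrite [leLHS]big_seq_cond [leRHS]big_seq_cond; apply: ler_sum => v /andP[vn vT].
have gv : lV g v by case/andP: (nb_V gG vn).
apply: le_trans (IH _ _ gv vT); rewrite le_eqVlt; apply/orP; left; apply/eqP.
congr (_ * _); apply: eq_bigr => q _; congr (nsq _); apply: (rr_eq gG z0) => y.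
by rewrite !(inE, mem_cat) orbCA.
Qed.

Variables (L o : nat).
Hypothesis go : lV g o.
Let B := undup (btree L [::] o).

Lemma energy_le : \sum_(p <- B) nsq (rr g z p) <= - complex.Im (gg g z [::] o) / complex.Im z.
Proof.
rewrite ler_pdivlMr // mulrC.
have := btree_energy L go (isT : o \notin [::]).
have -> : nsq (rr g z [::]) = 1 by rewrite (rr_nil gG z0) nsqR expr1n.
rewrite mulr1; apply: le_trans; rewrite ler_wpM2l ?(ltW z0) //.
under [leRHS]eq_bigr do rewrite cats0.
rewrite /B; elim: (btree L [::] o) => [|p s IH]; first by rewrite !big_nil.
rewrite /= big_cons; case: ifP => _; first by apply: (le_trans IH); rewrite lerDr nsq_ge0.
by rewrite big_cons lerD2l.
Qed.

Lemma memB p : (p \in B) = if p is u :: r then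
   [&& u == o, path (adj g) o r, uniq (o :: r) & (size r <= L)%N] else false.
Proof.
rewrite mem_undup; case: p => [|u r]; first by rewrite (negPf (btree_nil _ _ _)).
rewrite btreeP //; congr [&& _, _, _ & _]; case: hasP => // -[] //.
Qed.

(* The products of Green functions along paths form a solution of
   [(z - A) psi = delta_o] on the path tree. *)
Lemma tree_green p : p \in B -> (size p <= L)%N ->
  \sum_(q <- B | tree_adj p q) rr g z q = z * rr g z p - (p == [:: o])%:R.
Proof.
move=> pB sp; case/lastP: p => [|p0 v] in pB sp *; first by rewrite memB in pB.
have e1 : rr g z (rcons p0 v) = rr g z (v :: p0).
  by apply: (rr_eq gG z0) => y; rewrite mem_rcons.
have [gv vp0] : lV g v /\ v \notin p0.
  have U : uniq (rcons p0 v).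
    move: pB; rewrite memB; case: (rcons p0 v) => // u r /and4P[/eqP -> _ h _]; done.
  rewrite rcons_uniq in U; case/andP: U => vp0 _; split=> //.
  move: pB; rewrite memB; case: p0 {sp e1 vp0} => [|u r] /=.
    by case/andP => /eqP ->.
  by case/and4P => _; rewrite rcons_path => /andP[_ /and3P[]].
have exp := rr_expand gG z0 gv vp0.
have child w : (rcons (rcons p0 v) w \in B) = (w \in nb v) && (w \notin rcons p0 v).
  move: pB sp; rewrite !memB (nbE gG); case: p0 {e1 vp0 exp} => [|u r] /=.
    case/andP => /eqP -> _ sp; rewrite eqxx sp !andbT !inE.
    by rewrite eq_sym.
  rewrite !size_rcons !rcons_path !last_rcons => /and4P[/eqP -> /andP[hp pv]] U sr sp.
  rewrite eqxx hp pv /= sp andbT; case: (adj g v w) => //=.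
  move: U; rewrite !rcons_uniq => /andP[oN /andP[vr ur]].
  rewrite vr ur !andbT !(inE, mem_rcons) !negb_or.
  move: oN; rewrite mem_rcons inE negb_or => /andP[ov onr].
  by rewrite ov onr (eq_sym o w); case: (w == o); case: (w == v); rewrite ?andbT ?andbF.
pose nbrs := (if p0 is [::] then [::] else [:: p0]) ++
  [seq rcons (rcons p0 v) w | w <- nb v & w \notin rcons p0 v].
have pn : perm_eq [seq q <- B | tree_adj (rcons p0 v) q] nbrs.
  apply: uniq_perm.
  - by rewrite filter_uniq // undup_uniq.
  - rewrite cat_uniq map_inj_uniq ?filter_uniq ?(nb_uniq gG) //; last exact: rcons_injr.
    rewrite andbT; apply/andP; split; first by case: (p0).
    apply/hasPn => _ /mapP[w _ ->]; case: (p0) => // u r; rewrite /= inE.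
    by apply/negP => /eqP /(congr1 size); rewrite /= !size_rcons => /eqP; lia.
  - move=> q; rewrite mem_filter mem_cat /tree_adj size_rcons.
    apply/andP/orP => [[/orP[/andP[/eqP sq /eqP tq]|/andP[/eqP sq /eqP tq]] qB]|[]].
    + right; case/lastP: q => [|q w] in sq tq qB *; first by [].
      move: sq tq; rewrite size_rcons => -[sq]; rewrite -cats1 take_size_cat; last by rewrite -sq.
      move=> tq; rewrite tq in qB *; rewrite cats1 child in qB *.
      by apply/mapP; exists w => //; rewrite mem_filter andbC.
    + left; case: sq => sq; move: tq; rewrite -sq -cats1 take_size_cat // => e; rewrite -e in qB *.
      by case: (p0) qB => [|u r] qB; rewrite ?mem_head //; rewrite memB in qB.
    + case: p0 pB sp e1 vp0 exp child nbrs => // u r pB sp _ _ _ _ _; rewrite inE => /eqP ->.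
      split; first by rewrite -cats1 take_size_cat // !eqxx orbT.
      move: pB; rewrite !memB /= rcons_path size_rcons => /and4P[-> /andP[-> _]].
      rewrite rcons_uniq mem_rcons inE negb_or => /andP[/andP[_ ->] /andP[_ ->]] /ltnW ->.
      by [].
    + case/mapP => w; rewrite mem_filter => /andP[wp wv] ->; split; last by rewrite child wv.
      by rewrite size_rcons size_rcons eqxx /= -[rcons (rcons _ _) w]cats1 take_size_cat
        ?size_rcons // eqxx.
rewrite -big_filter (perm_big _ pn) /= big_cat big_map big_filter /=.
have -> : \sum_(w <- nb v | w \notin rcons p0 v) rr g z (rcons (rcons p0 v) w) =
    \sum_(w <- nb v | w \notin v :: p0) rr g z (w :: v :: p0).
  apply: eq_big => w; first by rewrite mem_rcons.
  by move=> _; apply: (rr_eq gG z0) => y; rewrite !(mem_rcons, inE).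
set S := \sum_(w <- nb v | _) _.
have eS : S = z * rr g z (v :: p0) - rr g z p0 by rewrite exp -/S; ring.
rewrite eS e1; case: (p0) pB => [|u r] pB.
  rewrite big_nil add0r (rr_nil gG z0).
  by move: pB; rewrite memB => /andP[/eqP -> _]; rewrite eqxx.
rewrite big_seq1 addrC subrK (_ : _ == _ = false) ?subr0 //.
by rewrite eqseq_cons; case: (r) => [|? ?]; rewrite andbF.
Qed.

End Energy.
End PathTree.

(** * Walks and polynomials in the adjacency operator *)

Section Walks.
Variables (R : realType) (g : lgraph) (D : nat) (nb : nat -> seq nat).
Hypothesis gG : good_graph D g nb.
Variables (L o : nat).
Hypothesis go : lV g o.

Let B := undup (btree nb L [::] o).
Let root := [:: o].

Lemma tree_adj_sym p q : tree_adj p q = tree_adj q p.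
Proof. by rewrite /tree_adj orbC. Qed.

Lemma root_B : root \in B.
Proof. by rewrite (memB gG) /= eqxx. Qed.

Definition opA (K : nmodType) (f : seq nat -> K) (p : seq nat) : K :=
  \sum_(q <- B | tree_adj p q) f q.

Lemma opA_sym (K : comNzRingType) (f h : seq nat -> K) :
  \sum_(p <- B) f p * opA h p = \sum_(p <- B) opA f p * h p.
Proof.
under eq_bigr do rewrite mulr_sumr big_mkcond.
under [RHS]eq_bigr do rewrite mulr_suml big_mkcond.
rewrite exchange_big; apply: eq_bigr => p _; apply: eq_bigr => q _ /=.
by rewrite tree_adj_sym.
Qed.

Fixpoint cw (k : nat) (p : seq nat) : nat :=
  if k is k'.+1 then \sum_(q <- B | tree_adj p q) cw k' q else (p == root).

Lemma cw_supp k p : (k.+1 < size p)%N -> cw k p = 0%N.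
Proof.
elim: k p => [|k IH] p sp /=; first by case: eqP sp => [->|].
apply: big1 => q; rewrite /tree_adj => /orP[]/andP[/eqP sq _]; apply: IH; lia.
Qed.

(** Coordinate at [p] of P(A) delta, where A is the adjacency operator of the truncated tree, delta
    sits at the root, and [cw i] is the vector A^i delta. *)
Definition vec (P : {poly R}) (p : seq nat) : R := \sum_(i < size P) P`_i * (cw i p)%:R.

Lemma vec_widen n (P : {poly R}) p : (size P <= n)%N -> vec P p = \sum_(i < n) P`_i * (cw i p)%:R.
Proof.
move=> sP; rewrite /vec (big_ord_widen_cond n predT (fun i => P`_i * (cw i p)%:R)) //=.
rewrite [RHS](bigID (fun i : 'I_n => i < size P)%N) /= [X in _ = _ + X]big1 ?addr0 //.
by move=> i; rewrite -leqNgt => /(nth_default 0) ->; rewrite mul0r.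
Qed.

Lemma vecD (P Q : {poly R}) p : vec (P + Q) p = vec P p + vec Q p.
Proof.
pose n := maxn (size P) (size Q).
rewrite (@vec_widen n (P + Q)) ?size_polyD // (@vec_widen n P) ?leq_maxl //.
rewrite (@vec_widen n Q) ?leq_maxr // -big_split; apply: eq_bigr => i _.
by rewrite coefD mulrDl.
Qed.

Lemma vecZ c (P : {poly R}) p : vec (c *: P) p = c * vec P p.
Proof.
rewrite (@vec_widen (size P) (c *: P)) ?size_scale_leq // /vec mulr_sumr.
by apply: eq_bigr => i _; rewrite coefZ mulrA.
Qed.

Lemma vecC c p : vec c%:P p = c * (p == root)%:R.
Proof. by rewrite (@vec_widen 1) ?size_polyC_leq1 // big_ord1 coefC. Qed.

Lemma vecX (P : {poly R}) p : vec ('X * P) p = opA (vec P) p.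
Proof.
rewrite (@vec_widen (size P).+1); last first.
  by rewrite mulrC (leq_trans (size_polyMleq _ _)) // size_polyX addn2.
rewrite big_ord_recl coefXM eqxx mul0r add0r /opA exchange_big /=.
by apply: eq_bigr => i _; rewrite coefXM /= natr_sum mulr_sumr.
Qed.

Lemma vec_supp (P : {poly R}) p : (size P < size p)%N -> vec P p = 0.
Proof.
move=> h; rewrite /vec big1 // => i _; rewrite cw_supp ?mulr0 //.
by have := ltn_ord i; lia.
Qed.

Lemma sum_root (K : pzSemiRingType) (f : seq nat -> K) :
  \sum_(p <- B) (p == root)%:R * f p = f root.
Proof.
rewrite (bigD1_seq root) ?root_B ?undup_uniq //= eqxx mul1r big1 ?addr0 // => p pr.
by rewrite (negPf pr) mul0r.
Qed.

(** Self-adjointness of A: inner products of vectors P(A) delta are expressed through closed walks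
    at the root, that is, through moments. *)
Lemma vec_ip (P Q : {poly R}) : \sum_(p <- B) vec P p * vec Q p = vec (P * Q) root.
Proof.
elim/poly_ind: P Q => [|P c IH] Q.
  rewrite mul0r /vec size_poly0 big_ord0 big1 // => p _.
  by rewrite big_ord0 mul0r.
have -> : (P * 'X + c%:P) * Q = P * ('X * Q) + c *: Q by rewrite mulrDl mulrA mul_polyC.
rewrite vecD vecZ -IH -(sum_root (vec Q)) mulr_sumr.
under [X in _ = X + _]eq_bigr do rewrite vecX.
rewrite opA_sym -big_split; apply: eq_bigr => p _.
by rewrite vecD vecC -vecX (mulrC 'X P) mulrDl mulrA.
Qed.

(* Cauchy-Schwarz for the pairing of [P(A) delta] with the resolvent. *)
Lemma vec_resolvent (theta t : R) (P : {poly R}) : 0 < t -> (size P <= L)%N ->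
  vec P root ^+ 2 <= (- complex.Im (gg g (zt theta t) [::] o) / t) *
    (t ^+ 2 * vec (P * P) root + vec ((('X - theta%:P) * P) * (('X - theta%:P) * P)) root).
Proof.
move=> t0 sP; set z := zt theta t; have z0 : 0 < complex.Im z by [].
set H := ('X - theta%:P) * P.
have eH p : vec H p = opA (vec P) p - theta * vec P p.
  by rewrite /H mulrBl mul_polyC -scaleNr vecD vecX vecZ mulNr.
(* [e] is (z - A) P(A) delta. Writing z - A as -(A - theta) + i t makes its squared norm split into
   the two moments of the claim. *)
pose e p : R[i] := (- vec H p) +i* (t * vec P p).
have E : \sum_(p <- B) rr g z p * e p = (vec P root)%:C.
  have ee p : e p = z * (vec P p)%:C - opA (fun q => (vec P q)%:C) p.
    rewrite /e eH /opA -rmorph_sum /z; congr (_ +i* _); rewrite /=; ring.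
  under eq_bigr do rewrite ee mulrBr mulrA.
  rewrite sumrB opA_sym -sumrB -(sum_root (fun p => (vec P p)%:C)).
  rewrite [LHS]big_seq [RHS]big_seq; apply: eq_bigr => p pB; rewrite -mulrBl.
  (* The resolvent equation may fail at the deepest level of the truncation, but P(A) delta vanishes
     there since the degree of [P] is less than [L]. *)
  have [sp|sp] := leqP (size p) L; last first.
    by rewrite (vec_supp (leq_ltn_trans sP sp)) !mulr0.
  by rewrite [opA _ p](tree_green gG z0 go pB sp); ring.
have := @psd2_sum R _ B predT (fun=> 1) (fun p => rr g z p * e p) (fun p => nsq (rr g z p))
  (fun p => nsq (e p)) (fun _ => ler01).
case=> [p _ _|_ h0]; first by split; rewrite ?nsq_ge0 // nsqM.
under eq_bigr do rewrite mul1r; rewrite E nsqR => h.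
apply: le_trans h _.
under eq_bigr do rewrite mul1r; under [X in _ * X]eq_bigr do rewrite mul1r.
have -> : \sum_(p <- B) nsq (e p) = t ^+ 2 * vec (P * P) root + vec (H * H) root.
  rewrite -!vec_ip mulr_sumr -big_split; apply: eq_bigr => p _.
  by rewrite /nsq /= ; ring.
apply: ler_wpM2r (energy_le gG z0 L go).
have pos Q : 0 <= vec (Q * Q) root.
  by rewrite -vec_ip sumr_ge0 // => p _; rewrite -expr2 sqr_ge0.
exact: addr_ge0 (mulr_ge0 (sqr_ge0 t) (pos P)) (pos H).
Qed.

(** An explicit list of the walks counted by [cw], stored without their starting point; it links
    [cw] to the cardinality of [closed_walks]. *)
Fixpoint wl (k : nat) (p : seq nat) : seq (seq (seq nat)) :=
  if k is k'.+1 then [seq rcons s p | q <- [seq q <- B | tree_adj p q], s <- wl k' q]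
  else if p == root then [:: [::]] else [::].

Lemma size_wl k p : size (wl k p) = cw k p.
Proof.
elim: k p => [|k IH] p /=; first by case: eqP.
rewrite size_allpairs_dep sumnE big_map big_filter; apply: eq_bigr => q _; exact: IH.
Qed.

Lemma wlP k p s : p \in B -> (s \in wl k p) =
  [&& size s == k, path tree_adj root s, all (mem B) s & last root s == p].
Proof.
elim: k p s => [|k IH] p s pB /=.
  case: eqVneq => [->|pr]; first by rewrite inE; case: s => [|? ?] //=; rewrite ?eqxx.
  by case: s => [|? ?] //=; rewrite eq_sym (negPf pr).
case/lastP: s => [|s q] /=.
  by apply/allpairsPdep => -[x [y [_ _ /(congr1 size)]]]; rewrite size_rcons.
rewrite size_rcons eqSS rcons_path all_rcons last_rcons /=.
apply/allpairsPdep/idP => [[x [s' [xn sx /rcons_inj[-> ->]]]]|].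
  move: xn; rewrite mem_filter => /andP[px xB].
  move: sx; rewrite IH // => /and4P[-> -> -> /eqP ->].
  by rewrite tree_adj_sym px eqxx pB.
case/and4P => ss /andP[hp sq] /andP[qB sB] /eqP qp; rewrite -qp.
exists (last root s), s; split=> //.
  rewrite mem_filter tree_adj_sym sq /=.
  by case/lastP: s sB {ss hp sq} => [|s y]; rewrite ?root_B // all_rcons last_rcons => /andP[].
rewrite IH ?ss ?hp ?sB ?eqxx //.
by case/lastP: s sB {ss hp sq} => [|s y]; rewrite ?root_B // all_rcons last_rcons => /andP[].
Qed.

Lemma wl_uniq k p : p \in B -> uniq (wl k p).
Proof.
elim: k p => [|k IH] p pB /=; first by case: eqP.
apply: allpairs_uniq_dep.
- by rewrite filter_uniq // undup_uniq.
- by move=> q; rewrite mem_filter => /andP[_ qB]; apply: IH.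
- move=> _ _ /allpairsPdep[x1 [s1 [xn1 sx1 ->]]] /allpairsPdep[x2 [s2 [xn2 sx2 ->]]] /=.
  move/rcons_inj => -[ss]; rewrite -ss in sx2 *.
  have inB x : x \in [seq q <- B | tree_adj p q] -> x \in B by rewrite mem_filter => /andP[].
  move: sx1 sx2; rewrite !wlP ?inB // => /and4P[_ _ _ /eqP <-] /and4P[_ _ _ /eqP <-].
  by [].
Qed.

Hypothesis ladjE : forall i j, ladj g i j = adj g i j.

Lemma is_gpathE p : is_gpath g o p = if p is u :: r then
  [&& u == o, path (adj g) o r & uniq (o :: r)] else false.
Proof.
case: p => // u r; rewrite /is_gpath; case: eqVneq => //= ->.
rewrite (eq_path ladjE) go /=; case hp: (path _ _ _) => //=.
have -> : all (lV g) r; last by rewrite andbT.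
elim: r (o) go hp => //= v r IH x gx /andP[xv hr].
have gv : lV g v by case/and3P: xv.
by rewrite gv (IH v).
Qed.

(** A walk of length at most [L] from the root never reaches a path with more than [L + 1] vertices,
    so the truncation loses none of them. *)
Lemma closed_walksE k : (k <= L)%N ->
  closed_walks g o k = [set` [seq root :: s | s <- wl k root]].
Proof.
move=> kL; apply/seteqP; split => w /=.
  case=> sw hw lw aw pw; case: w sw hw lw aw pw => //= x s [ss] -> lw /andP[_ aw] pw.
  apply/mapP; exists s => //; rewrite wlP ?root_B // ss eqxx pw /=.
  have -> : last root s == root by apply/eqP.
  rewrite andbT; have sz0 : (size s + size root <= L.+1)%N by rewrite ss addn1.
  have gen t p : path tree_adj p t -> all (is_gpath g o) t -> (size t + size p <= L.+1)%N ->
      all (mem B) t.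
    elim: t p => //= q t IH p /andP[pq ht] /andP[gq at_] sz.
    have sq : (size q <= (size p).+1)%N.
      by move: pq; rewrite /tree_adj => /orP[]/andP[/eqP -> _] //; rewrite -addn2 leq_addr.
    have sz' : (size t + size q <= L.+1)%N.
      by apply: leq_trans sz; rewrite addSnnS leq_add2l.
    rewrite (IH q) ?andbT //.
    move: gq; rewrite is_gpathE (memB gG); case: q sq sz' {pq ht} => //= u r _ sz' /and3P[-> -> ->] /=.
    by move: sz'; rewrite addnS ltnS; apply: leq_trans; rewrite leq_addl.
  exact: gen pw aw sz0.
move=> /mapP[s]; rewrite wlP ?root_B // => /and4P[/eqP ss hp sB /eqP ls] ->.
split=> //; first by rewrite /= ss.
have rg : is_gpath g o root by rewrite is_gpathE /= eqxx.
apply/allP => q; rewrite inE => /predU1P[-> //|qs]; move/allP: sB => /(_ q qs) /=.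
by rewrite (memB gG) is_gpathE; case: q {qs} => // u r /and4P[-> -> -> _].
Qed.

Lemma counting_closed_walks k : (k <= L)%N ->
  counting (closed_walks g o k) = ((cw k root)%:R : R)%:E.
Proof.
move=> kL; rewrite (closed_walksE kL) /counting; set s := [seq _ | _ <- _].
have fs : finite_set [set` s] by exact: finite_seq.
rewrite asboolT //; congr (_%:R%:E).
have us : uniq s by rewrite map_inj_uniq ?wl_uniq ?root_B // => x y [].
have /perm_size h : perm_eq (finmap.enum_fset (fset_set [set` s])) s.
  by apply: uniq_perm => // x; rewrite in_fset_set // mem_setE.
by rewrite [LHS]h /s size_map size_wl.
Qed.

(** One parent and at most [D] children; hence the geometric bound on the moments. *)
Lemma tree_degree p : p \in B -> (count (tree_adj p) B <= D.+1)%N.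
Proof.
move=> pB; rewrite -size_filter.
have [p0 [v pe]] : exists p0 v, p = rcons p0 v.
  by case/lastP: p pB => [|p0 v _]; [rewrite (memB gG)|exists p0, v].
have vN : (size (nb v) <= D)%N by exact: (nb_size gG).
apply: (@leq_trans (size (p0 :: [seq rcons p w | w <- nb v]))); last by rewrite /= size_map.
apply: uniq_leq_size; first by rewrite filter_uniq // undup_uniq.
move=> q; rewrite mem_filter /tree_adj => /andP[/orP[]/andP[/eqP sq /eqP tq] qB].
  case/lastP: q => [|q w] // in sq tq qB *.
  move: sq tq; rewrite size_rcons => -[sq]; rewrite -cats1 -sq take_size_cat // => qp.
  rewrite inE; apply/orP; right; apply/mapP; exists w; last by rewrite cats1 qp.
  rewrite qp in qB; move: qB; rewrite (memB gG) pe (nbE gG).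
  case: (p0) => [|u r] /=; first by case/and4P => /eqP -> /andP[].
  rewrite !rcons_path !last_rcons => /and4P[_ /andP[_ h] _ _]; done.
rewrite inE; apply/orP; left; move: sq tq; rewrite pe size_rcons => -[<-].
by rewrite -cats1 take_size_cat // => ->.
Qed.

Lemma cw_le k p : p \in B -> (cw k p <= D.+1 ^ k)%N.
Proof.
elim: k p => [|k IH] p pB /=; first by case: eqP.
rewrite big_seq_cond; apply: (@leq_trans (\sum_(q <- B | (q \in B) && tree_adj p q) D.+1 ^ k)).
  by apply: leq_sum => q /andP[qB _]; apply: IH.
rewrite -big_seq_cond big_const_seq iter_addn_0 expnSr leq_mul2l tree_degree ?orbT //.
Qed.

End Walks.

(** * Atoms of the matching measure *)

Section MomentBound.
Variables (R : realType) (nu : probability R R) (m : nat -> R) (C : R).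
Hypothesis nuE : forall k, (\int[nu]_x ((x ^+ k)%:E))%E = (m k)%:E.
Hypotheses (C0 : 0 <= C) (mC : forall k, m k <= C ^+ k).

Let Lam (P : {poly R}) := \sum_(i < size P) P`_i * m i.

(** Even powers are nonnegative, so their finite integrals give integrability; a general power is
    dominated by 1 + x^(2k). *)
Lemma moment_integrable k : nu.-integrable setT (EFin \o (fun x => x ^+ k)).
Proof.
have ev j : nu.-integrable setT (EFin \o (fun x : R => x ^+ (j * 2))).
  apply/integrableP; split; first by apply/measurable_EFinP; apply: exprn_measurable.
  rewrite (eq_integral (fun x : R => (x ^+ (j * 2))%:E)) ?nuE ?ltry // => x _ /=.
  by rewrite ger0_norm // exprM sqr_ge0.
apply: (@le_integrable _ _ _ nu setT measurableT _ (fun x : R => (1 + x ^+ (k * 2))%:E)).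
- by apply/measurable_EFinP; apply: exprn_measurable.
- move=> x _ /=; rewrite lee_fin exprM [leRHS]ger0_norm ?addr_ge0 ?sqr_ge0 //.
  by rewrite ler_norml; apply/andP; split; move: (x ^+ k) => y; nra.
- have h1 : nu.-integrable setT (EFin \o cst (1 : R)) by exact: finite_measure_integrable_cst.
  exact: eq_integrable (integrableD measurableT h1 (ev k)).
Qed.

Lemma moment_horner (P : {poly R}) : (\int[nu]_x (P.[x])%:E)%E = (Lam P)%:E.
Proof.
under eq_integral do rewrite horner_coef -sumEFin.
rewrite integral_sum //=.
  rewrite /Lam -sumEFin; apply: eq_bigr => i _.
  under eq_integral do rewrite EFinM.
  by rewrite integralZl ?nuE //; apply: moment_integrable.
move=> i; have := integrableZl measurableT P`_i (moment_integrable i).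
by apply: eq_integrable => // x _.
Qed.

(** Markov's inequality for even moments: the mass of |x| >= C + 1 is at most (C / (C + 1))^(2n) for
    every n. *)
Lemma moment_support : \forall x \ae nu, `|x| <= C + 1.
Proof.
pose S := [set x : R | C + 1 <= `|x|].
have mS : measurable S.
  rewrite (_ : S = (@Num.norm _ R) @^-1` `[C + 1, +oo[%classic); last first.
    by apply/seteqP; split => x /=; rewrite in_itv /= andbT.
  by rewrite -[X in measurable X]setTI; apply: (@normr_measurable R setT).
have hS n : fine (nu S) <= (C / (C + 1)) ^+ (n * 2).
  have C1 : 0 < (C + 1) ^+ (n * 2) by rewrite exprn_gt0 // ltr_wpDl.
  rewrite expr_div_n ler_pdivlMr // mulrC -lee_fin EFinM fineK ?fin_num_measure //.
  rewrite -[S]setIT -(integral_indic nu measurableT mS) -ge0_integralZl //; last 2 first.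
  - by apply/measurable_EFinP; exact: measurable_indic.
  - by rewrite lee_fin ltW.
  apply: (@le_trans _ _ (m (n * 2))%:E); last by rewrite lee_fin.
  rewrite -nuE; apply: ge0_le_integral => //.
  - by move=> x _; rewrite -EFinM lee_fin mulr_ge0 // ltW.
  - apply: measurable_funeM => //; apply/measurable_EFinP; exact: measurable_indic.
  - by apply/measurable_EFinP; apply: exprn_measurable.
  - move=> x _; rewrite -EFinM lee_fin indicE; case: (boolP (x \in S)) => xS.
      rewrite mulr1 2!exprM -(real_normK (num_real (x ^+ n))) -exprM mulnC exprM normrX -exprM mulnC exprM.
      by rewrite -!exprM lerXn2r ?nnegrE ?addr_ge0 //; move: xS; rewrite inE.
    by rewrite mulr0 exprM sqr_ge0.
suff S0 : nu S = 0.
  by exists S; split => // x /= /negP; rewrite -ltNge => /ltW.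
apply/eqP; rewrite eq_le measure_ge0 andbT -(fineK (fin_num_measure nu S mS)) lee_fin.
rewrite leNgt; apply/negP => a0.
pose q := (C / (C + 1)) ^+ 2.
have q0 : 0 <= q by rewrite sqr_ge0.
have q1 : q < 1.
  by rewrite /q -(expr1n _ 2) ltrXn2r ?nnegrE // ?divr_ge0 ?addr_ge0 // ltr_pdivrMr ?mul1r ?ltrDl // ltr_wpDl.
have h := @cvg_expr R q; have {}h : (fun n => q ^+ n) @ \oo --> 0 by apply: h; rewrite ger0_norm.
suff : fine (nu S) <= 0 by lra.
by apply: cvgr_to_ge h _; apply: nearW => n; rewrite /q -exprM mulnC.
Qed.

Lemma bernoulli_power (n : nat) (s : R) : 0 <= s -> s <= 1 -> n%:R * s * (1 - s) ^+ n <= 1.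
Proof.
move=> s0 s1.
have h : (1 + n%:R * s) * (1 - s) ^+ n <= 1.
  elim: n => [|n IH]; first by rewrite mul0r addr0 expr0 mulr1.
  apply: le_trans IH; rewrite exprS mulrA ler_wpM2r ?exprn_ge0 ?subr_ge0 //.
  rewrite -natr1; have : 0 <= n%:R :> R by []. nra.
apply: le_trans h; rewrite ler_wpM2r ?exprn_ge0 ?subr_ge0 //; lra.
Qed.

(* The test polynomial [(1 - (X - theta)^2 / M)^(2n)] is at most [1] on the support of [nu]
   and concentrates at [theta] as [n] grows. *)
Lemma moment_atom (theta t Psi : R) : 0 <= Psi ->
  (forall P : {poly R}, Lam P ^+ 2 <=
     Psi * (t ^+ 2 * Lam (P * P) + Lam ((('X - theta%:P) * P) * (('X - theta%:P) * P)))) ->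
  fine (nu [set theta]) <= t ^+ 2 * Psi.
Proof.
(* [M] bounds (x - theta)^2 for |x| <= C + 1, so that [s] takes values in [0, 1] on the support. *)
move=> Psi0 hP; pose M := (C + 1 + `|theta|) ^+ 2.
have M0 : 0 < M by rewrite exprn_gt0 // ltr_wpDr // ltr_wpDl.
pose s x := M^-1 * (x - theta) ^+ 2.
have s0 x : 0 <= s x by rewrite mulr_ge0 ?sqr_ge0 // invr_ge0 ltW.
have s1 x : `|x| <= C + 1 -> s x <= 1.
  move=> hx; rewrite /s mulrC ler_pdivrMr // mul1r -(real_normK (num_real (x - theta))).
  rewrite /M lerXn2r ?nnegrE ?addr_ge0 //; apply: (le_trans (ler_normB _ _)); lra.
pose Q n : {poly R} := (1 - M^-1 *: ('X - theta%:P) ^+ 2) ^+ (n * 2).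
have QE n x : (Q n).[x] = (1 - s x) ^+ (n * 2).
  by rewrite /Q horner_exp hornerD hornerN hornerZ horner_exp hornerXsubC hornerC.
have Q0 n x : 0 <= (Q n).[x] by rewrite QE exprM sqr_ge0.
have Q1 n x : `|x| <= C + 1 -> (Q n).[x] <= 1.
  by move=> /s1 hx; rewrite QE exprn_ile1 ?subr_ge0 // gerBl.
have mp (P : {poly R}) : measurable_fun setT (fun x : R => (P.[x])%:E).
  by apply/measurable_EFinP; apply: measurable_poly.
pose a := fine (nu [set theta]).
have aQ n : a <= Lam (Q n).
  rewrite -lee_fin fineK ?fin_num_measure //.
  rewrite -[X in nu X]setIT -(integral_indic nu measurableT) // -moment_horner.
  apply: ge0_le_integral => //.
  - by apply/measurable_EFinP; exact: measurable_indic.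
  - move=> x _; rewrite lee_fin indicE; case: (boolP (x \in _)) => //; rewrite inE /= => ->.
    by rewrite QE /s subrr expr0n mulr0 subr0 expr1n.
have QQ n : Lam (Q n * Q n) <= Lam (Q n).
  rewrite -lee_fin -!moment_horner; apply: ae_ge0_le_integral => //.
  - by move=> x _; rewrite lee_fin hornerM mulr_ge0.
  - by move=> x _; rewrite lee_fin.
  - apply: filterS (moment_support) => x hx _.
    by rewrite lee_fin hornerM ler_piMl // Q1.
have QY n : (0 < n)%N ->
    Lam ((('X - theta%:P) * Q n) * (('X - theta%:P) * Q n)) <= M / (n * 2)%:R.
  move=> n0; have n20 : 0 < (n * 2)%:R :> R by rewrite ltr0n muln_gt0 n0.
  rewrite -lee_fin -moment_horner -[leRHS]mule1 -(probability_setT nu) -integral_cst //.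
  apply: ae_ge0_le_integral => //.
  - by move=> x _; rewrite lee_fin hornerM -expr2 sqr_ge0.
  - by move=> x _; rewrite lee_fin divr_ge0 // ltW.
  - apply: filterS (moment_support) => x hx _ /=.
    rewrite lee_fin !hornerM hornerXsubC.
    have -> : (x - theta) * (Q n).[x] * ((x - theta) * (Q n).[x]) = (M * s x) * (Q n).[x] * (Q n).[x].
      by rewrite /s (mulrA M) divff ?gt_eqF // mul1r; ring.
    apply: (@le_trans _ _ (M * s x * (Q n).[x])).
      exact: ler_piMr (mulr_ge0 (mulr_ge0 (ltW M0) (s0 x)) (Q0 n x)) (Q1 n x hx).
    rewrite -(mulrA M) (ler_wpM2l (ltW M0)) // QE -[leRHS]mulr1 ler_pdivlMl // mulrA.
    exact: bernoulli_power (s1 _ hx).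
have key n : (0 < n)%N -> Lam (Q n) ^+ 2 <= Psi * (t ^+ 2 * Lam (Q n) + M / (n * 2)%:R).
  move=> n0; apply: (le_trans (hP _)); rewrite ler_wpM2l // lerD ?QY //.
  by rewrite ler_wpM2l ?sqr_ge0.
rewrite leNgt -/a; apply/negP => ta.
have a0 : 0 < a by apply: le_lt_trans ta; rewrite mulr_ge0 ?sqr_ge0.
(* If a > t^2 Psi, then [key] together with Lam (Q n) >= a gives a (a - t^2 Psi) <= Psi M / (2n),
   which fails for large [n]. *)
pose c := (a - t ^+ 2 * Psi) * a; have c0 : 0 < c by rewrite mulr_gt0 ?subr_gt0.
pose X := Psi * M / c; have X0 : 0 <= X by exact: divr_ge0 (mulr_ge0 Psi0 (ltW M0)) (ltW c0).
have [n nX] : exists n : nat, X < n%:R by exists (Num.bound X); apply: archi_boundP.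
have n0 : 0 < n%:R :> R by apply: le_lt_trans nX.
have h : Psi * (M / (n * 2)%:R) < c.
  rewrite mulrA natrM ltr_pdivrMr ?mulr_gt0 //; move: nX; rewrite ltr_pdivrMr //.
  move: (Psi * M) => u; nra.
have ab := aQ n; have := key n; rewrite -(ltr0n R) => /(_ n0).
rewrite mulrDr; move: h ab; move: (Psi * (M / _)) => e ec ab hb.
have tP : 0 <= t ^+ 2 * Psi by rewrite mulr_ge0 ?sqr_ge0.
have := ltW ta; move: hb tP ec; rewrite /c; move: (t ^+ 2) (Lam _) ab => u b ab hb tP ec ua.
nra.
Qed.

End MomentBound.

(** The measure is known only through its moments, so it meets the resolvent through test
    polynomials: Cauchy-Schwarz on a truncated tree gives the bound Re (i t G) for each t =
    [tk R k], and then t tends to 0. *)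
Lemma matching_atom_le (R : realType) (g : lgraph) (D : nat) (nb : nat -> seq nat)
    (nu : probability R R) (o : nat) (theta : R) :
  good_graph D g nb -> lV g o -> (forall i j, ladj g i j = adj g i j) ->
  matching_measure g o nu -> fine (nu [set theta]) <= atom g theta [::] o.
Proof.
move=> gG go ladjE nuE.
pose m k : R := (cw nb k o k [:: o])%:R.
(* Walk counts do not depend on the truncation depth once it is at least the length, so one depth
   can be chosen large enough for all the polynomials involved. *)
have cwE k L : (k <= L)%N -> (cw nb L o k [:: o])%:R = m k.
  move=> kL; have := counting_closed_walks R gG go ladjE kL.
  by rewrite (counting_closed_walks R gG go ladjE (leqnn k)) => -[<-].
have mE k : (\int[nu]_x ((x ^+ k)%:E))%E = (m k)%:E.
  by rewrite nuE (counting_closed_walks R gG go ladjE (leqnn k)).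
have mC k : m k <= D.+1%:R ^+ k.
  by rewrite /m -natrX ler_nat; apply: (cw_le gG); apply: (root_B gG).
suff h k : fine (nu [set theta]) <= complex.Re (fk g theta [::] o k).
  by rewrite atomE; apply: limr_ge; [apply/cvg_ex; exists (atom g theta [::] o); apply: (Re_fk_cvg gG)|apply: nearW].
have t0 := tk_gt0 R k; have im := gg_Im gG (z := zt theta (tk R k)) t0 go (isT : o \notin [::]).
have -> : complex.Re (fk g theta [::] o k) =
    tk R k ^+ 2 * (- complex.Im (gg g (zt theta (tk R k)) [::] o) / tk R k).
  by rewrite Re_fk expr2 -mulrA; congr (_ * _); rewrite mulrC divfK // gt_eqF.
apply: (moment_atom mE _ mC) => // [|Q].
  by apply: divr_ge0; rewrite ?oppr_ge0 ltW.
set H := _ * Q * _; pose L := maxn (size Q) (maxn (size (Q * Q)) (size H)).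
have vE (S : {poly R}) : (size S <= L)%N -> vec nb L o S [:: o] = \sum_(i < size S) S`_i * m i.
  by move=> sS; apply: eq_bigr => i _; rewrite cwE // (leq_trans _ sS) // ltnW.
rewrite -!vE ?leq_max ?leqnn ?orbT //.
by apply: (vec_resolvent gG go theta t0); rewrite leq_max leqnn.
Qed.

(** * Invariance under isomorphism *)

Definition nbr (g : lgraph) (u : nat) : seq nat := enum_fset (fset_set [set v | adj g u v]).
Definition goodg (D : nat) (g : lgraph) : Prop := good_graph D g (nbr g).

(** A form without the enumeration [nbr]: its conditions on finite lists are the ones that
    isomorphisms transport and that are seen to be measurable. *)
Lemma goodgP D g : goodg D g <-> [/\ forall u v, adj g u v = adj g v u,
  forall u, ~~ adj g u u & forall u (s : seq nat), uniq s -> all (adj g u) s -> (size s <= D)%N].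
Proof.
split=> [gG|[as_ ai ab]].
  split; [exact: adj_sym gG|by move=> u; rewrite (adj_irr gG)|move=> u s us sa].
  apply: (@leq_trans (size (nbr g u))); last exact: nb_size gG u.
  by apply: uniq_leq_size => // v vs; rewrite (nbE gG); exact: (allP sa).
have fin u : finite_set [set v | adj g u v].
  apply: contrapT => /(@infinite_set_fset _ _ D.+1)[B Bs].
  rewrite ltnNge => /negP; apply; apply: (ab u); first exact: fset_uniq.
  by apply/allP => v vB; apply: Bs.
have nE u v : (v \in nbr g u) = adj g u v.
  by rewrite [LHS]in_fset_set // mem_setE.
split=> // [u|u|u]; first exact: negbTE.
  exact: fset_uniq.
by apply: (ab u); [exact: fset_uniq|apply/allP => v; rewrite nE].
Qed.

Lemma graph_iso_inv g1 g2 phi : graph_iso g1 g2 phi ->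
  exists psi, [/\ graph_iso g2 g1 psi, forall i, lV g1 i -> psi (phi i) = i
    & forall j, lV g2 j -> phi (psi j) = j].
Proof.
move=> [pV [pI [pS pE]]].
have /choice[psi hpsi] : forall j, exists i, lV g2 j -> lV g1 i /\ phi i = j.
  move=> j; have [gj|gj] := boolP (lV g2 j); last by exists 0%N.
  by have [i gi ij] := pS j gj; exists i.
have psiK j : lV g2 j -> phi (psi j) = j by move=> /hpsi[].
have psiV j : lV g2 j -> lV g1 (psi j) by move=> /hpsi[].
have phiK i : lV g1 i -> psi (phi i) = i.
  by move=> gi; apply: (pI (psi (phi i)) i (psiV _ (pV _ gi)) gi (psiK _ (pV _ gi))).
exists psi; split=> //; split=> //; split; first by move=> i j gi gj e; rewrite -(psiK i) // e psiK.
split=> [i gi|i j gi gj]; first by exists (phi i); [exact: pV|exact: phiK].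
by rewrite -pE ?psiV // !psiK.
Qed.

Section Iso.
Variables (g1 g2 : lgraph) (phi : nat -> nat).
Hypothesis iso : graph_iso g1 g2 phi.

Let pV i : lV g1 i -> lV g2 (phi i). Proof. by case: iso => + _; apply. Qed.

Lemma iso_adj i j : lV g1 i -> lV g1 j -> adj g2 (phi i) (phi j) = adj g1 i j.
Proof. by move=> gi gj; rewrite /adj !pV // gi gj /=; case: iso => _ [_ [_ ->]]. Qed.

Lemma iso_goodg D : goodg D g1 -> goodg D g2.
Proof.
have [psi [iso' phiK psiK]] := graph_iso_inv iso.
have adjE u v : lV g2 u -> lV g2 v -> adj g2 u v = adj g1 (psi u) (psi v).
  by move=> gu gv; rewrite -{1}(psiK u gu) -{1}(psiK v gv) iso_adj //; case: iso' => + _; apply.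
have vV u v : adj g2 u v -> lV g2 u /\ lV g2 v by move=> /and3P[].
move=> /goodgP[a1 a2 a3]; apply/goodgP; split.
- move=> u v; case: (boolP (lV g2 u)) => gu; last by rewrite /adj (negPf gu) andbF.
  case: (boolP (lV g2 v)) => gv; last by rewrite /adj (negPf gv) andbF.
  by rewrite !adjE.
- move=> u; case: (boolP (lV g2 u)) => gu; last by rewrite /adj (negPf gu).
  by rewrite adjE.
- move=> u s us sa; rewrite -(size_map psi).
  have sV v : v \in s -> adj g2 u v by move/allP: sa; apply.
  apply: (a3 (psi u)).
    rewrite map_inj_in_uniq // => x y xs ys e.
    by rewrite -(psiK x) ?e ?psiK //; [case: (vV _ _ (sV y ys))|case: (vV _ _ (sV x xs))].
  apply/allP => _ /mapP[v vs ->]; have h := sV _ vs.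
  by have [gu gv] := vV _ _ h; rewrite -adjE.
Qed.

Let phi_inj (s : seq nat) : {subset s <= lV g1} -> {in s &, injective phi}.
Proof. by move=> sV x y /sV gx /sV gy; case: iso => _ [h _]; apply: h. Qed.

Lemma iso_exhausts F : exhausts g1 F -> exhausts g2 (fun n => [seq phi i | i <- F n]).
Proof.
move=> [uF sF eF]; split.
- by move=> n; rewrite map_inj_in_uniq //; exact: phi_inj (sF n).
- by move=> n _ /mapP[i iF ->]; apply: pV; apply: sF iF.
- move=> v gv; have [i gi <-] : exists2 i, lV g1 i & phi i = v by case: iso => _ [_ [+ _]]; apply.
  by have := eF i gi; apply: filterS => n; apply: map_f.
Qed.

Lemma iso_ratio (R : realType) (z : R[i]) F T : {subset F <= lV g1} -> {subset T <= lV g1} ->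
  ratio g2 z [seq phi i | i <- F] [seq phi i | i <- T] = ratio g1 z F T.
Proof.
move=> sF; have h S : {subset S <= lV g1} ->
    muC (fun=> z) (ew R g2) [seq phi i | i <- F] [seq phi i | i <- S] =
    muC (fun=> z) (ew R g1) F S.
  move=> sS; rewrite /muC /muD filter_map.
  have -> : [seq x <- F | preim phi (fun v => v \notin [seq phi i | i <- S]) x] =
            [seq x <- F | x \notin S].
    apply: eq_in_filter => x xF /=; congr (~~ _); apply/mapP/idP => [[y yS e]|xS]; last by exists x.
    suff -> : x = y by [].
    by apply: (phi_inj (s := F ++ S)); rewrite ?mem_cat ?xF ?yS ?orbT // => w; rewrite mem_cat => /orP[/sF|/sS].
  have sub w : w \in [seq x <- F | x \notin S] -> lV g1 w.
    by rewrite mem_filter => /andP[_ /sF].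
  rewrite mu_map; last exact: phi_inj.
  by apply: eq_mu => // u v /sub gu /sub gv; rewrite /ew iso_adj.
by move=> sT; rewrite /ratio h // -(h [::]).
Qed.

Variable D : nat.
Hypothesis gG : goodg D g1.
Let gG2 := iso_goodg gG.

(** The windows of [g1] are mapped to an exhaustion of [g2] that need not consist of windows;
    independence of the exhaustion gives the equality. *)
Lemma iso_rr (R : realType) (z : R[i]) T : 0 < complex.Im z -> {subset T <= lV g1} ->
  rr g2 z [seq phi i | i <- T] = rr g1 z T.
Proof.
move=> z0 sT; have hw := window_exhausts g1.
apply: (ccvg_unique (rr_cvg gG2 z0 [seq phi i | i <- T] (iso_exhausts hw))).
apply: ccvg_near (rr_cvg gG z0 T hw); apply: nearW => n.
by rewrite iso_ratio //; case: hw.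
Qed.

Variables (R : realType) (theta : R).

Lemma iso_atom T u : {subset T <= lV g1} -> lV g1 u ->
  atom g2 theta [seq phi i | i <- T] (phi u) = atom g1 theta T u.
Proof.
move=> sT gu; rewrite !atomE; congr (lim (_ @ \oo)); apply/funext => k.
have z0 : 0 < complex.Im (zt theta (tk R k)) by exact: (tk_gt0 R k).
rewrite /fk /gg -map_cons !iso_rr // => w; rewrite inE => /predU1P[-> //|]; exact: sT.
Qed.

Lemma iso_ess u : lV g1 u -> ess g2 theta (phi u) = ess g1 theta u.
Proof.
move=> gu; have s0 : {subset [::] <= lV g1} by [].
by rewrite /ess (pV gu) gu -(iso_atom s0 gu).
Qed.

Lemma iso_nbr u : lV g1 u -> perm_eq (nbr g2 (phi u)) [seq phi i | i <- nbr g1 u].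
Proof.
move=> gu; have nV : {subset nbr g1 u <= lV g1} by move=> v; rewrite (nbE gG) => /and3P[].
apply: uniq_perm; rewrite ?(nb_uniq gG2) ?map_inj_in_uniq ?(nb_uniq gG) //; first exact: phi_inj.
move=> v; rewrite (nbE gG2); apply/idP/mapP => [|[w wn ->]].
  move=> /[dup] /and3P[_ gv _]; have [i gi <-] : exists2 i, lV g1 i & phi i = v by case: iso => _ [_ [+ _]]; apply.
  by rewrite iso_adj // => h; exists i; rewrite ?(nbE gG).
by have gw := nV _ wn; rewrite iso_adj -?(nbE gG).
Qed.

Lemma iso_special u : lV g1 u -> special g2 (nbr g2) theta (phi u) = special g1 (nbr g1) theta u.
Proof.
move=> gu; have -> : special g1 (nbr g1) theta u =
    [&& lV g1 u, ~~ ess g1 theta u & has (fun v => ess g2 theta (phi v)) (nbr g1 u)].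
  rewrite /special; do 2!f_equal; apply: eq_in_has => v.
  by rewrite (nbE gG) => /and3P[_ gv _]; rewrite iso_ess.
by rewrite /special (pV gu) gu (iso_ess gu) (perm_has _ (iso_nbr gu)) has_map.
Qed.

Lemma iso_share a v : lV g1 a -> lV g1 v ->
  share g2 (nbr g2) theta (phi a) (phi v) = share g1 (nbr g1) theta a v.
Proof.
move=> ga gv; have sa : {subset [:: a] <= lV g1} by move=> x; rewrite inE => /eqP ->.
have h w : lV g1 w -> atom g2 theta [:: phi a] (phi w) = atom g1 theta [:: a] w.
  by move=> gw; rewrite -(iso_atom sa gw).
rewrite /share h // (perm_big _ (iso_nbr ga)) big_map; congr (_ / _).
rewrite big_seq [RHS]big_seq; apply: eq_bigr => w; rewrite (nbE gG) => /and3P[_ gw _]; exact: h.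
Qed.

Lemma iso_load u : lV g1 u -> load g2 (nbr g2) theta (phi u) = load g1 (nbr g1) theta u.
Proof.
move=> gu; have e0 : atom g2 theta [::] (phi u) = atom g1 theta [::] u.
  have s0 : {subset [::] <= lV g1} by [].
  by rewrite -(iso_atom s0 gu).
rewrite /load e0 (perm_big _ (iso_nbr gu)) big_map; f_equal.
rewrite big_seq_cond [RHS]big_seq_cond.
apply: eq_big => [v|v /andP[+ _]].
  by case: (boolP (v \in _)) => //=; rewrite (nbE gG) => /and3P[_ gv _]; rewrite iso_special.
by rewrite (nbE gG) => /and3P[_ gv _]; rewrite iso_share.
Qed.

End Iso.

(** * Clusters of essential vertices *)

Section Clusters.
Variables (R : realType) (g : lgraph) (theta : R).

(** Essentiality of [u] is included, so the cluster of an inessential vertex is empty. *)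
Definition linked (u v : nat) : Prop :=
  ess g theta u /\ exists p, [/\ path (adj g) u p, all (ess g theta) p & last u p = v].
Definition cluster (u : nat) : set nat := [set v | linked u v].
(** An infinite cluster gets the default value 0 of [fset_set], so sizes are always read together
    with finiteness. *)
Definition cluster_size (u : nat) : nat := #|` fset_set (cluster u)|.
Definition frontier (u v : nat) : Prop :=
  lV g v /\ ~ linked u v /\ exists w, linked u w /\ adj g w v.

Lemma linked_refl u : ess g theta u -> linked u u.
Proof. by move=> eu; split => //; exists [::]. Qed.

Lemma linked_ess u v : linked u v -> ess g theta v.
Proof.
move=> [eu [p [_ ep <-]]]; have /allP := ep; have := mem_last u p.
by rewrite inE => /predU1P[-> _ //|lp]; apply.
Qed.

Lemma linked_trans u v w : linked u v -> linked v w -> linked u w.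
Proof.
move=> [eu [p [pp ep <-]]] [_ [q [pq eq <-]]]; split => //; exists (p ++ q).
by rewrite cat_path all_cat last_cat pp pq ep eq.
Qed.

Lemma linked_step u v w : linked u v -> adj g v w -> ess g theta w -> linked u w.
Proof.
move=> uv vw ew; apply: (linked_trans uv); split; first exact: linked_ess uv.
by exists [:: w]; rewrite /= vw ew.
Qed.

Variables (D : nat) (gG : goodg D g).

Lemma linked_sym u v : linked u v -> linked v u.
Proof.
move=> uv; split; first exact: linked_ess uv.
case: uv => eu [p [pp ep lp]]; exists (rev (belast u p)).
rewrite -lp rev_path; split.
- by rewrite (eq_path (e' := adj g)) // => x y; rewrite (adj_sym gG).
- rewrite all_rev; apply/allP => x xb.
  have : x \in u :: p by rewrite lastI mem_rcons inE xb orbT.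
  by rewrite inE => /predU1P[-> //|]; apply/allP.
- by case: (p) => //= y q; rewrite rev_cons last_rcons.
Qed.

Lemma cluster_eq u v : linked u v -> cluster v = cluster u.
Proof.
move=> uv; apply/seteqP; split=> w; first exact: linked_trans.
by apply: linked_trans; apply: linked_sym.
Qed.

Lemma frontier_special u v : frontier u v -> special g (nbr g) theta v.
Proof.
move=> [gv [nuv [w [uw wv]]]]; rewrite /special gv /=; apply/andP; split.
  by apply/negP => ev; apply: nuv; exact: linked_step uw wv ev.
by apply/hasP; exists w; [rewrite (nbE gG) (adj_sym gG)|exact: linked_ess uw].
Qed.

Lemma cluster_seq u : finite_set (cluster u) -> exists s : seq nat,
  [/\ uniq s, size s = cluster_size u & forall v, v \in s <-> linked u v].
Proof.
move=> fu; exists (enum_fset (fset_set (cluster u))); split => //; first exact: fset_uniq.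
by move=> v; rewrite in_fset_set // inE.
Qed.

End Clusters.

Section IsoClusters.
Variables (R : realType) (theta : R) (D : nat).

Let iso_linked1 g1 g2 phi u v : graph_iso g1 g2 phi -> goodg D g1 -> linked g1 theta u v ->
  linked g2 theta (phi u) (phi v).
Proof.
move=> iso gG [eu [p [pp ep <-]]].
have essV w : ess g1 theta w -> lV g1 w by case/andP.
split; first by rewrite (iso_ess iso gG) ?essV.
exists [seq phi i | i <- p]; rewrite last_map; split => //.
  rewrite path_map; apply: sub_path pp => x y; rewrite /relpre /= => xy.
  by rewrite (iso_adj iso) //; case/and3P: xy.
rewrite all_map; apply/allP => w wp /=; have ew := allP ep _ wp.
by rewrite (iso_ess iso gG) ?essV.
Qed.

Variables (g1 g2 : lgraph) (phi : nat -> nat).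
Hypotheses (iso : graph_iso g1 g2 phi) (gG : goodg D g1).

Lemma iso_linked u v : lV g1 u -> lV g1 v ->
  linked g2 theta (phi u) (phi v) <-> linked g1 theta u v.
Proof.
move=> gu gv; have [psi [iso' phiK psiK]] := graph_iso_inv iso.
split; last exact: iso_linked1.
by move=> /(iso_linked1 iso' (iso_goodg iso gG)); rewrite !phiK.
Qed.

Lemma iso_cluster u : lV g1 u -> cluster g2 theta (phi u) = phi @` cluster g1 theta u.
Proof.
move=> gu; have essV g w : ess g theta w -> lV g w by case/andP.
apply/seteqP; split=> [v /= lv|_ [v lv <-]]; last exact: iso_linked1 lv.
have [i gi e] : exists2 i, lV g1 i & phi i = v.
  by case: iso => _ [_ [+ _]]; apply; exact: essV (linked_ess lv).
by exists i => //=; apply/iso_linked => //; rewrite e.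
Qed.

Lemma iso_cluster_finite u : lV g1 u ->
  finite_set (cluster g2 theta (phi u)) <-> finite_set (cluster g1 theta u).
Proof.
move=> gu; rewrite iso_cluster //; split=> [fin|]; last exact: finite_image.
have [psi [_ phiK _]] := graph_iso_inv iso.
rewrite (_ : cluster _ _ _ = psi @` (phi @` cluster g1 theta u)); first exact: finite_image.
have e v : linked g1 theta u v -> psi (phi v) = v.
  by move=> lv; apply: phiK; case/andP: (linked_ess lv).
apply/seteqP; split=> [v lv|_ [_ [v lv <-] <-]]; last by rewrite e.
by exists (phi v); [exists v|exact: e].
Qed.

Lemma iso_cluster_size u : lV g1 u -> cluster_size g2 theta (phi u) = cluster_size g1 theta u.
Proof.
move=> gu; have [fin|nfin] := pselect (finite_set (cluster g1 theta u)); last first.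
  rewrite /cluster_size /fset_set; case: pselect => [/(iso_cluster_finite gu)//|_].
  by case: pselect.
have [s1 [u1 <- h1]] := cluster_seq fin.
have [s2 [u2 <- h2]] := cluster_seq ((iso_cluster_finite gu).2 fin).
have sV v : v \in s1 -> lV g1 v by move=> /h1 /linked_ess /andP[].
rewrite -(size_map phi s1); apply/perm_size/uniq_perm => //.
  by rewrite map_inj_in_uniq // => x y /sV gx /sV gy; case: iso => _ [h _]; apply: h.
move=> v; apply/idP/mapP => [/h2|[w ws ->]].
  rewrite -[linked _ _ _ _]/(cluster g2 theta (phi u) v) iso_cluster // => -[w lw <-].
  by exists w => //; apply/h1.
by apply/h2/iso_linked => //; [exact: sV|exact/h1].
Qed.

Lemma iso_frontier u v : lV g1 u -> lV g1 v ->
  frontier g2 theta (phi u) (phi v) <-> frontier g1 theta u v.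
Proof.
move=> gu gv; rewrite /frontier iso_linked //.
have gv2 : lV g2 (phi v) by case: iso => + _; apply.
split=> -[_ [nl [w [lw wv]]]]; do 2!split => //.
  have : cluster g2 theta (phi u) w by [].
  rewrite iso_cluster // => -[x lx e]; exists x; split => //.
  by rewrite -(iso_adj iso) ?e //; case/andP: (linked_ess lx).
exists (phi w); have gw : lV g1 w by case/andP: (linked_ess lw).
by split; [apply/iso_linked|rewrite (iso_adj iso)].
Qed.

End IsoClusters.

(** * Measurability *)

Lemma countable_exists_measurable d (X : measurableType d) (I : countType) (A : I -> X -> Prop) :
  (forall i, measurable [set x | A i x]) -> measurable [set x | exists i, A i x].
Proof.
move=> mA; rewrite (_ : [set x | _] = \bigcup_i [set x | A i x]); last first.
  by apply/seteqP; split=> x [n] *; exists n.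
by apply: countable_bigcupT_measurable => //; exact: countableP.
Qed.

Lemma countable_forall_measurable d (X : measurableType d) (I : countType) (A : I -> X -> Prop) :
  (forall i, measurable [set x | A i x]) -> measurable [set x | forall i, A i x].
Proof.
move=> mA; rewrite (_ : [set x | _] = ~` [set x | exists i, ~ A i x]); last first.
  by apply/seteqP; split=> x /=; [move=> h [n]; apply; exact: h|move/forallNP => h i; apply: contrapT].
by apply: measurableC; apply: countable_exists_measurable => n; exact: measurableC (mA n).
Qed.

(** Splitting along the first bit, [A] agrees on each side with a set that depends on the remaining
    bits only. This covers arbitrary functions of a finite part of the graph. *)
Lemma finite_bits_measurable d (X : measurableType d) (I : eqType) (r : seq I)
    (b : I -> set X) (A : set X) :
  (forall i, measurable (b i)) ->
  (forall x y, (forall i, i \in r -> b i x <-> b i y) -> A x -> A y) -> measurable A.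
Proof.
move=> mb; elim: r A => [|i r IH] A hA.
  have [->|/set0P[x Ax]] := eqVneq A set0; first exact: measurable0.
  suff -> : A = setT by exact: measurableT.
  by apply/seteqP; split=> // y _; apply: hA Ax.
pose agree x y := forall i, i \in r -> b i x <-> b i y.
have mm (B : X -> Prop) : measurable [set x | exists y, [/\ B y, agree y x & A y]].
  apply: IH => x y xy [z [Bz zx Az]]; exists z; split => // j jr.
  by apply: (iff_trans (zx j jr)); apply: xy.
have -> : A = (b i `&` [set x | exists y, [/\ b i y, agree y x & A y]]) `|`
    (~` b i `&` [set x | exists y, [/\ ~ b i y, agree y x & A y]]).
  apply/seteqP; split=> [x Ax|x [[bx [y [yb yx Ay]]]|[bx [y [yb yx Ay]]]]].
  - by have [bx|bx] := pselect (b i x); [left|right]; split => //; exists x; split.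
  - by apply: hA Ay => j; rewrite inE => /predU1P[->|/yx].
  - by apply: hA Ay => j; rewrite inE => /predU1P[->|/yx].
by apply: measurableU; apply: measurableI => //; apply: measurableC.
Qed.

Section MeasurableGraph.
Variables (d : measure_display) (X : measurableType d) (G : X -> lgraph).
Hypotheses (mV : forall i, measurable [set x | lV (G x) i])
           (mE : forall i j, measurable [set x | ladj (G x) i j]).

Lemma adj_measurable i j : measurable [set x | adj (G x) i j].
Proof.
rewrite (_ : [set x | _] = [set x | lV (G x) i] `&` ([set x | lV (G x) j] `&` [set x | ladj (G x) i j])).
  by do 2?apply: measurableI.
by apply/seteqP; split => x /=; [move=> /and3P[]|move=> [? [? ?]]; apply/and3P].
Qed.

Lemma good_measurable D : measurable [set x | goodg D (G x)].
Proof.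
rewrite (_ : [set x | _] = [set x | forall u v, adj (G x) u v -> adj (G x) v u] `&`
  ([set x | forall u, ~ adj (G x) u u] `&` [set x | forall (us : nat * seq nat),
     uniq us.2 -> ~ (size us.2 <= D)%N -> exists v, v \in us.2 /\ ~ adj (G x) us.1 v])); last first.
  apply/seteqP; split=> x /=.
    move=> /goodgP[a1 a2 a3]; split; first by move=> u v; rewrite a1.
    split; first by move=> u; apply/negP.
    move=> [u s] /= us ss; apply: contrapT => h; apply: ss; apply: (a3 u) us _.
    by apply/allP => v vs; apply: contrapT => nv; apply: h; exists v; split.
  case=> [a1 [a2 a3]]; apply/goodgP; split.
  - by move=> u v; apply/idP/idP; apply: a1.
  - by move=> u; apply/negP.
  - move=> u s us sa; apply: contrapT => ss; have [v [vs]] := a3 (u, s) us ss; apply.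
    by move/allP: sa; apply.
have imp (P Q : X -> Prop) : measurable [set x | P x] -> measurable [set x | Q x] ->
    measurable [set x | P x -> Q x].
  move=> mP mQ; rewrite (_ : [set x | _] = ~` [set x | P x] `|` [set x | Q x]).
    by apply: measurableU => //; apply: measurableC.
  apply/seteqP; split=> x /=; last by move=> [?|? ?].
  by have [Px|] := pselect (P x) => h; [right; apply: h|left].
apply: measurableI; last apply: measurableI.
- do 2!(apply: countable_forall_measurable => ?); apply: imp; exact: adj_measurable.
- by apply: countable_forall_measurable => u; apply: measurableC; apply: adj_measurable.
- apply: countable_forall_measurable => -[u s] /=.
  have cst (P : Prop) : measurable [set x : X | P].
    by have [p|p] := pselect P; [rewrite (_ : mkset _ = setT)|rewrite (_ : mkset _ = set0)] => //;
      apply/seteqP; split.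
  do 2!(apply: (imp _ _) => //); apply: countable_exists_measurable => v; apply: measurableI; first exact: cst.
  by apply: measurableC; apply: adj_measurable.
Qed.

Lemma local_measurable (n : nat) (A : lgraph -> Prop) :
  (forall g1 g2, (forall i, (i < n)%N -> lV g1 i = lV g2 i) ->
     (forall i j, (i < n)%N -> (j < n)%N -> ladj g1 i j = ladj g2 i j) -> A g1 -> A g2) ->
  measurable [set x | A (G x)].
Proof.
move=> hA; pose b (p : nat * nat + nat) : set X :=
  match p with inl p => [set x | ladj (G x) p.1 p.2] | inr i => [set x | lV (G x) i] end.
pose r : seq (nat * nat + nat) :=
  [seq inl (i, j) | i <- iota 0 n, j <- iota 0 n] ++ [seq inr i | i <- iota 0 n].
apply: (@finite_bits_measurable _ _ _ r b) => [[p|i]|x y h]; [exact: mE|exact: mV|].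
have eqb (b1 b2 : bool) : (b1 <-> b2) -> b1 = b2 by move=> e; apply/idP/idP; apply e.
apply: hA => [i lt|i j li lj]; apply: eqb.
  by apply: (h (inr i)); rewrite mem_cat orbC map_f // mem_iota.
apply: (h (inl (i, j))); rewrite mem_cat; apply/orP; left; apply/allpairsP.
by exists (i, j); rewrite /= !mem_iota.
Qed.

Lemma green_window_local (R : realType) (z : R[i]) n T u g1 g2 :
  (forall i, (i < n)%N -> lV g1 i = lV g2 i) ->
  (forall i j, (i < n)%N -> (j < n)%N -> ladj g1 i j = ladj g2 i j) ->
  green (fun=> z) (ew R g1) (window g1 n) T u = green (fun=> z) (ew R g2) (window g2 n) T u.
Proof.
move=> hV hE; have -> : window g1 n = window g2 n.
  by apply: eq_in_filter => v; rewrite mem_iota => /andP[_ vn]; apply: hV.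
have h S : muC (fun=> z) (ew R g1) (window g2 n) S = muC (fun=> z) (ew R g2) (window g2 n) S.
  have lt v : v \in [seq w <- window g2 n | w \notin S] -> (v < n)%N.
    by rewrite mem_filter => /andP[_]; rewrite mem_filter mem_iota => /andP[_ /andP[]].
  apply: eq_mu => // i j /lt li /lt lj; congr (_%:R%:C).
  by rewrite /adj !hV // hE.
by rewrite /green !h.
Qed.

Section Relative.
Variables (R : realType) (theta : R) (D : nat) (E : set X).
Hypotheses (measE : measurable E) (goodE : forall x, E x -> goodg D (G x)).

(** Measurability is relative to an event [E] of good graphs, where the limits defining atoms are
    known to exist. [E] is the whole space for the random graph and the set of good graphs on the
    bi-rooted space. *)
Let mp (A : X -> Prop) := measurable (E `&` [set x | A x]).
Let mf (f : X -> R) := measurable_fun E f.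

Lemma rel_meas A : measurable [set x | A x] -> mp A.
Proof. exact: measurableI. Qed.

Lemma rel_eq A B : (forall x, E x -> A x <-> B x) -> mp A -> mp B.
Proof.
move=> h; rewrite /mp (_ : _ `&` _ = E `&` [set x | B x]) //.
by apply/seteqP; split=> x [Ex] /(h x Ex).
Qed.

Lemma rel_not A : mp A -> mp (fun x => ~ A x).
Proof.
move=> mA; rewrite /mp (_ : _ `&` _ = E `\` (E `&` [set x | A x])); first exact: measurableD.
by apply/seteqP; split=> x [Ex h]; split => // a; [apply: h; case: a|apply: h].
Qed.

Lemma rel_and A B : mp A -> mp B -> mp (fun x => A x /\ B x).
Proof.
move=> mA mB; rewrite /mp (_ : _ `&` _ = (E `&` [set x | A x]) `&` (E `&` [set x | B x])).
  exact: measurableI.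
by apply/seteqP; split=> x; [case=> ? []|case=> -[? ?] []].
Qed.

Lemma rel_exists (I : countType) (A : I -> X -> Prop) :
  (forall i, mp (A i)) -> mp (fun x => exists i, A i x).
Proof.
move=> mA; rewrite /mp (_ : _ `&` _ = [set x | exists i, E x /\ A i x]).
  exact: countable_exists_measurable.
by apply/seteqP; split=> x; [case=> Ex [n An]; exists n|case=> n [Ex An]; split => //; exists n].
Qed.

Lemma rel_forall (I : countType) (A : I -> X -> Prop) :
  (forall i, mp (A i)) -> mp (fun x => forall i, A i x).
Proof.
move=> mA; have := rel_not (rel_exists (fun n => rel_not (mA n))).
apply: rel_eq => x Ex; split=> [h n|h [n]]; last by apply.
by apply: contrapT => nA; apply: h; exists n.
Qed.

Lemma rel_imp A B : mp A -> mp B -> mp (fun x => A x -> B x).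
Proof.
move=> mA mB; have := rel_not (rel_and mA (rel_not mB)); apply: rel_eq => x _.
by split=> [h a|h [a]]; [apply: contrapT => b; apply: h|apply; apply: h].
Qed.

Lemma rel_adj i j : mp (fun x => adj (G x) i j).
Proof. by apply: rel_meas; apply: adj_measurable. Qed.

Lemma rel_cst (P : Prop) : mp (fun=> P).
Proof.
apply: rel_meas; have [p|p] := pselect P.
  by rewrite (_ : mkset _ = setT) //; apply/seteqP; split.
by rewrite (_ : mkset _ = set0) //; apply/seteqP; split.
Qed.

Lemma rel_gt0 f : mf f -> mp (fun x => 0 < f x).
Proof.
move=> /(_ measE `]0, +oo[%classic (measurable_itv _)).
by rewrite /mp (_ : f @^-1` _ = [set x | 0 < f x]) //; apply/seteqP; split=> x /=; rewrite in_itv /= andbT.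
Qed.

Lemma rel_indicator A : mp A -> mf (fun x => (`[< A x >])%:R).
Proof.
move=> mA; apply: (eq_measurable_fun (\1_(E `&` [set x | A x]) : X -> R)).
  move=> x; rewrite inE => Ex; rewrite indicE; congr (nat_of_bool _)%:R.
  by apply/idP/asboolP => [|Ax]; rewrite inE; [case|split].
exact: measurable_indic.
Qed.

(** An iterated limit, in the volume and then in t, of functions that depend on finitely many bits
    of the labelled graph. *)
Lemma rel_atom T u : mf (fun x => atom (G x) theta T u).
Proof.
pose z k := zt theta (tk R k).
have z0 k : 0 < complex.Im (z k) by exact: (tk_gt0 R k).
apply: (@measurable_fun_cvg _ _ _ E (fun k x => tk R k * - complex.Im (gg (G x) (z k) T u))).
  move=> k; apply: measurable_funM => //; apply: measurableT_comp => //.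
  apply: (@measurable_fun_cvg _ _ _ E
    (fun n x => complex.Im (green (fun=> z k) (ew R (G x)) (window (G x) n) T u))).
    move=> n; apply: measurable_funTS => _ B mB; rewrite setTI.
    apply: (@local_measurable n
      (fun g => B (complex.Im (green (fun=> z k) (ew R g) (window g n) T u)))) => g1 g2 hV hE.
    by rewrite (green_window_local (z k) T u hV hE).
  move=> x /goodE gG; have hw := window_exhausts (G x).
  have n0 := rr_neq0 gG (z0 k) T.
  suff : ccvg (fun n => green (fun=> z k) (ew R (G x)) (window (G x) n) T u) (gg (G x) (z k) T u).
    by case.
  have c1 := rr_cvg gG (z0 k) (u :: T) hw; have c2 := rr_cvg gG (z0 k) T hw.
  apply: ccvg_near (ccvgM c1 (ccvgV n0 c2)); apply: nearW => n; have [uF _ _] := hw.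
  have xz (v : nat) : 0 < complex.Im ((fun=> z k) v) by exact: z0.
  have nz (S : seq nat) := muC_neq0 (ew_sym R gG) (@ew_ge0 R (G x)) xz (uF n) S.
  by rewrite (ratio_green gG (z0 k)) // mulfK // mulf_neq0 ?invr_neq0 ?nz.
move=> x /goodE gG; have : complex.Re (fk (G x) theta T u k) @[k --> \oo] --> atom (G x) theta T u.
  exact: (Re_fk_cvg gG).
by under eq_fun do rewrite Re_fk.
Qed.

Lemma rel_lV u : mp (fun x => lV (G x) u).
Proof. exact: rel_meas. Qed.

Lemma rel_ess u : mp (fun x => ess (G x) theta u).
Proof.
have := rel_and (rel_lV u) (rel_gt0 (rel_atom [::] u)).
by apply: rel_eq => x _; rewrite /ess; split => [[]|/andP[]] // ? ?; apply/andP.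
Qed.

Lemma rel_special u : mp (fun x => special (G x) (nbr (G x)) theta u).
Proof.
have h := rel_exists (fun v => rel_and (rel_adj u v) (rel_ess v)).
have := rel_and (rel_lV u) (rel_and (rel_not (rel_ess u)) h).
apply: rel_eq => x /goodE gG; rewrite /special; split.
  move=> [-> [/negP -> [v [a e]]]] /=; apply/hasP; exists v => //; by rewrite (nbE gG).
move=> /and3P[-> /negP e /hasP[v]]; rewrite (nbE gG) => a ev; do 2!split => //.
by exists v.
Qed.

(** At each point the sums over labels below [n], weighted by indicators, are eventually constant in
    [n]; their limit is the sum over the random finite set. *)
Lemma rel_sum (A : X -> set nat) (f : nat -> X -> R) : (forall i, mp (fun x => A x i)) ->
  (forall i, mf (f i)) -> (forall x, E x -> finite_set (A x)) ->
  mf (fun x => \sum_(v <- enum_fset (fset_set (A x))) f v x).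
Proof.
move=> mA mfi fA.
apply: (@measurable_fun_cvg _ _ _ E (fun n x => \sum_(i <- iota 0 n) (`[< A x i >])%:R * f i x)).
  move=> n; apply: measurable_sum => i; apply: measurable_funM; [exact: rel_indicator (mA i)|exact: mfi].
move=> x Ex; have fAx := fA x Ex; apply: cvg_near_cst.
pose s : seq nat := enum_fset (fset_set (A x)).
have sE v : (v \in s) = `[< A x v >] by rewrite [LHS]in_fset_set // mem_setE.
have us : uniq s by exact: fset_uniq.
exists (\max_(v <- s) v.+1)%N => // n /= ln.
rewrite (bigID (mem s)) /= [X in _ + X]big1 => [|v]; last first.
  by rewrite sE => /negbTE ->; rewrite mul0r.
have sp : perm_eq [seq v <- iota 0 n | v \in s] s.
  apply: uniq_perm => //; first by rewrite filter_uniq // iota_uniq.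
  move=> v; rewrite mem_filter mem_iota /= add0n andb_idr // => vs.
  by apply: leq_trans ln; apply: (leq_bigmax_seq (F := fun v => v.+1)).
rewrite addr0 -big_filter (perm_big _ sp) big_seq_cond [RHS]big_seq_cond.
by apply: eq_bigr => v; rewrite sE andbT => ->; rewrite mul1r.
Qed.

Lemma rel_nbr_finite x u : E x -> finite_set [set v | adj (G x) u v].
Proof.
move=> /goodE gG; rewrite (_ : mkset _ = [set` nbr (G x) u]); first exact: finite_seq.
by apply/seteqP; split=> v /=; rewrite (nbE gG).
Qed.

Lemma rel_share a v : mf (fun x => share (G x) (nbr (G x)) theta a v).
Proof.
apply: measurable_funM; first exact: rel_atom.
have h : mf (fun x => \sum_(y <- nbr (G x) a) atom (G x) theta [:: a] y).
  apply: (rel_sum (A := fun x => [set v | adj (G x) a v])) => [i|i|x Ex].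
  - exact: rel_adj.
  - exact: rel_atom.
  - exact: rel_nbr_finite.
(* The inverse is taken as the real power -1, with which it agrees because the sum is
   nonnegative. *)
have hV : mf (fun x => (\sum_(y <- nbr (G x) a) atom (G x) theta [:: a] y) `^ (-1)).
  exact: measurableT_comp (measurable_powR _) h.
apply: eq_measurable_fun hV => x; rewrite inE => /goodE gG; rewrite powR_inv1 // sumr_ge0 // => y _.
exact: (atom_ge0 gG).
Qed.

Lemma rel_load u : mf (fun x => load (G x) (nbr (G x)) theta u).
Proof.
apply: measurable_funD; first exact: rel_atom.
have h : mf (fun x => \sum_(a <- nbr (G x) u)
    (`[< special (G x) (nbr (G x)) theta a >])%:R * share (G x) (nbr (G x)) theta a u).
  apply: (rel_sum (A := fun x => [set v | adj (G x) u v])) => [i|i|x Ex].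
  - exact: rel_adj.
  - by apply: measurable_funM; [apply: rel_indicator; exact: rel_special|exact: rel_share].
  - exact: rel_nbr_finite.
apply: eq_measurable_fun h => x _; rewrite [RHS]big_mkcond; apply: eq_bigr => a _.
by rewrite asboolb; case: ifP; rewrite (mul1r, mul0r).
Qed.

Lemma rel_index_pred (u : X -> nat) (A : nat -> X -> Prop) : (forall i, mp (fun x => u x = i)) ->
  (forall i, mp (A i)) -> mp (fun x => A (u x) x).
Proof.
move=> mu mA; have := rel_exists (fun n => rel_and (mu n) (mA n)).
by apply: rel_eq => x _; split=> [[n [-> //]]|h]; exists (u x).
Qed.

Lemma rel_index (u : X -> nat) (f : nat -> X -> R) : (forall i, mp (fun x => u x = i)) ->
  (forall i, mf (f i)) -> mf (fun x => f (u x) x).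
Proof.
move=> mu mfi _ B mB.
by apply: (rel_index_pred (A := fun i x => B (f i x)) mu) => n; apply: (mfi n).
Qed.

Lemma rel_linked u v : mp (fun x => linked (G x) theta u v).
Proof.
apply: rel_and; first exact: rel_ess.
apply: rel_exists => p.
have h w : mp (fun x => [/\ path (adj (G x)) w p, all (ess (G x) theta) p & last w p = v]).
  elim: p w => [|y p IH] w /=.
    by apply: rel_eq (rel_cst (w = v)) => x _; split => [|[]].
  have := rel_and (rel_and (rel_adj w y) (rel_ess y)) (IH y); apply: rel_eq => x _.
  by split=> [[[-> ->] [-> ->]] //|[/andP[-> ->] /andP[-> ->]]].
exact: h.
Qed.

Lemma rel_cluster_finite u : mp (fun x => finite_set (cluster (G x) theta u)).
Proof.
have := rel_exists (fun n => rel_forall (fun v => rel_imp (rel_linked u v) (rel_cst (v < n)%N))).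
apply: rel_eq => x _; split=> [[n hn]|/finite_seqP[s hs]].
  by apply: (sub_finite_set (B := `I_n)) => // v; exact: hn.
exists (\max_(v <- s) v.+1)%N => v lv.
have vs : v \in s by have : [set` s] v by rewrite -hs.
exact: (leq_bigmax_seq (F := fun v => v.+1)).
Qed.

Lemma rel_cluster_size u k : mp (fun x => cluster_size (G x) theta u = k).
Proof.
have h := rel_exists (fun s : seq nat => rel_and (rel_cst (uniq s /\ size s = k))
  (rel_forall (fun v => rel_and (rel_imp (rel_cst (v \in s)) (rel_linked u v))
                                (rel_imp (rel_linked u v) (rel_cst (v \in s)))))).
have := rel_and (rel_imp (rel_cluster_finite u) h)
  (rel_imp (rel_not (rel_cluster_finite u)) (rel_cst (0%N = k))).
apply: rel_eq => x _; rewrite /cluster_size; split=> [[h1 h2]|e].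
  have [fx|fx] := pselect (finite_set (cluster (G x) theta u)); last first.
    by rewrite -(h2 fx) /fset_set; case: pselect.
  have [s [[us <-] hs]] := h1 fx; apply/perm_size/uniq_perm => // v.
  rewrite in_fset_set //; apply/idP/idP; first by rewrite inE => /(hs v).2.
  by move=> /(hs v).1; rewrite inE.
split=> fx; last by rewrite -e /fset_set; case: pselect.
exists (enum_fset (fset_set (cluster (G x) theta u))); split; first by split; first exact: fset_uniq.
move=> v; rewrite in_fset_set //; split; first by rewrite inE.
by move=> lv; rewrite inE.
Qed.

Lemma rel_frontier u v : mp (fun x => frontier (G x) theta u v).
Proof.
apply: rel_and; first exact: rel_lV.
apply: rel_and; first exact: rel_not (rel_linked u v).
by apply: rel_exists => w; apply: rel_and; [exact: rel_linked|exact: rel_adj].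
Qed.

End Relative.

End MeasurableGraph.

(** * The space of bi-rooted graphs and the transport functions *)

HB.instance Definition _ := gen_eqMixin lgraph.
HB.instance Definition _ := gen_choiceMixin lgraph.
HB.instance Definition _ := isPointed.Build lgraph (LGraph xpred0 (fun _ _ => false)).

Definition bigraph_space := g_sigma_algebraType bigraph_cyl.
HB.instance Definition _ := Measurable.on bigraph_space.

Lemma bigraph_lV_measurable i : measurable [set x : bigraph_space | lV x.1.1 i].
Proof. by apply: sub_sigma_algebra; left; exists i. Qed.

Lemma bigraph_ladj_measurable i j : measurable [set x : bigraph_space | ladj x.1.1 i j].
Proof. by apply: sub_sigma_algebra; right; left; exists i, j. Qed.

Lemma bigraph_fst_measurable i : measurable [set x : bigraph_space | x.1.2 = i].
Proof. by apply: sub_sigma_algebra; right; right; left; exists i. Qed.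

Lemma bigraph_snd_measurable i : measurable [set x : bigraph_space | x.2 = i].
Proof. by apply: sub_sigma_algebra; right; right; right; exists i. Qed.

Section Sends.
Variables (R : realType) (D : nat).

(** Extended by 0 off good graphs, since transport functions live on all bi-rooted labelled graphs;
    goodness is measurable and invariant under isomorphism, so the extension is harmless. *)
Definition transport (F : lgraph -> nat -> nat -> R) (x : bigraph) : \bar R :=
  if `[< goodg D x.1.1 >] then (F x.1.1 x.1.2 x.2)%:E else 0%E.

Let good_space : set bigraph_space := [set x | goodg D x.1.1].

Let good_space_measurable : measurable good_space.
Proof. exact: good_measurable bigraph_lV_measurable bigraph_ladj_measurable D. Qed.

Lemma transport_transport_fun (F : lgraph -> nat -> nat -> R) :
  (forall g u v, goodg D g -> 0 <= F g u v) ->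
  (forall g1 g2 phi u v, graph_iso g1 g2 phi -> goodg D g1 -> lV g1 u -> lV g1 v ->
     F g2 (phi u) (phi v) = F g1 u v) ->
  (forall i j, measurable_fun good_space (fun x => F x.1.1 i j)) ->
  transport_fun (transport F).
Proof.
move=> F0 Fi Fm; split; first by move=> x; rewrite /transport; case: asboolP => [gG|//]; rewrite lee_fin; exact: F0.
split=> [B mB|g1 g2 phi u v iso gu gv].
  pose Fx (x : bigraph_space) := F x.1.1 x.1.2 x.2.
  have mF : measurable_fun good_space Fx.
    have m1 i : measurable (good_space `&` [set x | x.1.2 = i]).
      by apply: measurableI => //; exact: bigraph_fst_measurable.
    have m2 i : measurable (good_space `&` [set x | x.2 = i]).
      by apply: measurableI => //; exact: bigraph_snd_measurable.
    apply: (rel_index good_space_measurable (f := fun i x => F x.1.1 i x.2) m1) => i.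
    exact: (rel_index good_space_measurable (f := fun j x => F x.1.1 i j) m2).
  have -> : transport F @^-1` B = (good_space `&` (Fx @^-1` (EFin @^-1` B))) `|`
      (~` good_space `&` [set x | B 0%E]).
    apply/seteqP; split=> x; rewrite /transport /preimage /setU /= /setI /setC /=.
      by case: asboolP => gx Bx; [left|right].
    by case: asboolP => gx [[? ?]|[? ?]].
  have mc : measurable [set x : bigraph_space | B 0%E].
    have [p|p] := pselect (B 0%E).
      by rewrite (_ : mkset _ = setT) //; apply/seteqP; split.
    by rewrite (_ : mkset _ = set0) //; apply/seteqP; split.
  suff : measurable ((good_space `&` (Fx @^-1` (EFin @^-1` B))) `|`
      (~` good_space `&` [set x | B 0%E])) by [].
  apply: measurableU; last by apply: measurableI => //; apply: measurableC.
  by apply: mF => //; have := @EFin_measurable R setT measurableT _ mB; rewrite setTI.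
rewrite /transport /=; case: asboolP => g1G; case: asboolP => g2G //.
- by rewrite (Fi _ _ _ _ _ iso).
- by case: (g2G (iso_goodg iso g1G)).
- by have [psi [iso' _ _]] := graph_iso_inv iso; case: (g1G (iso_goodg iso' g2G)).
Qed.

Variable theta : R.

Definition send_share g u v : R :=
  (special g (nbr g) theta u && adj g u v)%:R * share g (nbr g) theta u v.

(** Every vertex sends its load to each vertex of its cluster; [b] separates finite clusters from
    infinite ones. *)
Definition send_load (b : bool) g u v : R :=
  `[< linked g theta u v /\ `[< finite_set (cluster g theta u) >] = b >]%:R *
  load g (nbr g) theta u.

(** A vertex of a finite cluster K sends 1/|K| to each boundary vertex of K: it sends |boundary| /
    |K| in total, while K as a whole sends 1 to each boundary vertex. *)
Definition send_frontier g u v : R :=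
  `[< frontier g theta u v /\ finite_set (cluster g theta u) >]%:R *
  (cluster_size g theta u)%:R^-1.

Lemma send_share_transport : transport_fun (transport send_share).
Proof.
apply: transport_transport_fun.
- by move=> g u v gG; rewrite mulr_ge0 // (share_ge0 gG).
- move=> g1 g2 phi u v iso gG gu gv; rewrite /send_share.
  by rewrite (iso_special iso gG theta gu) (iso_adj iso gu gv) (iso_share iso gG theta gu gv).
- move=> i j; apply: measurable_funM; last first.
    exact: (rel_share bigraph_lV_measurable bigraph_ladj_measurable theta good_space_measurable (fun x => id)).
  have h1 := rel_special bigraph_lV_measurable bigraph_ladj_measurable theta good_space_measurable (fun x => id) i.
  have h2 := rel_adj bigraph_lV_measurable bigraph_ladj_measurable good_space_measurable i j.
  have := rel_indicator (R := R) (rel_and h1 h2).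
  apply: eq_measurable_fun => x _; congr (nat_of_bool _)%:R.
  by apply/asboolP/andP.
Qed.

Lemma send_load_transport b : transport_fun (transport (send_load b)).
Proof.
apply: transport_transport_fun.
- by move=> g u v gG; rewrite mulr_ge0 // (load_ge0 gG).
- move=> g1 g2 phi u v iso gG gu gv; rewrite /send_load.
  rewrite (iso_load iso gG theta gu); congr ((nat_of_bool _)%:R * _).
  rewrite (asbool_equiv_eq (iso_cluster_finite theta iso gG gu)).
  by apply: asbool_equiv_eq; rewrite (iso_linked theta iso gG gu gv).
- move=> i j; apply: measurable_funM; last first.
    exact: (rel_load bigraph_lV_measurable bigraph_ladj_measurable theta good_space_measurable (fun x => id)).
  have h1 := rel_linked bigraph_lV_measurable bigraph_ladj_measurable theta good_space_measurable (fun x => id) i j.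
  have h2 := rel_cluster_finite bigraph_lV_measurable bigraph_ladj_measurable theta good_space_measurable (fun x => id) i.
  apply: (rel_indicator (R := R) (rel_and h1 _)).
  case: b; first by apply: rel_eq h2 => x _; split => /asboolP.
  apply: rel_eq (rel_not good_space_measurable h2) => x _.
  by split => [/asboolPn/negbTE|/negbT/asboolPn].
Qed.

Lemma send_frontier_transport : transport_fun (transport send_frontier).
Proof.
apply: transport_transport_fun.
- by move=> g u v gG; rewrite mulr_ge0 // invr_ge0.
- move=> g1 g2 phi u v iso gG gu gv; rewrite /send_frontier (iso_cluster_size theta iso gG gu).
  congr ((nat_of_bool _)%:R * _); apply: asbool_equiv_eq.
  by rewrite (iso_frontier theta iso gG gu gv) (iso_cluster_finite theta iso gG gu).
- move=> i j; apply: measurable_funM; last first.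
    have h k := rel_cluster_size bigraph_lV_measurable bigraph_ladj_measurable theta good_space_measurable (fun x => id) i k.
    by apply: (rel_index good_space_measurable (f := fun k _ => k%:R^-1) h) => k.
  have h1 := rel_frontier bigraph_lV_measurable bigraph_ladj_measurable theta good_space_measurable (fun x => id) i j.
  have h2 := rel_cluster_finite bigraph_lV_measurable bigraph_ladj_measurable theta good_space_measurable (fun x => id) i.
  exact: (rel_indicator (R := R) (rel_and h1 h2)).
Qed.

End Sends.

(** * Mass transport *)

Section NonnegativeSums.
Variable R : realType.

Lemma ler_sum_subseq (F : nat -> R) (s t : seq nat) : uniq s -> uniq t -> {subset s <= t} ->
  {in t, forall v, 0 <= F v} -> \sum_(v <- s) F v <= \sum_(v <- t) F v.
Proof.
move=> us ut st F0; have sp : perm_eq s [seq v <- t | v \in s].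
  apply: uniq_perm; rewrite ?filter_uniq // => v.
  by rewrite mem_filter andb_idr // => /st.
rewrite (perm_big _ sp) big_filter [leRHS](bigID (mem s)) /= lerDl.
by rewrite big_seq_cond sumr_ge0 // => v /andP[/F0].
Qed.

Lemma le_nneseries_seq (F : nat -> R) (P : pred nat) (s : seq nat) :
  (forall v, 0 <= F v) -> uniq s -> all P s ->
  ((\sum_(v <- s) F v)%:E <= \sum_(v <oo | P v) (F v)%:E)%E.
Proof.
move=> F0 us Ps; pose n := (\max_(v <- s) v.+1)%N.
apply: le_trans (@nneseries_lim_ge _ (fun v => (F v)%:E) P 0%N n _); last first.
  by move=> v _ _; rewrite lee_fin.
rewrite sumEFin lee_fin -[leRHS]big_filter; apply: ler_sum_subseq => //.
  by rewrite filter_uniq // iota_uniq.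
move=> v vs; rewrite mem_filter (allP Ps) //= mem_index_iota /=.
exact: (leq_bigmax_seq (F := fun v => v.+1)).
Qed.

Lemma nneseries_le_seq (F : nat -> R) (P : pred nat) (B : R) :
  (forall v, 0 <= F v) ->
  (forall s : seq nat, uniq s -> all P s -> \sum_(v <- s) F v <= B) ->
  (\sum_(v <oo | P v) (F v)%:E <= B%:E)%E.
Proof.
move=> F0 h; apply: lime_le.
  by apply: is_cvg_nneseries => v _ _; rewrite lee_fin.
apply: nearW => n; rewrite sumEFin lee_fin -big_filter; apply: h.
  by rewrite filter_uniq // iota_uniq.
by apply/allP => v; rewrite mem_filter => /andP[].
Qed.

(* Unlike [ge0_le_integral], no measurability is needed. *)
Lemma ge0_integral_mono d (T : measurableType d) (mu : {measure set T -> \bar R})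
    (f1 f2 : T -> \bar R) : (forall x, 0 <= f1 x)%E -> (forall x, f1 x <= f2 x)%E ->
  (\int[mu]_x f1 x <= \int[mu]_x f2 x)%E.
Proof.
move=> f0 f12; rewrite !ge0_integralTE //; last by move=> x; exact: le_trans (f12 x).
apply: le_ereal_sup => _ [h hf <-]; exists h => // x; exact: le_trans (hf x) (f12 x).
Qed.

End NonnegativeSums.

Section PointwiseTransport.
Variables (R : realType) (theta : R) (D : nat) (g : lgraph).
Hypothesis gG : goodg D g.

Local Notation w := (atom g theta [::]).
Local Notation ess := (ess g theta).
Local Notation special := (special g (nbr g) theta).
Local Notation share := (share g (nbr g) theta).
Local Notation load := (load g (nbr g) theta).
Local Notation linked := (linked g theta).
Local Notation cluster := (cluster g theta).

Lemma transportE (F : lgraph -> nat -> nat -> R) u v : transport D F (g, u, v) = (F g u v)%:E.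
Proof. by rewrite /transport asboolT. Qed.

Lemma send_share_out o :
  ((special o)%:R%:E <= \sum_(v <oo | lV g v) transport D (send_share theta) (g, o, v))%E.
Proof.
under eq_eseriesr do rewrite transportE.
have s0 v : 0 <= send_share theta g o v by rewrite mulr_ge0 // (share_ge0 gG).
have [so|_] := boolP (special o); last first.
  by apply: nneseries_ge0 => v _ _; rewrite lee_fin.
apply: le_trans (le_nneseries_seq (s := nbr g o) s0 (nb_uniq gG o) _); last first.
  by apply/allP => v; rewrite (nbE gG) => /and3P[].
rewrite lee_fin -(share_sum gG so) big_seq [leRHS]big_seq ler_sum // => v.
by rewrite (nbE gG) /send_share so => -> /=; rewrite mul1r.
Qed.

Lemma send_share_in o :
  (\sum_(v <oo | lV g v) transport D (send_share theta) (g, v, o) <= (load o - w o)%:E)%E.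
Proof.
under eq_eseriesr do rewrite transportE.
have s0 v : 0 <= send_share theta g v o by rewrite mulr_ge0 // (share_ge0 gG).
apply: nneseries_le_seq => // s us _; rewrite /load addrC addrA addNr add0r.
rewrite (bigID (fun v => special v && adj g v o)) /= [X in _ + X]big1 => [|v /negbTE]; last first.
  by rewrite /send_share => ->; rewrite mul0r.
rewrite addr0 -big_filter -[leRHS]big_filter.
rewrite (_ : \sum_(_ <- _) _ = \sum_(v <- [seq v <- s | special v && adj g v o]) share v o).
  apply: ler_sum_subseq => [||v|v _]; rewrite ?filter_uniq ?(nb_uniq gG) //; last exact: (share_ge0 gG).
  by rewrite !mem_filter (nbE gG) (adj_sym gG) => /andP[/andP[-> ->]].
rewrite !big_filter; apply: eq_bigr => v e.
by rewrite /send_share e mul1r.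
Qed.

Lemma load_le1 o : lV g o -> load o <= (ess o)%:R.
Proof.
move=> go; have [eo|neo] := boolP (ess o).
  suff : \sum_(u <- [:: o]) load u <= 1 by rewrite big_seq1.
  apply: (sum_load_le1 gG); rewrite //= ?eo //.
  by move=> u v; rewrite !inE => /eqP -> /eqP ->; exists [::].
rewrite /load big_seq_cond big1 => [|a]; last first.
  by rewrite (nbE gG) => /andP[ao sa]; rewrite (share_ess gG sa) // (nbE gG) (adj_sym gG).
by rewrite addr0 leNgt; move: neo; rewrite /ess go.
Qed.

Lemma cluster_list u (s : seq nat) : uniq s -> (forall v, v \in s -> linked u v) ->
  \sum_(v <- s) load v <= 1.
Proof.
move=> us sl; apply: (sum_load_le1 gG us).
  by apply/allP => v /sl; apply: linked_ess.
by move=> x y /sl ux /sl uy; have [_ [p hp]] := linked_trans (linked_sym gG ux) uy; exists p.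
Qed.

(** [M] is a lower bound for the size of the cluster: the minimal size when the clusters are finite,
    an arbitrary number when they are infinite. *)
Lemma send_load_out (b : bool) (o M : nat) : lV g o ->
  (ess o -> exists s : seq nat, [/\ uniq s, (M <= size s)%N & forall v, v \in s -> linked o v]) ->
  ((M%:R * (load o * (`[< finite_set (cluster o) >] == b)%:R))%:E <=
     \sum_(v <oo | lV g v) transport D (send_load theta b) (g, o, v))%E.
Proof.
move=> go hM; under eq_eseriesr do rewrite transportE.
have l0 : 0 <= load o by exact: (load_ge0 gG).
have s0 v : 0 <= send_load theta b g o v by rewrite mulr_ge0.
have [eo|neo] := boolP (ess o); last first.
  have -> : load o = 0 by apply/eqP; rewrite eq_le l0 andbT; have := load_le1 go; rewrite (negbTE neo).
  by rewrite mul0r mulr0; apply: nneseries_ge0 => v _ _; rewrite lee_fin.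
have [s [us sM sl]] := hM eo; apply: le_trans (le_nneseries_seq (s := s) s0 us _); last first.
  by apply/allP => v /sl /linked_ess /andP[].
rewrite lee_fin (eq_big_seq (fun=> load o * (`[< finite_set (cluster o) >] == b)%:R)) => [|v vs].
  rewrite big_const_seq count_predT iter_addr_0 -[leRHS]mulr_natl ler_wpM2r ?mulr_ge0 //.
  by rewrite ler_nat.
rewrite /send_load mulrC; congr (_ * (nat_of_bool _)%:R).
by apply/asboolP/eqP => [[]|] //; split => //; exact: sl.
Qed.

Lemma send_load_in (b : bool) (o : nat) :
  (\sum_(v <oo | lV g v) transport D (send_load theta b) (g, v, o) <=
    (ess o && (`[< finite_set (cluster o) >] == b))%:R%:E)%E.
Proof.
under eq_eseriesr do rewrite transportE.
have s0 v : 0 <= send_load theta b g v o by rewrite mulr_ge0 // (load_ge0 gG).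
apply: nneseries_le_seq => // s us _.
pose P v := `[< linked v o /\ `[< finite_set (cluster v) >] = b >].
rewrite (bigID P) /= [X in _ + X]big1 => [|v /negbTE]; last first.
  by rewrite /send_load -/(P v) => ->; rewrite mul0r.
rewrite addr0; have [e|ne] := boolP (ess o && (`[< finite_set (cluster o) >] == b)); last first.
  rewrite big1 // => v /asboolP[vo fb]; case/negP: ne; apply/andP; split; first exact: linked_ess vo.
  by rewrite (cluster_eq gG vo) fb.
rewrite -big_filter (eq_big_seq load) => [|v]; last first.
  by rewrite mem_filter => /andP[Pv _]; rewrite /send_load -/(P v) Pv mul1r.
apply: (@cluster_list o); first by rewrite filter_uniq.
by move=> v; rewrite mem_filter => /andP[/asboolP[vo _] _]; exact: linked_sym gG _ _ vo.
Qed.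

Lemma frontier_boundary u : (forall i j, ladj g i j = adj g i j) ->
  vboundary g (cluster u) = [set v | frontier g theta u v].
Proof.
move=> ladjE; apply/seteqP; split=> v [gv [nu [x]]].
  by move=> ux xv; split => //; split => //; exists x; rewrite -ladjE.
by case=> ux xv; split => //; split => //; exists x; rewrite ?ladjE.
Qed.

(** The total sent is the boundary-to-size ratio of the cluster of [o], one of the values over which
    [iso_const] is an infimum. *)
Lemma send_frontier_out (h : R) o : (forall i j, ladj g i j = adj g i j) -> 0 <= h ->
  (h%:E <= iso_const R g)%E ->
  ((h * (ess o && `[< finite_set (cluster o) >])%:R)%:E <=
    \sum_(v <oo | lV g v) transport D (send_frontier theta) (g, o, v))%E.
Proof.
move=> ladjE h0 hi; under eq_eseriesr do rewrite transportE.
have s0 v : 0 <= send_frontier theta g o v by rewrite mulr_ge0 // invr_ge0.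
have [/andP[eo /asboolP fo]|_] := boolP (_ && _); last first.
  by rewrite mulr0; apply: nneseries_ge0 => v _ _; rewrite lee_fin.
have [s [us ss sE]] := cluster_seq fo.
pose t := undup [seq v <- [seq v | x <- s, v <- nbr g x] | v \notin s].
have tE v : v \in t <-> frontier g theta o v.
  rewrite mem_undup mem_filter; split=> [/andP[vs /allpairsPdep[x [y [xs yn e]]]]|].
    move: yn; rewrite -e (nbE gG) => xv; split; first by case/and3P: xv.
    by split; [move=> /sE; apply/negP|exists x; split => //; apply/sE].
  move=> [gv [nv [x [ox xv]]]]; apply/andP; split; first by apply/negP => /sE.
  by apply/allpairsPdep; exists x, v; split => //; [apply/sE|rewrite (nbE gG)].
have cn (A : set nat) (r : seq nat) : uniq r -> (forall v, v \in r <-> A v) ->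
    counting A = ((size r)%:R : R)%:E.
  move=> ur rA; have -> : A = [set` r] by apply/seteqP; split=> v /rA.
  have fr : finite_set [set` r] by exact: finite_seq.
  rewrite /counting asboolT //; congr (_%:R%:E); apply/perm_size/uniq_perm => //.
  by move=> v; rewrite in_fset_set // mem_setE.
have : (iso_const R g <= ((size t)%:R * (size s)%:R^-1)%:E)%E.
  apply: ereal_inf_lbound; exists (cluster o); split => //.
  - by exists o; apply: linked_refl.
  - by move=> v /linked_ess /andP[].
  - rewrite (cn (cluster o) s) // frontier_boundary // (cn _ t) //; exact: undup_uniq.
move=> /(le_trans hi); rewrite lee_fin => ht.
apply: le_trans (le_nneseries_seq (s := t) s0 (undup_uniq _) _); last first.
  by apply/allP => v /tE [].
rewrite mulr1 lee_fin; apply: (le_trans ht).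
rewrite (eq_big_seq (fun=> (size s)%:R^-1)) => [|v vt].
  by rewrite big_const_seq count_predT iter_addr_0 -[leRHS]mulr_natl.
by rewrite /send_frontier asboolT ?mul1r ?ss //; split => //; apply/tE.
Qed.

(** A finite cluster touching [o] sends it at most 1 in all, and each such cluster contains one of
    the at most [D] neighbours of [o]. *)
Lemma send_frontier_in o :
  (\sum_(v <oo | lV g v) transport D (send_frontier theta) (g, v, o) <=
    (D%:R * (special o)%:R)%:E)%E.
Proof.
under eq_eseriesr do rewrite transportE.
have s0 v : 0 <= send_frontier theta g v o by rewrite mulr_ge0 // invr_ge0.
apply: nneseries_le_seq => // s us _.
have [so|/negP nso] := boolP (special o); last first.
  rewrite big1 ?mulr0 // => v _; rewrite /send_frontier asboolF ?mul0r // => -[/(frontier_special gG) sp _].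
  exact: nso sp.
pose F b v := `[< linked b v /\ finite_set (cluster b) >]%:R * (cluster_size g theta b)%:R^-1 : R.
have F0 b v : 0 <= F b v by rewrite mulr_ge0 // invr_ge0.
apply: (@le_trans _ _ (\sum_(v <- s) \sum_(b <- nbr g o) F b v)).
  apply: ler_sum => v _; rewrite /send_frontier; case: asboolP => [|_]; last first.
    by rewrite mul0r sumr_ge0.
  move=> [[_ [_ [b [vb bo]]]] fv]; have bn : b \in nbr g o by rewrite (nbE gG) (adj_sym gG).
  rewrite (bigD1_seq b) ?(nb_uniq gG) //= mul1r {1}/F asboolT; last first.
    by split; [exact: linked_sym gG _ _ vb|rewrite (cluster_eq gG vb)].
  by rewrite mul1r /cluster_size (cluster_eq gG vb) lerDl sumr_ge0.
rewrite exchange_big mulr1 /=; apply: (@le_trans _ _ (\sum_(b <- nbr g o) 1)); last first.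
  by rewrite big_const_seq count_predT iter_addr_0 ler_nat (nb_size gG).
apply: ler_sum => b _; have [fb|nfb] := pselect (finite_set (cluster b)); last first.
  by rewrite big1 // => v _; rewrite /F asboolF ?mul0r // => -[].
have [r [ur rs rE]] := cluster_seq fb.
apply: (@le_trans _ _ (\sum_(v <- [seq v <- s | v \in r]) (size r)%:R^-1)).
  rewrite big_filter [leRHS]big_mkcond ler_sum // => v _; rewrite /F rs; case: asboolP => [[bv _]|_].
    by rewrite mul1r ifT //; apply/rE.
  by rewrite mul0r; case: ifP.
rewrite big_const_seq count_predT iter_addr_0 -[leLHS]mulr_natl.
have [->|r0] := eqVneq (size r) 0%N; first by rewrite invr0 mulr0.
rewrite ler_pdivrMr ?mul1r ?ltr0n ?lt0n // ler_nat; apply: uniq_leq_size.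
  by rewrite filter_uniq.
by move=> v; rewrite mem_filter => /andP[].
Qed.

End PointwiseTransport.

Lemma simple_good g D : simple_graph g -> max_degree_le g D -> goodg D g.
Proof.
move=> [s1 [s2 s3]] dg; have aE i j : adj g i j = ladj g i j.
  by apply/and3P/idP => [[]//|ij]; have /andP[-> ->] := s3 i j ij.
apply/goodgP; split=> [u v|u|u s us sa]; rewrite ?aE //; apply: (dg u) us _.
by apply/allP => v /(allP sa); rewrite aE.
Qed.

Lemma simple_ladjE g i j : simple_graph g -> ladj g i j = adj g i j.
Proof.
move=> [_ [_ s3]]; apply/idP/and3P => [ij|[]//].
by have /andP[-> ->] := s3 i j ij.
Qed.

(** * Inequalities between expectations *)

Section MassTransport.
Variables (R : realType) (d : measure_display) (Omega : measurableType d).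
Variables (P : probability Omega R) (G : Omega -> lgraph) (o : Omega -> nat) (D : nat) (theta : R).
Hypotheses (rG : random_rooted_graph G o) (uG : unimodular P G o).
Hypothesis dG : forall w, max_degree_le (G w) D.

Let gG w : goodg D (G w).
Proof. by apply: simple_good => //; case: rG => + _ => /(_ w)[]. Qed.

Let go w : lV (G w) (o w).
Proof. by case: rG => + _ => /(_ w)[_ []]. Qed.

Let mV i : measurable [set w | lV (G w) i].
Proof. by case: rG => _ [+ _]. Qed.

Let mE i j : measurable [set w | ladj (G w) i j].
Proof. by case: rG => _ [_ [+ _]]. Qed.

Let mo i : measurable ([set: Omega] `&` [set w | o w = i]).
Proof. by rewrite setTI; case: rG => _ [_ [_ +]]. Qed.

(** The form in which unimodularity is used: a pointwise lower bound on the mass sent by the root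
    and an upper bound on the mass it receives become an inequality of expectations. *)
Lemma mass_transport F (f1 f2 : Omega -> R) : transport_fun (transport D F) ->
  (forall w, 0 <= f1 w) ->
  (forall w, ((f1 w)%:E <= \sum_(v <oo | lV (G w) v) transport D F (G w, o w, v))%E) ->
  (forall w, (\sum_(v <oo | lV (G w) v) transport D F (G w, v, o w) <= (f2 w)%:E)%E) ->
  (\int[P]_w (f1 w)%:E <= \int[P]_w (f2 w)%:E)%E.
Proof.
move=> tF f0 h1 h2; have [F0 _] := tF.
apply: le_trans (ge0_integral_mono P _ h1) _; first by move=> w; rewrite lee_fin.
rewrite (uG tF); apply: ge0_integral_mono => // w; exact: nneseries_ge0.
Qed.

Definition mean (f : Omega -> R) : R := fine (\int[P]_w (f w)%:E)%E.

Lemma mean_bounded (f : Omega -> R) : measurable_fun setT f -> (forall w, 0 <= f w) -> (forall w, f w <= 1) ->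
  (\int[P]_w (f w)%:E = (mean f)%:E)%E /\ 0 <= mean f <= 1.
Proof.
move=> mf f0 f1; have i0 : (0 <= \int[P]_w (f w)%:E)%E by apply: integral_ge0 => w _; rewrite lee_fin.
have i1 : (\int[P]_w (f w)%:E <= 1)%E.
  rewrite -(probability_setT P) -[leRHS]mul1e -integral_cst //.
  by apply: ge0_integral_mono => w; rewrite lee_fin.
rewrite /mean; move: i0 i1; case: (\int[P]_w _)%E => [r| |] //.
by rewrite !lee_fin => -> ->.
Qed.

Lemma meanZ (c : R) (f : Omega -> R) : 0 <= c -> measurable_fun setT f -> (forall w, 0 <= f w) ->
  (\int[P]_w (c * f w)%:E = c%:E * \int[P]_w (f w)%:E)%E.
Proof.
move=> c0 mf f0; under eq_integral do rewrite EFinM.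
rewrite ge0_integralZl_EFin // => [w _|]; first by rewrite lee_fin.
exact/measurable_EFinP.
Qed.

Lemma meanD (f1 f2 : Omega -> R) : measurable_fun setT f1 -> measurable_fun setT f2 ->
  (forall w, 0 <= f1 w) -> (forall w, 0 <= f2 w) ->
  (\int[P]_w (f1 w + f2 w)%:E = \int[P]_w (f1 w)%:E + \int[P]_w (f2 w)%:E)%E.
Proof.
move=> m1 m2 p1 p2; under eq_integral do rewrite EFinD.
by rewrite ge0_integralD //; try (by move=> w _; rewrite lee_fin); apply/measurable_EFinP.
Qed.

Let root_special w := special (G w) (nbr (G w)) theta (o w).
Let root_ess w := ess (G w) theta (o w).
Let root_atom w := atom (G w) theta [::] (o w).
Let root_load w := load (G w) (nbr (G w)) theta (o w).
Let root_fin w := `[< finite_set (cluster (G w) theta (o w)) >].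

Let mspecial : measurable_fun setT (fun w => (root_special w)%:R : R).
Proof.
have h i := rel_special mV mE theta measurableT (fun w _ => gG w) i.
have := rel_indicator (R := R) (rel_index_pred mo h).
by apply: eq_measurable_fun => w _; rewrite asboolb.
Qed.

Let matom : measurable_fun setT root_atom.
Proof.
have h i := rel_atom mV mE theta (E := setT) (fun w _ => gG w) [::] i.
exact: (rel_index measurableT (f := fun i w => atom (G w) theta [::] i) mo h).
Qed.

Let mload : measurable_fun setT root_load.
Proof.
have h i := rel_load mV mE theta measurableT (fun w _ => gG w) i.
exact: (rel_index measurableT (f := fun i w => load (G w) (nbr (G w)) theta i) mo h).
Qed.

Let mfin b : measurable_fun setT (fun w => (root_fin w == b)%:R : R).
Proof.
have h i := rel_cluster_finite mV mE theta measurableT (fun w _ => gG w) i.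
have h1 := rel_indicator (R := R) (rel_index_pred mo h).
case: b; first by apply: eq_measurable_fun h1 => w _; rewrite eqb_id.
have := measurable_funB (measurable_cst (1 : R)) h1.
by apply: eq_measurable_fun => w _; rewrite eqbF_neg /root_fin /=; case: asbool; rewrite ?subrr ?subr0.
Qed.

Let mess : measurable_fun setT (fun w => (root_ess w)%:R : R).
Proof.
have h i := rel_ess mV mE theta measurableT (fun w _ => gG w) i.
have := rel_indicator (R := R) (rel_index_pred mo h).
by apply: eq_measurable_fun => w _; rewrite asboolb.
Qed.

Let load0 w : 0 <= root_load w. Proof. exact: (load_ge0 (gG w)). Qed.
Let load1 w : root_load w <= 1.
Proof. by apply: (le_trans (load_le1 theta (gG w) (go w))); case: (ess _ _ _). Qed.
Let loadb0 b w : 0 <= root_load w * (root_fin w == b)%:R. Proof. exact: mulr_ge0. Qed.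
Let loadb1 b w : root_load w * (root_fin w == b)%:R <= 1.
Proof. by case: eqP => _; rewrite ?mulr1 ?mulr0. Qed.
Let mloadb b : measurable_fun setT (fun w => root_load w * (root_fin w == b)%:R).
Proof. exact: measurable_funM. Qed.
Let mclust b : measurable_fun setT (fun w => (root_ess w && (root_fin w == b))%:R : R).
Proof.
have := measurable_funM mess (mfin b); apply: eq_measurable_fun => w _ /=.
by case: (root_ess w); rewrite /= (mul1r, mul0r).
Qed.

Let S := mean (fun w => (root_special w)%:R).
Let A := mean root_atom.
Let L b := mean (fun w => root_load w * (root_fin w == b)%:R).
Let C b := mean (fun w => (root_ess w && (root_fin w == b))%:R).

Let bool01 (b : bool) : 0 <= b%:R :> R /\ b%:R <= 1 :> R. Proof. by case: b. Qed.

Let SE : (\int[P]_w ((root_special w)%:R)%:E = S%:E)%E /\ 0 <= S <= 1.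
Proof. by apply: mean_bounded => // w; case: (bool01 (root_special w)). Qed.

Let AE : (\int[P]_w (root_atom w)%:E = A%:E)%E /\ 0 <= A <= 1.
Proof. by apply: mean_bounded => // w; [exact: (atom_ge0 (gG w))|exact: (atom_le1 (gG w))]. Qed.

Let LE b : (\int[P]_w (root_load w * (root_fin w == b)%:R)%:E = (L b)%:E)%E /\ 0 <= L b <= 1.
Proof. exact: mean_bounded. Qed.

Let CE b : (\int[P]_w ((root_ess w && (root_fin w == b))%:R)%:E = (C b)%:E)%E /\ 0 <= C b <= 1.
Proof. by apply: mean_bounded => // w; case: (bool01 (root_ess w && (root_fin w == b))). Qed.

Let load_out w : 0 <= root_load w - root_atom w.
Proof.
rewrite /root_load /load addrC addrA addNr add0r sumr_ge0 // => a _; exact: (share_ge0 (gG w)).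
Qed.

(** This direction of the balance suffices, since the mean atom is to be bounded from above. *)
Let load_balance : S + A <= L true + L false.
Proof.
have h1 := mass_transport (send_share_transport D theta) (f1 := fun w => (root_special w)%:R)
  (fun w => (bool01 (root_special w)).1) (fun w => send_share_out theta (gG w) (o w))
  (fun w => send_share_in theta (gG w) (o w)).
rewrite -lee_fin !EFinD -SE.1 -AE.1 -(LE true).1 -(LE false).1.
apply: (le_trans (leeD2r _ h1)); rewrite -!meanD //.
- apply: ge0_integral_mono => w; rewrite lee_fin.
    by rewrite addr_ge0 ?load_out // (atom_ge0 (gG w)).
  by rewrite -/(root_load w) -/(root_atom w) subrK -mulrDr; case: root_fin; rewrite /= ?addr0 ?add0r mulr1.
- exact: measurable_funB.
- by move=> w; exact: (atom_ge0 (gG w)).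
Qed.

Let load_clusters b M :
  (forall w, root_ess w -> root_fin w = b -> exists s : seq nat,
    [/\ uniq s, (M <= size s)%N & forall v, v \in s -> linked (G w) theta (o w) v]) ->
  M%:R * L b <= C b.
Proof.
move=> hM; rewrite -lee_fin EFinM -(LE b).1 -(CE b).1 -meanZ //.
apply: (mass_transport (send_load_transport D theta b)) => w.
- by rewrite mulr_ge0.
- have [e|_] := boolP (root_fin w == b).
    rewrite -e; apply: (send_load_out (gG w) _ (go w)) => ew.
    by apply: hM => //; apply/eqP.
  by rewrite !mulr0; apply: nneseries_ge0 => v _ _; have [F0 _] := send_load_transport D theta b.
- exact: send_load_in.
Qed.

(** An infinite cluster contains finite sets of every size [M], so [M] times the mean load is at
    most 1 for all [M]. *)
Let infinite_load : L false = 0.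
Proof.
have h M : M%:R * L false <= 1.
  apply: le_trans (_ : C false <= 1); last by case: (CE false) => _ /andP[].
  apply: load_clusters => w ew /asboolPn nf; have [B Bs Bn] := infinite_set_fset M nf.
  by exists (enum_fset B); split=> [||v]; [exact: fset_uniq|exact: Bn|exact: Bs].
have /andP[l0 _] := (LE false).2; apply/eqP; rewrite eq_le l0 andbT leNgt; apply/negP => l1.
have := archi_boundP (x := (L false)^-1); rewrite invr_ge0 l0 => /(_ isT) lt.
have := h (Num.bound (L false)^-1); rewrite leNgt => /negP; apply.
by rewrite -ltr_pdivrMr // div1r.
Qed.

Let expansion (h : R) : 0 < h -> {ae P, forall w, (h%:E <= iso_const R (G w))%E} ->
  h * C true <= D%:R * S.
Proof.
move=> h0 [N [mN N0 hN]]; rewrite -lee_fin !EFinM -(CE true).1 -SE.1 -!meanZ ?(ltW h0) //;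
  try (by move=> w; case: (bool01 (root_special w)));
  try (by move=> w; case: (bool01 (root_ess w && (root_fin w == true)))).
(* The isoperimetric bound holds almost surely, whereas [mass_transport] asks for pointwise bounds.
   The indicator of the complement of the null set [N] supplies them without changing the
   integral. *)
have -> : (\int[P]_w (h * (root_ess w && (root_fin w == true))%:R)%:E =
    \int[P]_w ((h * (root_ess w && (root_fin w == true))%:R) * \1_(~` N) w)%:E)%E.
  have mNC : measurable_fun setT (\1_(~` N) : Omega -> R).
    by apply: measurable_indic; exact: measurableC.
  apply: ge0_ae_eq_integral => //.
  - by apply/measurable_EFinP; apply: measurable_funM => //; exact: mclust.
  - apply/measurable_EFinP; apply: measurable_funM => //.
    by apply: measurable_funM => //; exact: mclust.
  - by move=> w _; rewrite lee_fin mulr_ge0 // ltW.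
  - by move=> w _; rewrite lee_fin !mulr_ge0 // ltW.
  - exists N; split => // w /= ne; apply: contrapT => nN; apply: ne => _.
    by rewrite indicE mem_set // mulr1.
apply: (mass_transport (send_frontier_transport D theta)) => w.
- by rewrite !mulr_ge0 // ltW.
- have [wN|wN] := pselect (N w).
    rewrite indicE memNset ?mulr0; last by move=> /(_ wN).
    by apply: nneseries_ge0 => v _ _; have [F0 _] := send_frontier_transport D theta.
  have hw : (h%:E <= iso_const R (G w))%E by apply: contrapT => nh; apply: wN; apply: hN.
  rewrite indicE mem_set // mulr1 eqb_id; apply: send_frontier_out => //; last exact: ltW.
  by move=> i j; apply: simple_ladjE; case: rG => + _ => /(_ w)[].
- exact: send_frontier_in.
Qed.

Lemma mean_atom_eq0 (h : R) (N : nat) : 0 < h -> D%:R <= N%:R * h -> (0 < N)%N ->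
  {ae P, forall w, (h%:E <= iso_const R (G w))%E} ->
  (forall w u, ess (G w) theta u -> finite_set (cluster (G w) theta u) ->
     (N <= cluster_size (G w) theta u)%N) ->
  (\int[P]_w (atom (G w) theta [::] (o w))%:E)%E = 0%E.
Proof.
move=> h0 DN N0 hP hN; rewrite AE.1; congr (_%:E).
have h1 := expansion h0 hP; have h2 := load_balance.
have h3 : N%:R * L true <= C true.
  apply: load_clusters => w ew /asboolP fw; have [s [us ss sE]] := cluster_seq fw.
  by exists s; split => // [|v /sE //]; rewrite ss; exact: hN.
rewrite infinite_load addr0 in h2; have /andP[A0 _] := AE.2; have /andP[S0 _] := SE.2.
apply/eqP; rewrite eq_le A0 andbT leNgt; apply/negP => A1.
have n0 : 0 < N%:R * h by rewrite mulr_gt0 // ltr0n.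
(* With L = [L true] and C = [C true], the chain is N h (S + A) <= N h L <= h C <= D S <= N h S. *)
have : (N%:R * h) * (S + A) <= (N%:R * h) * S.
  apply: (@le_trans _ _ (D%:R * S)); last by rewrite ler_wpM2r.
  apply: le_trans h1; apply: (@le_trans _ _ (h * (N%:R * L true))).
    by rewrite mulrA [h * _]mulrC ler_wpM2l // ltW.
  by rewrite ler_wpM2l // ltW.
by rewrite ler_pM2l // leNgt ltrDl A1.
Qed.

End MassTransport.

Lemma cluster_root (R : realType) (theta : R) D g u N : goodg D g -> ess g theta u ->
  finite_set (cluster g theta u) -> (cluster_size g theta u < N)%N ->
  exists (K : seq nat) (e : rel nat), [/\ uniq K, (size K < N)%N, forall u v, e u v = e v u
    & mu (fun=> theta%:C) (fun u v => (e u v)%:R : R[i]) K = 0].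
Proof.
move=> gG eu fu; have [s [us <- sE]] := cluster_seq fu => sN.
exists s, (adj g); split => //; first exact: adj_sym gG.
have uins : u \in s by apply/sE; exact: linked_refl.
have <- : mu (fun=> theta%:C) (fun u v => (ew R g u v)%:C) s = 0.
  apply: (finite_component_root gG us) => [||x y /sE ux].
  - by apply: contraTneq uins => ->.
  - by apply/allP => v /sE; exact: linked_ess.
  - by rewrite (nbE gG) => xy ey; apply/sE; exact: linked_step ux xy ey.
by apply: eq_mu => // x y _ _; rewrite /ew rmorph_nat.
Qed.

Theorem theorem6p6 (R : realType) (d : measure_display) (Omega : measurableType d)
  (P : probability Omega R) (G : Omega -> lgraph) (o : Omega -> nat) (D : nat)
  (h : R) (nu : Omega -> probability R R) :
  random_rooted_graph G o ->
  unimodular P G o ->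
  (forall w, max_degree_le (G w) D) ->
  0 < h ->
  {ae P, forall w, (h%:E <= iso_const R (G w))%E} ->
  (forall w, matching_measure (G w) (o w) (nu w)) ->
  finite_set [set x : R | (0 < \int[P]_w (nu w [set x]))%E].
Proof.
move=> rG uG dG h0 hP hnu.
(* An integer at least D / h; the successor makes its positivity hold by computation. *)
pose N := (Num.bound (D%:R / h)).+1.
have DN : D%:R <= N%:R * h.
  rewrite -ler_pdivrMr //; apply: le_trans (ltW (archi_boundP _)) _; first by rewrite divr_ge0 // ltW.
  by rewrite ler_nat leqnSn.
apply: (sub_finite_set _ (finite_roots R N)) => theta /= th; apply: contrapT => nroot.
have gG w : simple_graph (G w) /\ goodg D (G w).
  by case: rG => + _ => /(_ w)[sg _]; split => //; exact: simple_good.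
have gN w u : ess (G w) theta u -> finite_set (cluster (G w) theta u) ->
    (N <= cluster_size (G w) theta u)%N.
  move=> eu fu; rewrite leqNgt; apply/negP => lt; apply: nroot.
  exact: cluster_root (gG w).2 eu fu lt.
have A0 := mean_atom_eq0 rG uG dG h0 DN isT hP gN.
move: th; rewrite -A0 ltNge => /negP; apply; apply: ge0_integral_mono => [w|w].
  exact: measure_ge0.
rewrite -(fineK (fin_num_measure (nu w) _ (measurable_set1 theta))) lee_fin.
have [sg gg] := gG w; apply: (matching_atom_le theta gg) => // [|i j].
  by case: rG => + _ => /(_ w)[_ []].
exact: simple_ladjE.
Qed.
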